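(* $\mathsf{RCA}_0\vdash\mathsf{SR}\to\mathsf{CR}$. Thus $\mathsf{SR}$ and $\mathsf{CR}$ are equivalent over $\mathsf{RCA}_0$.
   Context: $\mathsf{RCA}_0$ is the theory in the language of second-order arithmetic with axioms: the basic axioms $\mathsf{PA}^-$ of Peano arithmetic (the natural numbers form a discretely ordered commutative semiring with $1$); the $\Sigma^0_1$ induction scheme, i.e. the universal closures of $(\varphi(0)\wedge\forall n(\varphi(n)\to\varphi(n+1)))\to\forall n\,\varphi(n)$ for $\varphi$ a $\Sigma^0_1$ formula; and the $\Delta^0_1$ comprehension scheme, i.e. the universal closures of $\forall n(\varphi(n)\leftrightarrow\psi(n))\to\exists X\forall n(n\in X\leftrightarrow\varphi(n))$ for $\varphi$ a $\Sigma^0_1$ and $\psi$ a $\Pi^0_1$ formula with $X$ not free in $\varphi$. Set parameters are allowed in formulas. All definitions below are made inside $\mathsf{RCA}_0$. $\mathbb{N}$ is the (possibly nonstandard) first-order part. Finite strings, finite sets and rationals are coded as usual; reals are coded by rapidly converging Cauchy sequences of rationals; $\leq_{\mathrm T}$ is Turing reducibility. $2^{<\mathbb{N}}$ is the set of finite binary strings, $|\sigma|$ is the length of $\sigma$, $X\restriction n=\langle X(0),\dots,X(n-1)\rangle$, $\sigma^{\frown}\tau$ is concatenation. For a set $B$ of strings, $X\in[B]$ means some $\sigma\in B$ is an initial segment of $X$. Open sets: A code for a $\mathbf{\Sigma^0_1}$ (open) set $\mathcal U$ is a sequence $(B_i)_{i\in\mathbb{N}}$ of coded finite subsets of $2^{<\mathbb{N}}$;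 a uniform sequence of $\Sigma^{0,Z}_1$ sets is coded by a double sequence $(B_{n,i})_{n,i\in\mathbb{N}}\leq_{\mathrm T}Z$ of coded finite subsets of $2^{<\mathbb{N}}$. $X\in\mathcal U$ means $\exists i\,(X\in[B_i])$. For finite $B\subseteq 2^{<\mathbb{N}}$, $\mu(B)=\sum_{\sigma\in\widehat B}2^{-|\sigma|}$, where $\widehat B$ is the set of $\sigma\in B$ with no proper initial segment in $B$. $\mu(\mathcal U)=\lim_m\mu(\bigcup_{i\leq m}B_i)$ if the limit exists; $\mu(\mathcal U)\leq r$ means $\forall m\,(\mu(\bigcup_{i\leq m}B_i)\leq r)$. Schnorr randomness: A Schnorr test relative to $Z$ is a uniform sequence $(\mathcal U_n)_{n\in\mathbb{N}}$ of $\Sigma^{0,Z}_1$ sets with $\forall n\,(\mu(\mathcal U_n)\leq 2^{-n})$ such that additionally the measures exist and $(\mu(\mathcal U_n))_{n\in\mathbb{N}}\leq_{\mathrm T}Z$. $X$ is Schnorr random relative to $Z$ if $X\notin\bigcap_n\mathcal U_n$ for every Schnorr test relative to $Z$. $\mathsf{SR}$ is the statement ''for every $Z$ there is an $X$ that is Schnorr random relative to $Z$.'' Computable randomness: A supermartingale is a function $S\colon 2^{<\mathbb{N}}\to\mathbb{Q}^{\geq 0}$ with $S(\sigma^{\frown} 0)+S(\sigma^{\frown} 1)\leq 2S(\sigma)$ for all $\sigma$. $S$ succeeds on $X$ if $\forall k\exists n\,(S(X\restriction n)>k)$. $X$ is computably random relative to $Z$ if no supermartingale $S\leq_{\mathrm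 T}Z$ succeeds on $X$. $\mathsf{CR}$ is the statement ''for every $Z$ there is an $X$ that is computably random relative to $Z$.'' *)

(* Defs.v *)
From Stdlib Require Import List.
Import ListNotations.

(** * The language of second-order arithmetic

    Two-sorted first-order syntax with de Bruijn indices; number variables and
    set variables are indexed independently.  The only set terms are set
    variables, and equality is primitive for numbers only. *)

Inductive tm : Type :=
| TVar (n : nat)
| TZero
| TOne
| TAdd (t u : tm)
| TMul (t u : tm).

Inductive fm : Type :=
| FEq (t u : tm)
| FLt (t u : tm)
| FIn (t : tm) (X : nat)
| FBot
| FImp (p q : fm)
| FAllN (p : fm)
| FAllS (p : fm).

Definition FNot (p : fm) : fm := FImp p FBot.
Definition FAnd (p q : fm) : fm := FNot (FImp p (FNot q)).
Definition FOr (p q : fm) : fm := FImp (FNot p) q.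
Definition FIff (p q : fm) : fm := FAnd (FImp p q) (FImp q p).
Definition FExN (p : fm) : fm := FNot (FAllN (FNot p)).
Definition FExS (p : fm) : fm := FNot (FAllS (FNot p)).

Fixpoint tsub (s : nat -> tm) (t : tm) : tm :=
  match t with
  | TVar n => s n
  | TZero => TZero
  | TOne => TOne
  | TAdd t u => TAdd (tsub s t) (tsub s u)
  | TMul t u => TMul (tsub s t) (tsub s u)
  end.

Definition tshift : tm -> tm := tsub (fun n => TVar (S n)).

Definition upN (s : nat -> tm) (n : nat) : tm :=
  match n with 0 => TVar 0 | S n => tshift (s n) end.

Definition upS (r : nat -> nat) (n : nat) : nat :=
  match n with 0 => 0 | S n => S (r n) end.

(** Simultaneous substitution of terms for number variables and of set
    variables for set variables. *)
Fixpoint fsub (s : nat -> tm) (r : nat -> nat) (p : fm) : fm :=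
  match p with
  | FEq t u => FEq (tsub s t) (tsub s u)
  | FLt t u => FLt (tsub s t) (tsub s u)
  | FIn t X => FIn (tsub s t) (r X)
  | FBot => FBot
  | FImp p q => FImp (fsub s r p) (fsub s r q)
  | FAllN p => FAllN (fsub (upN s) r p)
  | FAllS p => FAllS (fsub s (upS r) p)
  end.

Definition shiftN : fm -> fm := fsub (fun n => TVar (S n)) (fun X => X).
Definition shiftS : fm -> fm := fsub TVar S.

Definition instN (p : fm) (t : tm) : fm :=
  fsub (fun n => match n with 0 => t | S n => TVar n end) (fun X => X) p.
Definition instS (p : fm) (Y : nat) : fm :=
  fsub TVar (fun X => match X with 0 => Y | S X => X end) p.

(** * Provability: classical natural deduction with equality *)

Inductive nd : list fm -> fm -> Prop :=
| nd_hyp G p : In p G -> nd G p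
| nd_impI G p q : nd (p :: G) q -> nd G (FImp p q)
| nd_impE G p q : nd G (FImp p q) -> nd G p -> nd G q
| nd_raa G p : nd (FNot p :: G) FBot -> nd G p
| nd_allNI G p : nd (map shiftN G) p -> nd G (FAllN p)
| nd_allNE G p t : nd G (FAllN p) -> nd G (instN p t)
| nd_allSI G p : nd (map shiftS G) p -> nd G (FAllS p)
| nd_allSE G p Y : nd G (FAllS p) -> nd G (instS p Y)
| nd_refl G t : nd G (FEq t t)
| nd_subst G p t u : nd G (FEq t u) -> nd G (instN p t) -> nd G (instN p u).

Definition provable (T : fm -> Prop) (p : fm) : Prop :=
  exists G : list fm, (forall q, In q G -> T q) /\ nd G p.

(** * Named binders

    To write concrete formulas without computing indices, expressions are
    functions of the number of enclosing number quantifiers and formulas are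
    functions of the numbers of enclosing number and set quantifiers.  A
    variable bound under [d] quantifiers has index [d' - S d] when it is used
    under [d'] quantifiers. *)

Definition nexp := nat -> tm.
Definition sexp := nat -> nat.
Definition frm := nat -> nat -> fm.

Definition allN (f : nexp -> frm) : frm :=
  fun d s => FAllN (f (fun d' => TVar (d' - S d)) (S d) s).
Definition exN (f : nexp -> frm) : frm :=
  fun d s => FExN (f (fun d' => TVar (d' - S d)) (S d) s).
Definition allS (f : sexp -> frm) : frm :=
  fun d s => FAllS (f (fun s' => s' - S s) d (S s)).
Definition exS (f : sexp -> frm) : frm :=
  fun d s => FExS (f (fun s' => s' - S s) d (S s)).

Definition sentence (p : frm) : fm := p 0 0.

Declare Scope so_scope.
Delimit Scope so_scope with so.
Bind Scope so_scope with nexp sexp frm.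

Notation "0" := ((fun _ => TZero) : nexp) : so_scope.
Notation "1" := ((fun _ => TOne) : nexp) : so_scope.
Notation "x + y" := ((fun d => TAdd (x d) (y d)) : nexp) : so_scope.
Notation "x * y" := ((fun d => TMul (x d) (y d)) : nexp) : so_scope.
Notation "x = y" := ((fun d _ => FEq (x d) (y d)) : frm) : so_scope.
Notation "x < y" := ((fun d _ => FLt (x d) (y d)) : frm) : so_scope.
Notation "x ∈ X" := ((fun d s => FIn (x d) (X s)) : frm)
  (at level 70, no associativity) : so_scope.
Notation "p --> q" := ((fun d s => FImp (p d s) (q d s)) : frm)
  (at level 90, right associativity) : so_scope.
Notation "p <--> q" := ((fun d s => FIff (p d s) (q d s)) : frm)
  (at level 95, no associativity) : so_scope.
Notation "p /\ q" := ((fun d s => FAnd (p d s) (q d s)) : frm) : so_scope.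
Notation "p \/ q" := ((fun d s => FOr (p d s) (q d s)) : frm) : so_scope.
Notation "~ p" := ((fun d s => FNot (p d s)) : frm) : so_scope.
Notation "x <= y" := ((x < y) \/ (x = y))%so : so_scope.
Notation "'All' x .. y , p" := (allN (fun x => .. (allN (fun y => p%so)) ..))
  (at level 200, x binder, y binder, right associativity) : so_scope.
Notation "'Ex' x .. y , p" := (exN (fun x => .. (exN (fun y => p%so)) ..))
  (at level 200, x binder, y binder, right associativity) : so_scope.
Notation "'AllS' X .. Y , p" := (allS (fun X => .. (allS (fun Y => p%so)) ..))
  (at level 200, X binder, Y binder, right associativity) : so_scope.
Notation "'ExS' X .. Y , p" := (exS (fun X => .. (exS (fun Y => p%so)) ..))
  (at level 200, X binder, Y binder, right associativity) : so_scope.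

(** * The axioms of RCA_0 *)

Definition PAminus : list fm := map sentence [
  (All x y z, (x + y) + z = x + (y + z));
  (All x y, x + y = y + x);
  (All x y z, (x * y) * z = x * (y * z));
  (All x y, x * y = y * x);
  (All x y z, x * (y + z) = x * y + x * z);
  (All x, x + 0 = x);
  (All x, x * 0 = 0);
  (All x, x * 1 = x);
  (All x y z, x < y --> y < z --> x < z);
  (All x, ~ (x < x));
  (All x y, x < y \/ x = y \/ y < x);
  (All x y z, x < y --> x + z < y + z);
  (All x y z, 0 < z --> x < y --> x * z < y * z);
  (All x y, x < y --> Ex z, x + z = y);
  (0 < 1);
  (All x, 0 < x --> 1 <= x);
  (All x, 0 <= x)
]%so.

(** Bounded formulas; the bound [t] may not contain the quantified variable.
    Bounded existential quantification is [~ (forall n < t) ~], and the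
    remaining connectives are definable from [FImp] and [FBot]. *)
Definition FBall (t : tm) (p : fm) : fm := FAllN (FImp (FLt (TVar 0) (tshift t)) p).

Inductive Delta0 : fm -> Prop :=
| D0_eq t u : Delta0 (FEq t u)
| D0_lt t u : Delta0 (FLt t u)
| D0_in t X : Delta0 (FIn t X)
| D0_bot : Delta0 FBot
| D0_imp p q : Delta0 p -> Delta0 q -> Delta0 (FImp p q)
| D0_ball t p : Delta0 p -> Delta0 (FBall t p).

Definition Sigma1 (p : fm) : Prop := exists q, Delta0 q /\ p = FExN q.
Definition Pi1 (p : fm) : Prop := exists q, Delta0 q /\ p = FAllN q.

(** [fbelow m k p]: the free number (set) variables of [p] have index below
    [m] ([k]). *)
Fixpoint tbelow (m : nat) (t : tm) : Prop :=
  match t with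
  | TVar n => n < m
  | TZero | TOne => True
  | TAdd t u | TMul t u => tbelow m t /\ tbelow m u
  end.

Fixpoint fbelow (m k : nat) (p : fm) : Prop :=
  match p with
  | FEq t u | FLt t u => tbelow m t /\ tbelow m u
  | FIn t X => tbelow m t /\ X < k
  | FBot => True
  | FImp p q => fbelow m k p /\ fbelow m k q
  | FAllN p => fbelow (S m) k p
  | FAllS p => fbelow m (S k) p
  end.

Definition is_closure (p c : fm) : Prop :=
  exists m k, fbelow m k p /\ c = Nat.iter m FAllN (Nat.iter k FAllS p).

(** In both schemes the distinguished variable [n] is number variable 0. *)
Definition induction_ax (p : fm) : fm :=
  let p_succ := fsub (fun n => match n with
                               | 0 => TAdd (TVar 0) TOne
                               | S n => TVar (S n)
                               end) (fun X => X) p in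
  FImp (FAnd (instN p TZero) (FAllN (FImp p p_succ))) (FAllN p).

Definition comprehension_ax (p q : fm) : fm :=
  FImp (FAllN (FIff p q)) (FExS (FAllN (FIff (FIn (TVar 0) 0) (shiftS p)))).

Inductive RCA0 : fm -> Prop :=
| RCA0_basic p : In p PAminus -> RCA0 p
| RCA0_induction p c :
    Sigma1 p -> is_closure (induction_ax p) c -> RCA0 c
| RCA0_comprehension p q c :
    Sigma1 p -> Pi1 q -> is_closure (comprehension_ax p q) c -> RCA0 c.

Local Open Scope so_scope.

(** * Coding of finite objects *)

Definition num (n : nat) : nexp := fun _ => Nat.iter n (fun t => TAdd t TOne) TZero.

(** The injective polynomial pairing (x + y)^2 + x. *)
Definition pr (x y : nexp) : nexp := (x + y) * (x + y) + x.

(** Every number [c] codes a finite set: the code (k,(m,n)) stands for the set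
    of all x < k such that m(x+1)+1 divides n, and other numbers stand for the
    empty set. *)
Definition mem (x c : nexp) : frm :=
  Ex k m n, c = pr k (pr m n) /\ x < k /\ Ex w, n = w * (m * (x + 1) + 1).

(** [prim_rec base step n y]: there is a finite sequence from a value
    satisfying [base] to [y] in [n] steps; [step i v u] relates the value [v]
    at [i] to the value [u] at [i + 1].  The sequence is a coded finite set of
    pairs, each of which is justified by another one. *)
Definition prim_rec (base : nexp -> frm) (step : nexp -> nexp -> nexp -> frm)
    (n y : nexp) : frm :=
  Ex c, mem (pr n y) c /\
    All i u, mem (pr i u) c -->
      (i = 0 /\ base u) \/
      Ex j v, i = j + 1 /\ mem (pr j v) c /\ step j v u.

(** p = 2^n *)
Definition exp2 (n p : nexp) : frm :=
  prim_rec (fun u => u = 1) (fun _ v u => u = v + v) n p.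

(** ** Functions and sequences

    A function is a set of pairs; only its pairs with first component in the
    domain matter. *)
Definition is_fun (dom cod : nexp -> frm) (F : sexp) : frm :=
  All x, dom x -->
    Ex y, pr x y ∈ F /\ cod y /\ All z, pr x z ∈ F --> z = y.

Definition is_pair (x : nexp) : frm := Ex n i, x = pr n i.

(** ** Binary strings

    The string b_0 ... b_(n-1) is the number with binary expansion
    1 b_0 ... b_(n-1): the empty string is 1, and s^0, s^1 are 2s, 2s+1. *)
Definition is_string (s : nexp) : frm := 0 < s.
Definition app0 (s : nexp) : nexp := s + s.
Definition app1 (s : nexp) : nexp := s + s + 1.

(** |s| = n *)
Definition len (s n : nexp) : frm :=
  Ex p, exp2 n p /\ p <= s /\ s < p + p.

(** [t] is a proper initial segment of [s]. *)
Definition proper_prefix (t s : nexp) : frm :=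
  ~ (t = s) /\ Ex k p r, exp2 k p /\ r < p /\ s = t * p + r.

(** s is the restriction of X to n, where X(i) = 1 iff i is in X *)
Definition restr (X : sexp) (n s : nexp) : frm :=
  prim_rec (fun u => u = 1)
    (fun i v u => (i ∈ X /\ u = app1 v) \/ (~ (i ∈ X) /\ u = app0 v)) n s.

(** A finite set of strings. *)
Definition is_string_set (b : nexp) : frm := All s, mem s b --> is_string s.

(** X is in [b]. *)
Definition in_cyl (X : sexp) (b : nexp) : frm :=
  Ex n s, restr X n s /\ mem s b.

(** ** Rationals

    [Rat a b c] is the rational (a - b)/c, where c > 0.  Codes of rationals
    are not unique; equality of rationals is [req]. *)
Record rat := Rat { rpos : nexp; rneg : nexp; rden : nexp }.

Definition qcode (x : rat) : nexp := pr (pr (rpos x) (rneg x)) (rden x).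

Definition allQ (f : rat -> frm) : frm := All a b c, 0 < c --> f (Rat a b c).
Definition exQ (f : rat -> frm) : frm := Ex a b c, 0 < c /\ f (Rat a b c).
Notation "'AllQ' x .. y , p" := (allQ (fun x => .. (allQ (fun y => p%so)) ..))
  (at level 200, x binder, y binder, right associativity) : so_scope.
Notation "'ExQ' x .. y , p" := (exQ (fun x => .. (exQ (fun y => p%so)) ..))
  (at level 200, x binder, y binder, right associativity) : so_scope.

Definition rnat (n : nexp) : rat := Rat n 0 1.
Definition rinv (n : nexp) : rat := Rat 1 0 n.
Definition ropp (x : rat) : rat := Rat (rneg x) (rpos x) (rden x).
Definition radd (x y : rat) : rat :=
  Rat (rpos x * rden y + rpos y * rden x)
      (rneg x * rden y + rneg y * rden x)
      (rden x * rden y).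
Definition rsub (x y : rat) : rat := radd x (ropp y).
Definition rle (x y : rat) : frm :=
  rpos x * rden y + rneg y * rden x <= rpos y * rden x + rneg x * rden y.
Definition rlt (x y : rat) : frm :=
  rpos x * rden y + rneg y * rden x < rpos y * rden x + rneg x * rden y.
Definition req (x y : rat) : frm := rle x y /\ rle y x.

(** |x| <= y *)
Definition rabs_le (x y : rat) : frm := rle x y /\ rle (ropp x) y.

(** ** Reals and limits

    A sequence of rationals is given by its graph [q], [q k x] meaning that
    the [k]-th term is [x]. *)

(** |q_k - q_l| <= 2^-k for all k <= l *)
Definition rapid (q : nexp -> rat -> frm) : frm :=
  All k l p, k <= l --> exp2 k p -->
    AllQ x y, q k x --> q l y --> rabs_le (rsub x y) (rinv p).

(** |a - r| <= e for the real r coded by q; since |r - q_k| <= 2^-k, this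
    holds iff |a - q_k| <= e + 2^-k for all k. *)
Definition dist_le (a : rat) (q : nexp -> rat -> frm) (e : rat) : frm :=
  All k p, exp2 k p --> AllQ x, q k x -->
    rabs_le (rsub a x) (radd e (rinv p)).

(** The rationals a_m converge to the real coded by q. *)
Definition converges (a q : nexp -> rat -> frm) : frm :=
  All k p, exp2 k p -->
    Ex M, All m, M <= m --> AllQ x, a m x --> dist_le x q (rinv p).

(** * Turing reducibility

    Indices of partial recursive functionals, with z the oracle:
      (0,0) zero                 (1,0) successor
      (2,0) (a,b) |-> a          (3,0) (a,b) |-> b
      (4,0) characteristic function of z
      (5,(f,g)) x |-> (f x, g x)
      (6,(f,g)) x |-> f (g x)
      (7,(f,g)) primitive recursion:
                (a,0) |-> f a,  (a,n+1) |-> g (a,(n, h (a,n)))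
      (8,f)     x |-> least n with f (x,n) = 0
    where h is the function being defined.  A computation is a finite set of
    triples (e,(x,y)), read as "e converges on x with value y", each of which
    is justified by other triples of the set.  A justification always passes
    to smaller indices, or to a smaller recursion argument of the same index,
    so there are no circular computations. *)
Definition trip (e x y : nexp) : nexp := pr e (pr x y).

Definition justified (Z : sexp) (D e x y : nexp) : frm :=
  (e = pr (num 0) 0 /\ y = 0) \/
  (e = pr (num 1) 0 /\ y = x + 1) \/
  (e = pr (num 2) 0 /\ Ex b, x = pr y b) \/
  (e = pr (num 3) 0 /\ Ex a, x = pr a y) \/
  (e = pr (num 4) 0 /\ ((x ∈ Z /\ y = 1) \/ (~ (x ∈ Z) /\ y = 0))) \/
  (Ex f g, e = pr (num 5) (pr f g) /\
     Ex u v, y = pr u v /\ mem (trip f x u) D /\ mem (trip g x v) D) \/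
  (Ex f g, e = pr (num 6) (pr f g) /\
     Ex u, mem (trip g x u) D /\ mem (trip f u y) D) \/
  (Ex f g, e = pr (num 7) (pr f g) /\
     Ex a, (x = pr a 0 /\ mem (trip f a y) D) \/
           Ex n u, x = pr a (n + 1) /\ mem (trip e (pr a n) u) D /\
                   mem (trip g (pr a (pr n u)) y) D) \/
  (Ex f, e = pr (num 8) f /\ mem (trip f (pr x y) 0) D /\
     All n, n < y --> Ex u, mem (trip f (pr x n) u) D /\ 0 < u).

Definition computes (Z : sexp) (e x y : nexp) : frm :=
  Ex D, mem (trip e x y) D /\
    All e' x' y', mem (trip e' x' y') D --> justified Z D e' x' y'.

(** X is Turing reducible to Z. *)
Definition leT (X Z : sexp) : frm :=
  Ex e, All n, (n ∈ X --> computes Z e n 1) /\ (~ (n ∈ X) --> computes Z e n 0).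

(** * Open sets and their measure *)

(** [s] is in the set of minimal elements of [b]. *)
Definition minimal (s b : nexp) : frm :=
  mem s b /\ ~ (Ex t, mem t b /\ proper_prefix t s).

(** mu(b) = x.  Partial sums over the minimal elements of [b] below j = 0, 1,
    ..., b; every element of the set coded by [b] is smaller than [b]. *)
Definition fin_measure (b : nexp) (x : rat) : frm :=
  prim_rec (fun u => ExQ y, u = qcode y /\ req y (rnat 0))
    (fun j v u => ExQ y z, v = qcode y /\ u = qcode z /\
       ((minimal j b /\ Ex l p, len j l /\ exp2 l p /\ req z (radd y (rinv p)))
        \/ (~ minimal j b /\ req z y)))
    b (qcode x).

(** A uniform sequence of open sets: F(n,i) codes the finite set B_(n,i). *)
Definition open_seq (F : sexp) : frm := is_fun is_pair is_string_set F.

(** X is in the n-th open set. *)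
Definition in_open (X F : sexp) (n : nexp) : frm :=
  Ex i b, pr (pr n i) b ∈ F /\ in_cyl X b.

(** mu(B_(n,0) u ... u B_(n,m)) = x *)
Definition stage_measure (F : sexp) (n m : nexp) (x : rat) : frm :=
  Ex c, (All s, mem s c <--> Ex i b, i <= m /\ pr (pr n i) b ∈ F /\ mem s b) /\
        fin_measure c x.

(** The measure of the n-th open set is at most r. *)
Definition measure_le (F : sexp) (n : nexp) (r : rat) : frm :=
  All m, ExQ x, stage_measure F n m x /\ rle x r.

(** * Schnorr randomness *)

(** R is a sequence of reals, R(n,k) coding the k-th rational approximation of
    the n-th real. *)
Definition real_term (R : sexp) (n k : nexp) (x : rat) : frm :=
  pr (pr n k) (qcode x) ∈ R.

Definition real_seq (R : sexp) : frm :=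
  is_fun is_pair (fun y => ExQ x, y = qcode x) R /\
  All n, rapid (real_term R n).

Definition schnorr_test (F Z : sexp) : frm :=
  open_seq F /\ leT F Z /\
  (All n p, exp2 n p --> measure_le F n (rinv p)) /\
  ExS R, real_seq R /\ leT R Z /\
    All n, converges (stage_measure F n) (real_term R n).

Definition schnorr_random (X Z : sexp) : frm :=
  AllS F, schnorr_test F Z --> ~ (All n, in_open X F n).

Definition SR : fm := sentence (AllS Z, ExS X, schnorr_random X Z).

(** * Computable randomness *)

Definition supermartingale (S : sexp) : frm :=
  is_fun is_string (fun y => ExQ x, y = qcode x /\ rle (rnat 0) x) S /\
  All s, is_string s --> AllQ x y z,
    pr (app0 s) (qcode x) ∈ S --> pr (app1 s) (qcode y) ∈ S -->
    pr s (qcode z) ∈ S --> rle (radd x y) (radd z z).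

Definition succeeds (S X : sexp) : frm :=
  All k, Ex n s, restr X n s /\
    ExQ x, pr s (qcode x) ∈ S /\ rlt (rnat k) x.

Definition computably_random (X Z : sexp) : frm :=
  AllS S, supermartingale S --> leT S Z --> ~ succeeds S X.

Definition CR : fm := sentence (AllS Z, ExS X, computably_random X Z).

(* Main.v *)
(** By Goedel's completeness theorem it suffices to argue in an arbitrary model of
    RCA_0; its numbers have an ordered field of fractions, in which measures and
    capitals live.

    SR -> CR: let X be Schnorr random relative to Z and let a supermartingale
    B <=_T Z succeed on X.  The function f(k) = least n with B(X|n) > C 2^k dominates
    every Z-computable g: by Kolmogorov's inequality the strings of length < g(k)
    where B exceeds C 2^k have measure at most 2^-k, so these sets form a Schnorr
    test, and X would fail it.  Hence f eventually bounds the search for the values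
    of any Z-computable supermartingale, and from Z and X together one computes a
    single supermartingale that is a weighted sum of all of them: the share of an
    index is kept as long as the values converge within f and are fair.  Any path
    along which this sum never increases is computably random relative to Z.

    CR -> SR: a Schnorr test U yields the supermartingale
    s |-> sum_n 2^n mu(U_3n | s) (+ a vanishing correction), where mu(U_3n) is replaced by
    the measure of a stage found from the measures that come with the test. *)

From HB Require Import structures.
From mathcomp Require Import all_boot all_order all_algebra.
From mathcomp Require Import boolp.
From mathcomp Require Import ring lra.
From Stdlib Require Import Lia.
From Stdlib Require List PeanoNat.
Require Import Defs.
Set Implicit Arguments.
Unset Strict Implicit.
Unset Printing Implicit Defensive.

(** * Completeness of the deduction system *)

Module Import Completeness.
Import List PeanoNat.

(** A Schnorr random set need not be computably random, so [CR_of_SR] argues by cases: if some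
    supermartingale succeeds on [X], it builds another set [Y] from [Z] and [X]. The obstacle is
    that the Z-computable supermartingales cannot be listed effectively, since totality and fairness
    of an index are undecidable and RCA_0 has no jump. Domination supplies convergence bounds, but
    only from some length n0 on; therefore the sum runs over pairs of an index and a starting
    length. Players yet to enter are paid out of a reserve 2^-|s|, so no infinite sum is formed.

    Numbers may be nonstandard and only Sigma_1 induction is available. Internal inductions are thus
    on Delta_0 predicates, on predicates computable in some oracle, or on Sigma_1 statements over
    these, and every object must be shown computable; the tactics [d0] and [comp] do this along the
    syntax of an expression. Kolmogorov's inequality for finite sets of strings, applied to suitable
    supermartingales, also yields monotonicity and subadditivity of the measure. *)

Definition scons {A : Type} (a : A) (f : nat -> A) (n : nat) : A :=
  match n with O => a | S n => f n end.

Lemma tsub_comp s s' t : tsub s (tsub s' t) = tsub (fun n => tsub s (s' n)) t.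
Proof. by elim: t => //= t -> u ->. Qed.

Lemma tsub_id t : tsub TVar t = t.
Proof. by elim: t => //= t -> u ->. Qed.

Lemma upN_comp s s' : upN (fun n => tsub s (s' n)) = fun n => tsub (upN s) (upN s' n).
Proof. by apply: funext; case=> //= n; rewrite /tshift !tsub_comp. Qed.

Lemma upS_comp r r' : upS (fun n => r (r' n)) = fun n => upS r (upS r' n).
Proof. by apply: funext; case. Qed.

Lemma fsub_comp p s r s' r' :
  fsub s r (fsub s' r' p) = fsub (fun n => tsub s (s' n)) (fun n => r (r' n)) p.
Proof.
elim: p s r s' r' => //= [t u|t u|t X|p IHp q IHq|p IHp|p IHp] s r s' r'.
- by rewrite !tsub_comp.
- by rewrite !tsub_comp.
- by rewrite !tsub_comp.
- by rewrite IHp IHq.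
- by rewrite IHp -(upN_comp s s').
- by rewrite IHp -(upS_comp r r').
Qed.

Lemma fsub_id p : fsub TVar (fun n => n) p = p.
Proof.
have uN : upN TVar = TVar by apply: funext; case.
have uS : upS (fun n => n) = fun n => n by apply: funext; case.
by elim: p => //= [t u|t u|t X|p -> q ->|p IH|p IH]; rewrite ?tsub_id ?uN ?uS ?IH.
Qed.

Lemma instN_sub s r p t :
  fsub s r (instN p t) = instN (fsub (upN s) r p) (tsub s t).
Proof.
rewrite /instN !fsub_comp; congr fsub; apply: funext; case=> //= n.
by rewrite /tshift tsub_comp /= tsub_id.
Qed.

Lemma instS_sub s r p Y :
  fsub s r (instS p Y) = instS (fsub s (upS r) p) (r Y).
Proof.
rewrite /instS !fsub_comp; congr fsub; last by apply: funext; case.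
by apply: funext => n /=; rewrite tsub_id.
Qed.

Lemma shiftN_sub s r p : shiftN (fsub s r p) = fsub (upN s) r (shiftN p).
Proof. by rewrite /shiftN !fsub_comp. Qed.

Lemma shiftS_sub s r p : shiftS (fsub s r p) = fsub s (upS r) (shiftS p).
Proof.
rewrite /shiftS !fsub_comp; congr fsub.
by apply: funext => n /=; rewrite tsub_id.
Qed.

(** The quantifier rules express their eigenvariable as a shift of the context, and shifts commute
    with lifted substitutions, so the induction goes through. Its later use is to move a fresh
    variable to the bound index 0. *)
Lemma nd_sub G p s r : nd G p -> nd (map (fsub s r) G) (fsub s r p).
Proof.
move=> H; elim: H s r => {G p} /=.
- by move=> G p Hp s r; apply: nd_hyp; apply: in_map.
- by move=> G p q _ IH s r; apply: nd_impI; apply: IH.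
- by move=> G p q _ IH1 _ IH2 s r; apply: nd_impE (IH1 s r) (IH2 s r).
- by move=> G p _ IH s r; apply: nd_raa; apply: (IH s r).
- move=> G p _ IH s r; apply: nd_allNI.
  move: (IH (upN s) r); rewrite !List.map_map.
  by under List.map_ext do rewrite -shiftN_sub.
- by move=> G p t _ IH s r; rewrite instN_sub; apply: nd_allNE; apply: IH.
- move=> G p _ IH s r; apply: nd_allSI.
  move: (IH s (upS r)); rewrite !List.map_map.
  by under List.map_ext do rewrite -shiftS_sub.
- by move=> G p t _ IH s r; rewrite instS_sub; apply: nd_allSE; apply: IH.
- by move=> G t s r; apply: nd_refl.
- move=> G p t u _ IH1 _ IH2 s r; rewrite instN_sub.
  by apply: nd_subst (IH1 s r) _; rewrite -instN_sub.
Qed.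

Lemma nd_weak G G' p : nd G p -> incl G G' -> nd G' p.
Proof.
move=> H; elim: H G' => {G p}.
- by move=> G p Hp G' I; apply: nd_hyp; apply: I.
- move=> G p q _ IH G' I; apply: nd_impI; apply: IH => x [->|Hx]; first by left.
  by right; apply: I.
- by move=> G p q _ IH1 _ IH2 G' I; apply: nd_impE (IH1 _ I) (IH2 _ I).
- move=> G p _ IH G' I; apply: nd_raa; apply: IH => x [->|Hx]; first by left.
  by right; apply: I.
- by move=> G p _ IH G' I; apply: nd_allNI; apply: IH; apply: incl_map.
- by move=> G p t _ IH G' I; apply: nd_allNE; apply: IH.
- by move=> G p _ IH G' I; apply: nd_allSI; apply: IH; apply: incl_map.
- by move=> G p t _ IH G' I; apply: nd_allSE; apply: IH.
- by move=> *; apply: nd_refl.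
- by move=> G p t u _ IH1 _ IH2 G' I; apply: nd_subst (IH1 _ I) (IH2 _ I).
Qed.

Lemma tsub_below m s s' t :
  tbelow m t -> (forall n, lt n m -> s n = s' n) -> tsub s t = tsub s' t.
Proof.
elim: t => //= [n|t IHt u IHu|t IHt u IHu] H E.
- exact: E.
- by case: H => Ht Hu; rewrite IHt ?IHu.
- by case: H => Ht Hu; rewrite IHt ?IHu.
Qed.

Lemma fsub_below m k p s r s' r' :
  fbelow m k p -> (forall n, lt n m -> s n = s' n) -> (forall n, lt n k -> r n = r' n) ->
  fsub s r p = fsub s' r' p.
Proof.
elim: p m k s r s' r' => //= [t u|t u|t X|p IHp q IHq|p IHp|p IHp] m k s r s' r' H E F.
- by case: H => Ht Hu; rewrite (tsub_below Ht E) (tsub_below Hu E).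
- by case: H => Ht Hu; rewrite (tsub_below Ht E) (tsub_below Hu E).
- by case: H => Ht Hu; rewrite (tsub_below Ht E) (F _ Hu).
- by case: H => Hp Hq; rewrite (IHp _ _ _ _ _ _ Hp E F) (IHq _ _ _ _ _ _ Hq E F).
- congr FAllN; apply: IHp H _ F => -[|n] //= Hn; rewrite E //; lia.
- congr FAllS; apply: IHp H E _ => -[|n] //= Hn; rewrite F //; lia.
Qed.

Lemma tbelow_mono m m' t : tbelow m t -> le m m' -> tbelow m' t.
Proof.
elim: t => //= [n|t IHt u IHu|t IHt u IHu] H L; [lia|by case: H; auto|by case: H; auto].
Qed.

Lemma fbelow_mono m k m' k' p : fbelow m k p -> le m m' -> le k k' -> fbelow m' k' p.
Proof.
elim: p m k m' k' => //= [t u|t u|t X|p IHp q IHq|p IHp|p IHp] m k m' k' H L1 L2.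
- by case: H => /tbelow_mono Ht /tbelow_mono Hu; auto.
- by case: H => /tbelow_mono Ht /tbelow_mono Hu; auto.
- by case: H => /tbelow_mono Ht Hu; split; [auto|lia].
- by case: H; split; [apply: IHp L1 L2|apply: IHq L1 L2].
- by apply: IHp H _ L2; lia.
- by apply: IHp H L1 _; lia.
Qed.

Lemma tbelow_ex t : exists m, tbelow m t.
Proof.
elim: t => //= [n||| t [m Ht] u [m' Hu]|t [m Ht] u [m' Hu]].
- by exists (S n); lia.
- by exists 0.
- by exists 0.
- by exists (m + m')%coq_nat; split; [apply: tbelow_mono Ht _|apply: tbelow_mono Hu _]; lia.
- by exists (m + m')%coq_nat; split; [apply: tbelow_mono Ht _|apply: tbelow_mono Hu _]; lia.
Qed.

Lemma fbelow_ex p : exists m, fbelow m m p.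
Proof.
elim: p => //= [t u|t u|t X||p [m Hp] q [m' Hq]|p [m Hp]|p [m Hp]].
- have [m Ht] := tbelow_ex t; have [m' Hu] := tbelow_ex u.
  by exists (m + m')%coq_nat; split; [apply: tbelow_mono Ht _|apply: tbelow_mono Hu _]; lia.
- have [m Ht] := tbelow_ex t; have [m' Hu] := tbelow_ex u.
  by exists (m + m')%coq_nat; split; [apply: tbelow_mono Ht _|apply: tbelow_mono Hu _]; lia.
- have [m Ht] := tbelow_ex t.
  by exists (m + S X)%coq_nat; split; [apply: tbelow_mono Ht _|]; lia.
- by exists 0.
- by exists (m + m')%coq_nat; split; [apply: fbelow_mono Hp _ _|apply: fbelow_mono Hq _ _]; lia.
- by exists m; apply: fbelow_mono Hp _ _; lia.
- by exists m; apply: fbelow_mono Hp _ _; lia.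
Qed.

Lemma fbelow_exl (G : list fm) : exists m, forall p, In p G -> fbelow m m p.
Proof.
elim: G => [|p G [m H]]; first by exists 0.
have [m' Hp] := fbelow_ex p; exists (m + m')%coq_nat => q [<-|Hq].
- by apply: fbelow_mono Hp _ _; lia.
- by apply: fbelow_mono (H _ Hq) _ _; lia.
Qed.

Definition closed (p : fm) := fbelow 0 0 p.

Lemma closed_sub p s r : closed p -> fsub s r p = p.
Proof. by move=> H; rewrite -{2}(fsub_id p); apply: fsub_below H _ _ => n; lia. Qed.

(** Generic trees over [nat] are countable, so injecting terms and formulas into them numbers all
    formulas for the Henkin construction. *)
Fixpoint tm_tree (t : tm) : GenTree.tree nat :=
  match t with
  | TVar n => GenTree.Leaf n
  | TZero => GenTree.Node 0 [::]
  | TOne => GenTree.Node 1 [::]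
  | TAdd t u => GenTree.Node 2 [:: tm_tree t; tm_tree u]
  | TMul t u => GenTree.Node 3 [:: tm_tree t; tm_tree u]
  end.

Fixpoint fm_tree (p : fm) : GenTree.tree nat :=
  match p with
  | FEq t u => GenTree.Node 0 [:: tm_tree t; tm_tree u]
  | FLt t u => GenTree.Node 1 [:: tm_tree t; tm_tree u]
  | FIn t X => GenTree.Node 2 [:: tm_tree t; GenTree.Leaf X]
  | FBot => GenTree.Node 3 [::]
  | FImp p q => GenTree.Node 4 [:: fm_tree p; fm_tree q]
  | FAllN p => GenTree.Node 5 [:: fm_tree p]
  | FAllS p => GenTree.Node 6 [:: fm_tree p]
  end.

Lemma tm_tree_inj : injective tm_tree.
Proof.
elim=> [n|||t IHt u IHu|t IHt u IHu] [m|||t' u'|t' u'] //=.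
- by case=> ->.
- by case=> /IHt -> /IHu ->.
- by case=> /IHt -> /IHu ->.
Qed.

Lemma fm_tree_inj : injective fm_tree.
Proof.
elim=> [t u|t u|t X||p IHp q IHq|p IHp|p IHp] [t' u'|t' u'|t' X'||p' q'|p'|p'] //=.
- by case=> /tm_tree_inj -> /tm_tree_inj ->.
- by case=> /tm_tree_inj -> /tm_tree_inj ->.
- by case=> /tm_tree_inj -> ->.
- by case=> /IHp -> /IHq ->.
- by case=> /IHp ->.
- by case=> /IHp ->.
Qed.

Definition fm_code (p : fm) : nat := pickle (fm_tree p).

Lemma fm_code_inj : injective fm_code.
Proof. by move=> p q /(pcan_inj pickleK) /fm_tree_inj. Qed.

Record structure := Structure {
  num_of : Type;
  set_of : Type;
  zero_of : num_of;
  one_of : num_of;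
  add_of : num_of -> num_of -> num_of;
  mul_of : num_of -> num_of -> num_of;
  lt_of : num_of -> num_of -> Prop;
  in_of : num_of -> set_of -> Prop }.

Fixpoint eval (M : structure) (rho : nat -> num_of M) (t : tm) : num_of M :=
  match t with
  | TVar n => rho n
  | TZero => zero_of M
  | TOne => one_of M
  | TAdd t u => add_of (eval rho t) (eval rho u)
  | TMul t u => mul_of (eval rho t) (eval rho u)
  end.

Fixpoint sat (M : structure) (rho : nat -> num_of M) (eta : nat -> set_of M) (p : fm) : Prop :=
  match p with
  | FEq t u => eval rho t = eval rho u
  | FLt t u => lt_of (eval rho t) (eval rho u)
  | FIn t X => in_of (eval rho t) (eta X)
  | FBot => False
  | FImp p q => sat rho eta p -> sat rho eta q
  | FAllN p => forall x, sat (scons x rho) eta p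
  | FAllS p => forall A, sat rho (scons A eta) p
  end.

(** * Henkin extension and term model *)

Section Henkin.
Variable T : fm -> Prop.
Hypothesis T_closed : forall p, T p -> closed p.

(** The axioms used are kept apart from the context [G]: being closed, they are untouched by the
    shifts and substitutions that act on [G]. *)
Definition proves (G : list fm) (p : fm) : Prop :=
  exists GT, (forall q, In q GT -> T q) /\ nd (GT ++ G) p.

Lemma proves_weak G G' p : proves G p -> incl G G' -> proves G' p.
Proof.
move=> [GT [HT H]] I; exists GT; split=> //; apply: nd_weak H _.
by apply: incl_app; [apply: incl_appl; apply: incl_refl|apply: incl_appr].
Qed.

Lemma proves_hyp G p : In p G -> proves G p.
Proof. by move=> H; exists nil; split=> //; apply: nd_hyp. Qed.

Lemma proves_T G p : T p -> proves G p.
Proof. by move=> H; exists [:: p]; split=> [q [<-|]|] //; apply: nd_hyp; left. Qed.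

Lemma proves_impE G p q : proves G (FImp p q) -> proves G p -> proves G q.
Proof.
move=> [GT [HT H]] [GT' [HT' H']]; exists (GT ++ GT'); split.
  by move=> x Hx; case: (in_app_or _ _ _ Hx); auto.
apply: (@nd_impE _ p).
- apply: nd_weak H _ => x Hx; apply: in_or_app.
  by case: (in_app_or _ _ _ Hx) => ?; [left; apply: in_or_app; left|right].
- apply: nd_weak H' _ => x Hx; apply: in_or_app.
  by case: (in_app_or _ _ _ Hx) => ?; [left; apply: in_or_app; right|right].
Qed.

Lemma proves_map G p q :
  (forall GT, nd (GT ++ G) p -> nd (GT ++ G) q) -> proves G p -> proves G q.
Proof. by move=> H [GT [HT K]]; exists GT; split=> //; apply: H. Qed.

Lemma proves_impI G p q : proves (p :: G) q -> proves G (FImp p q).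
Proof.
move=> [GT [HT K]]; exists GT; split=> //; apply: nd_impI; apply: nd_weak K _ => x Hx.
case: (in_app_or _ _ _ Hx) => [?|[->|?]]; [right|left|right] => //; apply: in_or_app; auto.
Qed.

Lemma proves_raa G p : proves (FNot p :: G) FBot -> proves G p.
Proof.
move=> /proves_impI; apply: proves_map => GT H; apply: nd_raa.
apply: (@nd_impE _ (FNot p)); last by apply: nd_hyp; left.
by apply: nd_weak H _; apply: incl_tl; apply: incl_refl.
Qed.

Lemma proves_exf G p : proves G FBot -> proves G p.
Proof. by move=> H; apply: proves_raa; apply: proves_weak H _; apply: incl_tl; apply: incl_refl. Qed.

Lemma map_closed s r GT : (forall q, In q GT -> T q) -> map (fsub s r) GT = GT.
Proof.
elim: GT => //= p GT IH H; rewrite IH; last by move=> q Hq; apply: H; right.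
by rewrite closed_sub //; apply: T_closed; apply: H; left.
Qed.

(** The substitution [s] sends the fresh variable [m] to index 0 and shifts all others. On formulas
    below [m] it is the shift demanded by the rule, and on the instance it undoes [instN]. *)
Lemma fresh_allN m G p : (forall q, In q G -> fbelow m m q) -> fbelow m m (FAllN p) ->
  proves G (instN p (TVar m)) -> proves G (FAllN p).
Proof.
move=> HG Hp [GT [HT H]]; exists GT; split=> //; apply: nd_allNI.
pose s n := if n =? m then TVar 0 else TVar (S n).
move: (nd_sub s id H); rewrite !List.map_app map_closed //.
rewrite [map shiftN GT]map_closed //.
have -> : map (fsub s id) G = map shiftN G.
  apply: List.map_ext_in => q Hq; apply: fsub_below (HG _ Hq) _ _ => // n Hn.
  by rewrite /s (proj2 (Nat.eqb_neq _ _)) //; lia.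
suff -> : fsub s id (instN p (TVar m)) = p by [].
rewrite /instN fsub_comp -{2}(fsub_id p); apply: (@fsub_below (S m) m) => // -[|n] Hn /=.
- by rewrite /s Nat.eqb_refl.
- by rewrite /s (proj2 (Nat.eqb_neq _ _)) //; lia.
Qed.

Lemma fresh_allS m G p : (forall q, In q G -> fbelow m m q) -> fbelow m m (FAllS p) ->
  proves G (instS p m) -> proves G (FAllS p).
Proof.
move=> HG Hp [GT [HT H]]; exists GT; split=> //; apply: nd_allSI.
pose r n := if n =? m then 0 else S n.
move: (nd_sub TVar r H); rewrite !List.map_app map_closed //.
rewrite [map shiftS GT]map_closed //.
have -> : map (fsub TVar r) G = map shiftS G.
  apply: List.map_ext_in => q Hq; apply: fsub_below (HG _ Hq) _ _ => // n Hn.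
  by rewrite /r (proj2 (Nat.eqb_neq _ _)) //; lia.
suff -> : fsub TVar r (instS p m) = p by [].
rewrite /instS fsub_comp -{2}(fsub_id p); apply: (@fsub_below m (S m)) => // -[|n] Hn /=.
- by rewrite /r Nat.eqb_refl.
- by rewrite /r (proj2 (Nat.eqb_neq _ _)) //; lia.
Qed.

(** A negated universal statement gets a named counterexample; any other formula is returned as it
    is, so that adding it next to [p] changes nothing. *)
Definition witness (m : nat) (p : fm) : fm :=
  match p with
  | FImp (FAllN q) FBot => FNot (instN q (TVar m))
  | FImp (FAllS q) FBot => FNot (instS q m)
  | _ => p
  end.

Definition fresh (G : list fm) : nat := projT1 (cid (fbelow_exl G)).

Lemma freshP G p : In p G -> fbelow (fresh G) (fresh G) p.
Proof. by rewrite /fresh; case: cid => /= m; apply. Qed.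

Lemma witnessP m p : witness m p = p \/
  (exists q, p = FNot (FAllN q) /\ witness m p = FNot (instN q (TVar m))) \/
  (exists q, p = FNot (FAllS q) /\ witness m p = FNot (instS q m)).
Proof.
case: p; auto=> q q'; case: q'; case: q; auto => q.
- by right; left; exists q.
- by right; right; exists q.
Qed.

(** If the named counterexample were refutable, the instance at a fresh variable would be provable,
    hence the universal statement, against its negation [p] in the context. *)
Lemma witness_cons G p : ~ proves (p :: G) FBot ->
  ~ proves (witness (fresh (p :: G)) p :: p :: G) FBot.
Proof.
set m := fresh _ => C.
have Fr q : In q (p :: G) -> fbelow m m q by exact: freshP.
have Hp : In p (p :: G) by left.
have [->|[[q [E ->]]|[q [E ->]]]] := witnessP m p => H; apply: C.
- by apply: proves_weak H _ => x /= [<-|//]; left.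
- move: (Fr _ Hp); rewrite {1}E => -[B _]; move: H => /proves_raa H.
  have := fresh_allN Fr B H.
  by apply: proves_impE; apply: proves_hyp; left.
- move: (Fr _ Hp); rewrite {1}E => -[B _]; move: H => /proves_raa H.
  have := fresh_allS Fr B H.
  by apply: proves_impE; apply: proves_hyp; left.
Qed.

Variable p0 : fm.
Hypothesis p0_unprovable : ~ proves [:: FNot p0] FBot.

Definition extend (G : list fm) (p : fm) : list fm :=
  if pselect (proves (p :: G) FBot) then G else witness (fresh (p :: G)) p :: p :: G.

(** Stage [n] treats the formula with code [n], when there is one, so every formula is decided at
    the stage given by its own code. *)
Definition extend_code (G : list fm) (n : nat) : list fm :=
  if pselect (exists p, fm_code p = n) is left E then extend G (projT1 (cid E)) else G.

Fixpoint stage (n : nat) : list fm :=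
  match n with O => [:: FNot p0] | S n => extend_code (stage n) n end.

Definition hk (p : fm) : Prop := exists n, proves (stage n) p.

Lemma extend_codeE G p : extend_code G (fm_code p) = extend G p.
Proof.
rewrite /extend_code; case: pselect => [E|[]]; last by exists p.
by case: cid => q /= /fm_code_inj ->.
Qed.

Lemma extend_incl G p : incl G (extend G p).
Proof. by rewrite /extend => x Hx; case: (pselect _) => H //; right; right. Qed.

Lemma stage_mono n m : le n m -> incl (stage n) (stage m).
Proof.
move=> L; induction L as [|j _ IH]; first exact: incl_refl.
apply: incl_tran IH _ => /=; rewrite /extend_code.
by case: pselect => [E|_]; [apply: extend_incl|apply: incl_refl].
Qed.

Lemma extend_cons G p : ~ proves G FBot -> ~ proves (extend G p) FBot.
Proof. by rewrite /extend; case: pselect => // C _; apply: witness_cons. Qed.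

Lemma stage_cons n : ~ proves (stage n) FBot.
Proof.
elim: n => //= n IH; rewrite /extend_code; case: pselect => // E; apply: extend_cons.
exact: IH.
Qed.

Lemma hk_cons : ~ hk FBot.
Proof. by case=> n /stage_cons. Qed.

Lemma hk_up n m p : proves (stage n) p -> le n m -> proves (stage m) p.
Proof. by move=> H L; apply: proves_weak H (stage_mono L). Qed.

Lemma hk_mp p q : hk (FImp p q) -> hk p -> hk q.
Proof.
move=> [n H] [m K]; exists (n + m)%coq_nat.
by apply: proves_impE (hk_up H _) (hk_up K _); lia.
Qed.

Lemma hk_map p q : (forall G, proves G p -> proves G q) -> hk p -> hk q.
Proof. by move=> H [n K]; exists n; apply: H. Qed.

Lemma hk_all p : (forall G, proves G p) -> hk p.
Proof. by move=> H; exists 0; apply: H. Qed.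

Lemma hk_dec p : hk p \/ hk (FNot p).
Proof.
have := extend_codeE (stage (fm_code p)) p; rewrite /extend; case: pselect => H E.
- by right; exists (fm_code p); apply: proves_impI.
- by left; exists (S (fm_code p)); rewrite /= E; apply: proves_hyp; right; left.
Qed.

Lemma hk_imp p q : hk (FImp p q) <-> (hk p -> hk q).
Proof.
split=> [|H]; first exact: hk_mp.
have [/H|] := hk_dec p; apply: hk_map => G K.
- by apply: proves_impI; apply: proves_weak K _; apply: incl_tl; apply: incl_refl.
- apply: proves_impI; apply: proves_exf; apply: (@proves_impE _ p).
  + by apply: proves_weak K _; apply: incl_tl; apply: incl_refl.
  + by apply: proves_hyp; left.
Qed.

Lemma hk_not p : hk (FNot p) -> ~ hk p.
Proof. by move=> H K; apply: hk_cons; apply: hk_mp H K. Qed.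

Lemma hk_witness p : hk p -> exists m, hk (witness m p).
Proof.
move=> Hp; have := extend_codeE (stage (fm_code p)) p; rewrite /extend; case: pselect => H E.
- by case: hk_cons; apply: hk_mp Hp; exists (fm_code p); apply: proves_impI.
- exists (fresh (p :: stage (fm_code p))).
  by exists (S (fm_code p)); rewrite /= E; apply: proves_hyp; left.
Qed.

Lemma hk_allN p : hk (FAllN p) <-> forall t, hk (instN p t).
Proof.
split=> [H t|H]; first by apply: hk_map H => G; apply: proves_map => GT; apply: nd_allNE.
have [//|/[dup] /hk_not K /hk_witness[m] /= W] := hk_dec (FAllN p).
by case: (hk_not W (H _)).
Qed.

Lemma hk_allS p : hk (FAllS p) <-> forall Y, hk (instS p Y).
Proof.
split=> [H t|H]; first by apply: hk_map H => G; apply: proves_map => GT; apply: nd_allSE.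
have [//|/[dup] /hk_not K /hk_witness[m] /= W] := hk_dec (FAllS p).
by case: (hk_not W (H _)).
Qed.

Definition teq (t u : tm) : Prop := hk (FEq t u).

Lemma teq_refl t : teq t t.
Proof. by apply: hk_all => G; exists nil; split=> //; apply: nd_refl. Qed.

Lemma teq_subst p t u : teq t u -> hk (instN p t) -> hk (instN p u).
Proof.
move=> [n H] [m K]; exists (n + m)%coq_nat.
have [GT [HT {}H]] := hk_up H (Nat.le_add_r n m).
have [GT' [HT' {}K]] : proves (stage (n + m)%coq_nat) (instN p t) by apply: hk_up K _; lia.
exists (GT ++ GT'); split; first by move=> x Hx; case: (in_app_or _ _ _ Hx); auto.
apply: (@nd_subst _ _ t).
- apply: nd_weak H _ => x Hx; apply: in_or_app.
  by case: (in_app_or _ _ _ Hx) => ?; [left; apply: in_or_app; left|right].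
- apply: nd_weak K _ => x Hx; apply: in_or_app.
  by case: (in_app_or _ _ _ Hx) => ?; [left; apply: in_or_app; right|right].
Qed.

Lemma instN_tshift t u : tsub (fun n => match n with O => u | S n => TVar n end) (tshift t) = t.
Proof. by rewrite /tshift tsub_comp /= tsub_id. Qed.

Lemma teq_sym t u : teq t u -> teq u t.
Proof.
move=> H; have := @teq_subst (FEq (TVar 0) (tshift t)) _ _ H.
by rewrite /instN /= !instN_tshift; apply; apply: teq_refl.
Qed.

Lemma teq_trans t u v : teq t u -> teq u v -> teq t v.
Proof.
move=> H K; have := @teq_subst (FEq (tshift t) (TVar 0)) _ _ K.
by rewrite /instN /= !instN_tshift; apply.
Qed.

Definition tclass (t : tm) : tm -> Prop := teq t.

Lemma tclassE t u : tclass t = tclass u <-> teq t u.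
Proof.
split=> [E|H]; first by rewrite -/(tclass t u) E; apply: teq_refl.
apply: funext => v; apply: propext; split; first exact: teq_trans (teq_sym H).
exact: teq_trans H.
Qed.

(** Equality is interpreted as identity, so numbers are classes of provably equal terms. Sets will
    be the set variables themselves, because the language has no equality of sets. *)
Definition tnum : Type := {c : tm -> Prop | exists t, c = tclass t}.
Definition toN (t : tm) : tnum := exist _ (tclass t) (ex_intro _ t erefl).
Definition ofN (c : tnum) : tm := projT1 (cid (proj2_sig c)).

Lemma ofNK c : toN (ofN c) = c.
Proof.
by rewrite /ofN; case: cid => t /=; case: c => c H /= E; apply: eq_exist.
Qed.

Lemma toN_eq t u : toN t = toN u <-> teq t u.
Proof.
rewrite -tclassE; split=> [[]//|E]; exact: eq_exist.
Qed.

Lemma toN_of t : teq (ofN (toN t)) t.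
Proof. by apply/toN_eq; rewrite ofNK. Qed.

Definition term_model : structure := {|
  num_of := tnum; set_of := nat;
  zero_of := toN TZero; one_of := toN TOne;
  add_of := fun c d => toN (TAdd (ofN c) (ofN d));
  mul_of := fun c d => toN (TMul (ofN c) (ofN d));
  lt_of := fun c d => hk (FLt (ofN c) (ofN d));
  in_of := fun c X => hk (FIn (ofN c) X) |}.

Lemma teq_cong (f : tm -> tm -> tm) t t' u u' :
  (forall s t u, tsub s (f t u) = f (tsub s t) (tsub s u)) ->
  teq t t' -> teq u u' -> teq (f t u) (f t' u').
Proof.
move=> E Ht Hu; apply: (@teq_trans _ (f t' u)).
- have := @teq_subst (FEq (tshift (f t u)) (f (TVar 0) (tshift u))) _ _ Ht.
  by rewrite /instN /= !E !instN_tshift; apply; apply: teq_refl.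
- have := @teq_subst (FEq (tshift (f t' u)) (f (tshift t') (TVar 0))) _ _ Hu.
  by rewrite /instN /= !E !instN_tshift; apply; apply: teq_refl.
Qed.

Lemma eval_term s t : eval (M := term_model) (fun n => toN (s n)) t = toN (tsub s t).
Proof.
elim: t => //= t -> u ->; apply/toN_eq; apply: teq_cong => //; exact: toN_of.
Qed.

(** Every number of the term model is the class of a term, so a quantifier ranges over instances,
    and [hk_allN] and [hk_allS], which rest on the Henkin witnesses, govern these. *)
Lemma truth p s r : sat (M := term_model) (fun n => toN (s n)) r p <-> hk (fsub s r p).
Proof.
elim: p s r => /= [t u|t u|t X||p IHp q IHq|p IHp|p IHp] s r.
- by rewrite !eval_term toN_eq.
- rewrite !eval_term; set t' := tsub s t; set u' := tsub s u.
  have R v v' w w' : teq v v' -> teq w w' -> hk (FLt v w) -> hk (FLt v' w').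
    move=> Hv Hw H; have := @teq_subst (FLt (TVar 0) (tshift w)) _ _ Hv.
    rewrite /instN /= !instN_tshift => /(_ H) K.
    by have := @teq_subst (FLt (tshift v') (TVar 0)) _ _ Hw; rewrite /instN /= !instN_tshift; apply.
  by split; [apply: R; apply: toN_of|apply: R; apply: teq_sym; apply: toN_of].
- rewrite !eval_term; split=> H.
  + by have := @teq_subst (FIn (TVar 0) (r X)) _ _ (toN_of (tsub s t)); apply.
  + by have := @teq_subst (FIn (TVar 0) (r X)) _ _ (teq_sym (toN_of (tsub s t))); apply.
- by split=> // /hk_cons.
- by rewrite hk_imp -IHp -IHq.
- have E t : scons (toN t) (fun n => toN (s n)) = fun n => toN (scons t s n).
    by apply: funext; case.
  rewrite hk_allN; split=> [H t|H c].
  + move: (H (toN t)); rewrite E IHp /instN fsub_comp; congr (hk (fsub _ _ _)).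
    by apply: funext; case=> //= n; rewrite instN_tshift.
  + rewrite -(ofNK c) E IHp; move: (H (ofN c)); rewrite /instN fsub_comp; congr (hk (fsub _ _ _)).
    by apply: funext; case=> //= n; rewrite instN_tshift.
- have F Y : fsub s (scons Y r) p = instS (fsub s (upS r) p) Y.
    rewrite /instS fsub_comp; congr fsub; apply: funext; last by case.
    by move=> n; rewrite tsub_id.
  rewrite hk_allS; split=> [H Y|H Y].
  + by rewrite -F -IHp.
  + by rewrite IHp F.
Qed.

Lemma term_model_sat : (forall p, T p -> forall rho eta, sat (M := term_model) rho eta p) /\
  exists rho eta, ~ sat (M := term_model) rho eta p0.
Proof.
split=> [p Hp rho eta|].
- have -> : rho = fun n => toN (ofN (rho n)) by apply: funext => n; rewrite ofNK.
  rewrite truth closed_sub; last exact: T_closed.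
  by exists 0; apply: proves_T.
- exists (fun n => toN (TVar n)), id; rewrite truth -[id]/(fun n => n) fsub_id.
  by apply: hk_not; exists 0; apply: proves_hyp; left.
Qed.
End Henkin.

Lemma completeness (T : fm -> Prop) (p : fm) :
  (forall q, T q -> closed q) ->
  (forall M : structure, (forall q, T q -> forall rho eta, @sat M rho eta q) ->
     forall rho eta, @sat M rho eta p) ->
  provable T p.
Proof.
move=> C H; apply: contrapT => N.
have U : ~ proves T [:: FNot p] FBot.
  by move=> /proves_raa[GT [HT K]]; apply: N; exists GT; rewrite cats0 in K.
have [S [rho [eta]]] := term_model_sat C U.
by apply; apply: H.
Qed.
End Completeness.

Import Order.TTheory GRing.Theory Num.Theory.
Local Open Scope ring_scope.

(** * Models and their fraction fields *)

(** The set [inh] is the default value of finite set assignments and serves as oracle wherever no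
    particular one is needed. *)
Record model := Model {
  str :> structure;
  inh : set_of str;
  model_sat : forall q, RCA0 q -> forall rho eta, @sat str rho eta q }.

Section SatConnectives.
Variables (M : structure) (rho : nat -> num_of M) (eta : nat -> set_of M).
Implicit Types p q : fm.

Lemma sat_and p q : sat rho eta (FAnd p q) <-> sat rho eta p /\ sat rho eta q.
Proof.
rewrite /FAnd /=; split=> [H|[Hp Hq] H]; last exact: H.
by split; apply: contrapT => N; apply: H => Hp; [case: (N Hp)|move=> Hq; case: (N Hq)].
Qed.
Lemma sat_or p q : sat rho eta (FOr p q) <-> sat rho eta p \/ sat rho eta q.
Proof.
rewrite /FOr /=; split=> [H|[Hp N|Hq _] //].
by have [Hp|Hp] := pselect (sat rho eta p); [left|right; apply: H].
Qed.
Lemma sat_iff p q : sat rho eta (FIff p q) <-> (sat rho eta p <-> sat rho eta q).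
Proof. by rewrite sat_and /=; split=> -[]. Qed.
Lemma sat_exN p : sat rho eta (FExN p) <-> exists x, sat (scons x rho) eta p.
Proof.
rewrite /FExN /=; split=> [H|[x Hx] H]; last exact: H Hx.
by apply: contrapT => N; apply: H => x Hx; apply: N; exists x.
Qed.
Lemma sat_exS p : sat rho eta (FExS p) <-> exists A, sat rho (scons A eta) p.
Proof.
rewrite /FExS /=; split=> [H|[x Hx] H]; last exact: H Hx.
by apply: contrapT => N; apply: H => x Hx; apply: N; exists x.
Qed.
End SatConnectives.

(** * Ordered semiring laws from the basic axioms *)

Section BasicFacts.
Variable M : model.
Local Notation N := (num_of M).
Local Notation "x ⊕ y" := (@add_of M x y) (at level 50, left associativity).
Local Notation "x ⊗ y" := (@mul_of M x y) (at level 40, left associativity).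
Local Notation "x ≺ y" := (@lt_of M x y) (at level 70).
Local Notation n0 := (zero_of M).
Local Notation n1 := (one_of M).

Let basic n : PeanoNat.Nat.ltb n 17 = true ->
  @sat M (fun _ => n0) (fun _ => inh M) (List.nth n PAminus FBot).
Proof.
by move=> /PeanoNat.Nat.ltb_lt Hn; apply: model_sat; apply: RCA0_basic; apply: List.nth_In.
Qed.

Ltac ax n := (have := @basic n erefl);
  rewrite /PAminus /=.

Lemma pa_addA x y z : (x ⊕ y) ⊕ z = x ⊕ (y ⊕ z).
Proof. by ax 0%N; apply. Qed.
Lemma pa_addC x y : x ⊕ y = y ⊕ x.
Proof. by ax 1%N; apply. Qed.
Lemma pa_mulA x y z : (x ⊗ y) ⊗ z = x ⊗ (y ⊗ z).
Proof. by ax 2%N; apply. Qed.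
Lemma pa_mulC x y : x ⊗ y = y ⊗ x.
Proof. by ax 3%N; apply. Qed.
Lemma pa_mulD x y z : x ⊗ (y ⊕ z) = x ⊗ y ⊕ x ⊗ z.
Proof. by ax 4%N; apply. Qed.
Lemma pa_add0 x : x ⊕ n0 = x.
Proof. by ax 5%N; apply. Qed.
Lemma pa_mul0 x : x ⊗ n0 = n0.
Proof. by ax 6%N; apply. Qed.
Lemma pa_mul1 x : x ⊗ n1 = x.
Proof. by ax 7%N; apply. Qed.
Lemma pa_ltt x y z : x ≺ y -> y ≺ z -> x ≺ z.
Proof. by ax 8%N; apply. Qed.
Lemma pa_ltn x : ~ x ≺ x.
Proof. by ax 9%N; apply. Qed.
Lemma pa_cmp x y : x ≺ y \/ x = y \/ y ≺ x.
Proof.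
ax 10%N => /(_ x y) H.
have [|C] := pselect (x ≺ y); [by left|right].
have [|C'] := pselect (x = y); [by left|right]; apply: H => // D; tauto.
Qed.
Lemma pa_ltD x y z : x ≺ y -> x ⊕ z ≺ y ⊕ z.
Proof. by ax 11%N; apply. Qed.
Lemma pa_ltM x y z : n0 ≺ z -> x ≺ y -> x ⊗ z ≺ y ⊗ z.
Proof. by ax 12%N; apply. Qed.
Lemma pa_sub x y : x ≺ y -> exists z, x ⊕ z = y.
Proof. by ax 13%N => H /H {}H; apply: contrapT => C; apply: H => z E; apply: C; exists z. Qed.
Lemma pa_lt01 : n0 ≺ n1.
Proof. by ax 14%N. Qed.
Lemma pa_pos x : n0 ≺ x -> n1 = x \/ n1 ≺ x.
Proof.
ax 15%N => H /H {}H; have [|C] := pselect (n1 ≺ x); [by right|left; exact: H].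
Qed.
Lemma pa_ge0 x : n0 = x \/ n0 ≺ x.
Proof.
ax 16%N => /(_ x) H; have [|C] := pselect (n0 ≺ x); [by right|left; exact: H].
Qed.
End BasicFacts.

Definition carrier (M : model) : Type := num_of M.

Section SemiRing.
Variable M : model.
Local Notation N := (carrier M).
HB.instance Definition _ := gen_eqMixin N.
HB.instance Definition _ := gen_choiceMixin N.
Lemma pa_addA' : associative (@add_of M).
Proof. by move=> x y z; rewrite pa_addA. Qed.
Lemma pa_add0' : left_id (zero_of M) (@add_of M).
Proof. by move=> x; rewrite pa_addC pa_add0. Qed.
HB.instance Definition _ := GRing.isNmodule.Build N pa_addA' (@pa_addC M) pa_add0'.
Lemma pa_mulA' : associative (@mul_of M).
Proof. by move=> x y z; rewrite pa_mulA. Qed.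
Lemma pa_mul1' : left_id (one_of M) (@mul_of M).
Proof. by move=> x; rewrite pa_mulC pa_mul1. Qed.
Lemma pa_mulD' : left_distributive (@mul_of M) (@add_of M).
Proof. by move=> x y z; rewrite pa_mulC pa_mulD !(pa_mulC z). Qed.
Lemma pa_mul0' : left_zero (zero_of M) (@mul_of M).
Proof. by move=> x; rewrite pa_mulC pa_mul0. Qed.
Lemma pa_10 : one_of M != zero_of M :> N.
Proof. by apply/eqP => E; have := @pa_lt01 M; rewrite E; apply: pa_ltn. Qed.
HB.instance Definition _ := GRing.Nmodule_isComNzSemiRing.Build N
  pa_mulA' (@pa_mulC M) pa_mul1' pa_mulD' pa_mul0' pa_10.
End SemiRing.

Definition ltN (M : model) (x y : carrier M) : Prop := @lt_of M x y.
Definition leN (M : model) (x y : carrier M) : Prop := ltN x y \/ x = y.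
Notation "x ≺ y" := (ltN x y) (at level 70, no associativity).
Notation "x ⪯ y" := (leN x y) (at level 70, no associativity).

Section OrderedSemiRing.
Variable M : model.
Implicit Types x y z : carrier M.

Lemma ltN_trans x y z : x ≺ y -> y ≺ z -> x ≺ z. Proof. exact: pa_ltt. Qed.
Lemma ltNn x : ~ x ≺ x. Proof. exact: pa_ltn. Qed.
Lemma ltN_cmp x y : [\/ x ≺ y, x = y | y ≺ x].
Proof. by case: (@pa_cmp M x y) => [?|[?|?]]; [constructor 1|constructor 2|constructor 3]. Qed.
Lemma ltND x y z : x ≺ y -> x + z ≺ y + z. Proof. exact: pa_ltD. Qed.
Lemma ltNM x y z : 0 ≺ z -> x ≺ y -> x * z ≺ y * z. Proof. exact: pa_ltM. Qed.
Lemma ltN_subE x y : x ≺ y -> exists z, x + z = y. Proof. exact: pa_sub. Qed.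
Lemma ltN01 : (0 : carrier M) ≺ 1. Proof. exact: pa_lt01. Qed.
Lemma ltN_ge1 x : 0 ≺ x -> 1 ⪯ x. Proof. by case/pa_pos; [right|left]. Qed.
Lemma leN0 x : 0 ⪯ x. Proof. by case: (@pa_ge0 M x); [right|left]. Qed.

Lemma addNI x y z : x + z = y + z -> x = y.
Proof.
by case: (ltN_cmp x y) => // /(@ltND _ _ z) + E; rewrite E => /ltNn.
Qed.
Lemma mulNI x y z : 0 ≺ z -> x * z = y * z -> x = y.
Proof.
by move=> Hz; case: (ltN_cmp x y) => // /(ltNM Hz) + E; rewrite E => /ltNn.
Qed.
Lemma leN_ltN x y : x ⪯ y <-> ~ y ≺ x.
Proof.
split=> [[H|->]|H]; [by move=> /(ltN_trans H) /ltNn|exact: ltNn|].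
by case: (ltN_cmp x y) => ?; [left|right|].
Qed.
Lemma leN_total x y : x ⪯ y \/ y ⪯ x.
Proof. by case: (ltN_cmp x y) => H; [left; left|left; right|right; left]. Qed.
Lemma leN_anti x y : x ⪯ y -> y ⪯ x -> x = y.
Proof. by move=> [H|//] [K|//]; case: (ltNn (ltN_trans H K)). Qed.
Lemma leN_subE x y : x ⪯ y -> exists z, x + z = y.
Proof. by case=> [/ltN_subE //|->]; exists 0; rewrite addr0. Qed.
Lemma leN_addr x z : x ⪯ x + z.
Proof.
case: (leN0 z) => [H|<-]; last by right; rewrite addr0.
by left; have := ltND x H; rewrite add0r addrC.
Qed.
Lemma leNE x y : x ⪯ y <-> exists z, x + z = y.
Proof. by split=> [/leN_subE //|[z <-]]; apply: leN_addr. Qed.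
Lemma pos_mul x y : 0 ≺ x -> 0 ≺ y -> 0 ≺ x * y.
Proof. by move=> Hx /(ltNM Hx); rewrite mul0r mulrC. Qed.

(** The triples (a, b, c) for (a - b)/c of the formal language, taken over so that codes of
    rationals have direct values in the field. Keeping a and b apart makes up for the missing
    negatives. *)
Record frac := Frac { fnum : carrier M; fneg : carrier M; fden : carrier M }.
Implicit Types t u v : frac.
Definition fvalid t := 0 ≺ fden t.
Definition feq t u :=
  fnum t * fden u + fneg u * fden t = fnum u * fden t + fneg t * fden u.
Definition fclass t : frac -> Prop := fun u => fvalid u /\ feq t u.

Lemma feq_sym t u : feq t u -> feq u t. Proof. by []. Qed.
Lemma feq_trans u t v : fvalid u -> feq t u -> feq u v -> feq t v.
Proof.
case: t u v => [a b c] [a' b' c'] [a2 b2 c2]; rewrite /fvalid /feq /= => V E1 E2.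
apply: (mulNI V); apply: (addNI (z := a' * c * c2 + b' * c * c2)).
transitivity ((a * c' + b' * c) * c2 + (a' * c2 + b2 * c') * c); first by ring.
by rewrite E1 E2; ring.
Qed.

Lemma fclassE t u : fvalid t -> fvalid u -> fclass t = fclass u <-> feq t u.
Proof.
move=> Vt Vu; split=> [E|E].
- by have : fclass u u by []; rewrite -E => -[].
- apply: funext => v; apply: propext; split=> -[V K]; split=> //.
  + by apply: (feq_trans (u := t)) K => //; apply: feq_sym.
  + by apply: feq_trans K.
Qed.
End OrderedSemiRing.

Definition ratio (M : model) : Type :=
  {P : frac M -> Prop | exists t, fvalid t /\ P = fclass t}.

(** * The ordered field of fractions *)

Section FractionField.
Variable M : model.
Local Notation K := (ratio M).
Implicit Types t u v : frac M.
Implicit Types k l : K.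

Definition mkr t (V : fvalid t) : K := exist _ (fclass t) (ex_intro _ t (conj V erefl)).
Definition rep k : frac M := projT1 (cid (proj2_sig k)).
Lemma rep_valid k : fvalid (rep k). Proof. by rewrite /rep; case: cid => t []. Qed.

Lemma ratioP (P : K -> Prop) : (forall t (V : fvalid t), P (mkr V)) -> forall k, P k.
Proof.
by move=> H [Q [t [V E]]]; rewrite (_ : exist _ _ _ = mkr V) //; apply: eq_exist.
Qed.

Lemma mkrE t u (V : fvalid t) (W : fvalid u) : mkr V = mkr W <-> feq t u.
Proof. by rewrite -fclassE //; split=> [[]//|E]; apply: eq_exist. Qed.

Lemma rep_mkr t (V : fvalid t) : feq (rep (mkr V)) t.
Proof. by rewrite /rep; case: cid => u /= [W /(fclassE V W) E]; apply: feq_sym. Qed.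

Lemma radd_valid t u : fvalid t -> fvalid u -> fvalid (Frac
  (fnum t * fden u + fnum u * fden t) (fneg t * fden u + fneg u * fden t) (fden t * fden u)).
Proof. exact: pos_mul. Qed.
Lemma rmul_valid t u : fvalid t -> fvalid u -> fvalid (Frac
  (fnum t * fnum u + fneg t * fneg u) (fnum t * fneg u + fneg t * fnum u) (fden t * fden u)).
Proof. exact: pos_mul. Qed.
Lemma ropp_valid t : fvalid t -> fvalid (Frac (fneg t) (fnum t) (fden t)).
Proof. by []. Qed.
Lemma rnat_valid (x : carrier M) : fvalid (Frac x 0 1).
Proof. exact: ltN01. Qed.

(* The operations are sealed: unification must not unfold them when it compares
   rational expressions. *)
Lemma rat_add_sig : {f : K -> K -> K | forall k l, f k l = mkr (radd_valid (rep_valid k) (rep_valid l))}.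
Proof. by exists (fun k l => mkr (radd_valid (rep_valid k) (rep_valid l))). Qed.
Lemma rat_mul_sig : {f : K -> K -> K | forall k l, f k l = mkr (rmul_valid (rep_valid k) (rep_valid l))}.
Proof. by exists (fun k l => mkr (rmul_valid (rep_valid k) (rep_valid l))). Qed.
Lemma rat_opp_sig : {f : K -> K | forall k, f k = mkr (ropp_valid (rep_valid k))}.
Proof. by exists (fun k => mkr (ropp_valid (rep_valid k))). Qed.
Lemma iota_sig : {f : carrier M -> K | forall x, f x = mkr (rnat_valid x)}.
Proof. by exists (fun x => mkr (rnat_valid x)). Qed.
Definition rat_add := sval rat_add_sig.
Definition rat_mul := sval rat_mul_sig.
Definition rat_opp := sval rat_opp_sig.
Definition iota := sval iota_sig.
Lemma iota_def x : iota x = mkr (rnat_valid x). Proof. exact: (svalP iota_sig). Qed.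

Lemma rat_addE t u (V : fvalid t) (W : fvalid u) : rat_add (mkr V) (mkr W) = mkr (radd_valid V W).
Proof.
rewrite [LHS](svalP rat_add_sig); apply/mkrE; move: (rep (mkr V)) (rep (mkr W)) (rep_mkr V) (rep_mkr W).
case: t u {V W} => [a' b' c'] [d' e' f'] [a b c] [d e f].
rewrite /feq /= => E1 E2.
transitivity ((a * c' + b' * c) * (f * f') + (d * f' + e' * f) * (c * c')); first by ring.
by rewrite E1 E2; ring.
Qed.
Lemma rat_oppE t (V : fvalid t) : rat_opp (mkr V) = mkr (ropp_valid V).
Proof.
rewrite [LHS](svalP rat_opp_sig); apply/mkrE; move: (rep_mkr V); rewrite /feq /= => E.
by rewrite addrC -E addrC.
Qed.
Lemma rat_mulE t u (V : fvalid t) (W : fvalid u) : rat_mul (mkr V) (mkr W) = mkr (rmul_valid V W).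
Proof.
rewrite [LHS](svalP rat_mul_sig); apply/mkrE; apply: (feq_trans (rmul_valid V (rep_valid (mkr W)))).
- move: (rep (mkr V)) (rep (mkr W)) (rep_mkr V).
  case: t {V} => [a' b' c'] [a b c] [d e f]; rewrite /feq /= => E.
  transitivity (f * (d * (a * c' + b' * c) + e * (a' * c + b * c'))); first by ring.
  transitivity (f * (d * (a' * c + b * c') + e * (a * c' + b' * c))); last by ring.
  by rewrite E.
- move: (rep (mkr W)) (rep_mkr W).
  case: t u {V W} => [d e f] [a' b' c'] [a b c]; rewrite /feq /= => E.
  transitivity (f * (d * (a * c' + b' * c) + e * (a' * c + b * c'))); first by ring.
  transitivity (f * (d * (a' * c + b * c') + e * (a * c' + b' * c))); last by ring.
  by rewrite E.
Qed.

Lemma rat_addA : associative rat_add.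
Proof.
elim/ratioP=> [[a b c] V]; elim/ratioP=> [[d e f] W]; elim/ratioP=> [[g h i] U].
by rewrite !rat_addE; apply/mkrE; rewrite /feq /=; ring.
Qed.
Lemma rat_addC : commutative rat_add.
Proof.
elim/ratioP=> [[a b c] V]; elim/ratioP=> [[d e f] W].
by rewrite !rat_addE; apply/mkrE; rewrite /feq /=; ring.
Qed.
Lemma rat_add0 : left_id (iota 0) rat_add.
Proof.
elim/ratioP=> [[a b c] V]; rewrite !iota_def rat_addE; apply/mkrE; rewrite /feq /=; ring.
Qed.
Lemma rat_addN : left_inverse (iota 0) rat_opp rat_add.
Proof.
elim/ratioP=> [[a b c] V]; rewrite !iota_def rat_oppE rat_addE; apply/mkrE; rewrite /feq /=; ring.
Qed.
Lemma rat_mulA : associative rat_mul.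
Proof.
elim/ratioP=> [[a b c] V]; elim/ratioP=> [[d e f] W]; elim/ratioP=> [[g h i] U].
by rewrite !rat_mulE; apply/mkrE; rewrite /feq /=; ring.
Qed.
Lemma rat_mulC : commutative rat_mul.
Proof.
elim/ratioP=> [[a b c] V]; elim/ratioP=> [[d e f] W].
by rewrite !rat_mulE; apply/mkrE; rewrite /feq /=; ring.
Qed.
Lemma rat_mul1 : left_id (iota 1) rat_mul.
Proof.
elim/ratioP=> [[a b c] V]; rewrite !iota_def rat_mulE; apply/mkrE; rewrite /feq /=; ring.
Qed.
Lemma rat_mulD : left_distributive rat_mul rat_add.
Proof.
elim/ratioP=> [[a b c] V]; elim/ratioP=> [[d e f] W]; elim/ratioP=> [[g h i] U].
by rewrite !(rat_addE, rat_mulE); apply/mkrE; rewrite /feq /=; ring.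
Qed.

HB.instance Definition _ := gen_eqMixin K.
HB.instance Definition _ := gen_choiceMixin K.
HB.instance Definition _ := GRing.isZmodule.Build K rat_addA rat_addC rat_add0 rat_addN.
Lemma rat_10 : iota 1 != iota 0.
Proof.
apply/eqP; rewrite !iota_def => /mkrE; rewrite /feq /= !mulr1 !addr0 => E.
by have := @ltN01 M; rewrite E => /ltNn.
Qed.
HB.instance Definition _ := GRing.Zmodule_isComNzRing.Build K
  rat_mulA rat_mulC rat_mul1 rat_mulD rat_10.

(** Only the smaller of two numbers can be subtracted from the larger, so the order of [a] and [b]
    decides whether the inverse is c/d or -c/d, with d their difference. *)
Lemma rat_inv_ex k : exists l : K, k != 0 -> l * k = 1.
Proof.
elim/ratioP: k => [[a b c] V]; case: (ltN_cmp a b) => H.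
- have [d Hd] := ltN_subE H; have W : fvalid (Frac 0 c d).
    case: (leN0 d) => // E; case: (@ltNn _ a); move: H.
    by rewrite -Hd -E addr0.
  exists (mkr W) => _; rewrite [_ * _]rat_mulE [RHS](iota_def 1); apply/mkrE; rewrite /feq /= -Hd; ring.
- by exists 0 => /eqP[]; rewrite [RHS](iota_def 0); apply/mkrE; rewrite H /feq /=; ring.
- have [d Hd] := ltN_subE H; have W : fvalid (Frac c 0 d).
    case: (leN0 d) => // E; case: (@ltNn _ b); move: H.
    by rewrite -Hd -E addr0.
  exists (mkr W) => _; rewrite [_ * _]rat_mulE [RHS](iota_def 1); apply/mkrE; rewrite /feq /= -Hd; ring.
Qed.
Definition rat_inv k : K := if k == 0 then 0 else projT1 (cid (rat_inv_ex k)).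
Lemma rat_mulV k : k != 0 -> rat_inv k * k = 1.
Proof. by rewrite /rat_inv; case: cid => l /= H K; rewrite ifN // H. Qed.
Lemma rat_inv0 : rat_inv 0 = 0. Proof. by rewrite /rat_inv; case: cid => l /= _; rewrite eqxx. Qed.
HB.instance Definition _ := GRing.ComNzRing_isField.Build K rat_mulV rat_inv0.

Definition rat_nneg k : bool := `[< fneg (rep k) ⪯ fnum (rep k) >].
Lemma leN_mulP (x y z : carrier M) : 0 ≺ z -> (x * z ⪯ y * z) <-> (x ⪯ y).
Proof.
move=> Hz; split=> [/leN_ltN H|[H|->]]; [|by left; apply: ltNM|by right].
by apply/leN_ltN => /(ltNM Hz).
Qed.
Lemma leN_addP (x y z : carrier M) : (x + z ⪯ y + z) <-> (x ⪯ y).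
Proof.
split=> [/leN_ltN H|[H|->]]; [|by left; apply: ltND|by right].
by apply/leN_ltN => /(@ltND M _ _ z).
Qed.
Lemma rat_nnegE t (V : fvalid t) : rat_nneg (mkr V) <-> fneg t ⪯ fnum t.
Proof.
have Hv : fvalid t := V.
rewrite /rat_nneg; move: (rep (mkr V)) (rep_mkr V) (rep_valid (mkr V)) Hv.
case: t {V} => [a' b' c'] [a b c].
rewrite /feq /fvalid /= => E Hc Hc'; split=> [/asboolP H|H].
- apply/(leN_mulP _ _ Hc)/(leN_addP _ _ (b * c')); rewrite -E addrC.
  by apply/leN_addP/leN_mulP.
- apply/asboolP/(leN_mulP _ _ Hc')/(leN_addP _ _ (b' * c)); rewrite E addrC.
  by apply/leN_addP/leN_mulP.
Qed.

Definition rat_le k l : bool := rat_nneg (l - k).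
Definition rat_norm k : K := if rat_nneg k then k else - k.
Lemma rat_le0 k : rat_le 0 k = rat_nneg k. Proof. by rewrite /rat_le subr0. Qed.

Lemma rat_le0_add k l : rat_le 0 k -> rat_le 0 l -> rat_le 0 (k + l).
Proof.
rewrite !rat_le0; elim/ratioP: k => [[a b c] V]; elim/ratioP: l => [[d e f] W].
rewrite [_ + _]rat_addE !rat_nnegE /= => /leN_subE[x <-] /leN_subE[y <-]; apply/leNE.
by exists (x * f + y * c); ring.
Qed.
Lemma rat_le0_mul k l : rat_le 0 k -> rat_le 0 l -> rat_le 0 (k * l).
Proof.
rewrite !rat_le0; elim/ratioP: k => [[a b c] V]; elim/ratioP: l => [[d e f] W].
rewrite [_ * _]rat_mulE !rat_nnegE /= => /leN_subE[x <-] /leN_subE[y <-]; apply/leNE.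
by exists (x * y); ring.
Qed.
Lemma rat_le0_anti k : rat_le 0 k -> rat_le k 0 -> k = 0.
Proof.
rewrite /rat_le subr0 sub0r; elim/ratioP: k => [[a b c] V].
rewrite [- _]rat_oppE !rat_nnegE /= => H1 H2; rewrite [RHS](iota_def 0); apply/mkrE; rewrite /feq /=.
by rewrite (leN_anti H1 H2); ring.
Qed.
Lemma rat_sub_ge0 k l : rat_le 0 (l - k) = rat_le k l.
Proof. by rewrite rat_le0. Qed.
Lemma rat_le0_total k : rat_le 0 k || rat_le k 0.
Proof.
rewrite /rat_le subr0 sub0r; elim/ratioP: k => [[a b c] V]; apply/orP.
by rewrite [- _]rat_oppE !rat_nnegE /=; apply: leN_total.
Qed.
Lemma rat_normN k : rat_norm (- k) = rat_norm k.
Proof.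
rewrite /rat_norm opprK; case: ifPn => H1; case: ifPn => H2 //.
- suff -> : k = 0 by rewrite oppr0.
  by apply: rat_le0_anti; rewrite /rat_le ?subr0 ?sub0r.
- by have := rat_le0_total k; rewrite /rat_le subr0 sub0r (negbTE H1) (negbTE H2).
Qed.
Lemma rat_ge0_norm k : rat_le 0 k -> rat_norm k = k.
Proof. by rewrite rat_le0 /rat_norm => ->. Qed.
HB.instance Definition _ := Num.IntegralDomain_isLeReal.Build K
  rat_le0_add rat_le0_mul rat_le0_anti rat_sub_ge0 rat_le0_total rat_normN rat_ge0_norm
  (fun _ _ => erefl).

Lemma iota_is_additive : nmod_morphism iota.
Proof.
split=> [//|x y]; rewrite !iota_def [RHS]rat_addE; apply/mkrE; rewrite /feq /=; ring.
Qed.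
Lemma iota_is_multiplicative : monoid_morphism iota.
Proof.
split=> [//|x y]; rewrite !iota_def [RHS]rat_mulE; apply/mkrE; rewrite /feq /=; ring.
Qed.
HB.instance Definition _ := GRing.isNmodMorphism.Build (carrier M) K iota iota_is_additive.
HB.instance Definition _ := GRing.isMonoidMorphism.Build (carrier M) K iota iota_is_multiplicative.

Lemma iota_le x y : iota x <= iota y <-> x ⪯ y.
Proof.
have -> : (iota x <= iota y) =
    rat_nneg (mkr (radd_valid (rnat_valid y) (ropp_valid (rnat_valid x)))).
  by rewrite !iota_def -rat_addE -rat_oppE.
rewrite rat_nnegE /=.
have -> : 0 * 1 + x * 1 = x by ring.
by have -> : y * 1 + 0 * 1 = y by ring.
Qed.
Lemma iota_inj : injective iota.
Proof. by move=> x y E; apply: leN_anti; apply/iota_le; rewrite E. Qed.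
Lemma iota_lt x y : iota x < iota y <-> x ≺ y.
Proof.
split=> [H|H].
- case: (leN_total y x) => [/iota_le|]; first by rewrite leNgt H.
  by case=> // E; rewrite E ltxx in H.
- rewrite lt_neqAle; apply/andP; split; last by apply/iota_le; left.
  by apply/eqP => /iota_inj E; rewrite E in H; case: (ltNn H).
Qed.
End FractionField.

(** * Truth of the formalized notions in a model *)

Section Meaning.
Variable M : model.
Local Notation N := (carrier M).
Local Notation Om := (set_of M).
Implicit Types (x y z v w c i j k m n e : N) (X Y Z F A : Om) (t : frac M).

(* A name of the definitions of RCA_0 prefixed by [s] is what it expresses in [M]. *)
Definition inS x A : Prop := @in_of M x A.
Definition spr x y : N := (x + y) * (x + y) + x.
Definition smem x c : Prop := exists k m n, c = spr k (spr m n) /\ x ≺ k /\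
  exists w, n = w * (m * (x + 1) + 1).
Definition sprim_rec (base : N -> Prop) (step : N -> N -> N -> Prop) n y : Prop :=
  exists c, smem (spr n y) c /\ forall i u, smem (spr i u) c ->
    (i = 0 /\ base u) \/ exists j v, i = j + 1 /\ smem (spr j v) c /\ step j v u.
Definition sexp2 n p := sprim_rec (fun u => u = 1) (fun _ v u => u = v + v) n p.
Definition sis_fun (dom cod : N -> Prop) F : Prop := forall x, dom x ->
  exists y, inS (spr x y) F /\ cod y /\ forall z, inS (spr x z) F -> z = y.
Definition sis_pair x : Prop := exists n i, x = spr n i.
Definition slen s n : Prop := exists p, sexp2 n p /\ p ⪯ s /\ s ≺ p + p.
Definition sproper_prefix (t s : N) : Prop :=
  t <> s /\ exists k p r, sexp2 k p /\ r ≺ p /\ s = t * p + r.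
Definition srestr X n s : Prop := sprim_rec (fun u => u = 1)
  (fun i v u => (inS i X /\ u = v + v + 1) \/ (~ inS i X /\ u = v + v)) n s.
Definition sis_string_set b : Prop := forall s, smem s b -> 0 ≺ s.
Definition sin_cyl X b : Prop := exists n s, srestr X n s /\ smem s b.

Definition scode t : N := spr (spr (fnum t) (fneg t)) (fden t).
Definition srnat n : frac M := Frac n 0 1.
Definition srinv n : frac M := Frac 1 0 n.
Definition sropp t : frac M := Frac (fneg t) (fnum t) (fden t).
Definition sradd (t u : frac M) : frac M := Frac
  (fnum t * fden u + fnum u * fden t) (fneg t * fden u + fneg u * fden t) (fden t * fden u).
Definition srsub (t u : frac M) := sradd t (sropp u).
Definition srle (t u : frac M) : Prop :=
  fnum t * fden u + fneg u * fden t ⪯ fnum u * fden t + fneg t * fden u.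
Definition srlt (t u : frac M) : Prop :=
  fnum t * fden u + fneg u * fden t ≺ fnum u * fden t + fneg t * fden u.
Definition sreq (t u : frac M) : Prop := srle t u /\ srle u t.
Definition srabs_le (t u : frac M) : Prop := srle t u /\ srle (sropp t) u.
Definition srapid (q : N -> frac M -> Prop) : Prop := forall k l p, k ⪯ l -> sexp2 k p ->
  forall t, fvalid t -> forall u, fvalid u -> q k t -> q l u -> srabs_le (srsub t u) (srinv p).
Definition sdist_le t (q : N -> frac M -> Prop) (e : frac M) : Prop := forall k p, sexp2 k p ->
  forall u, fvalid u -> q k u -> srabs_le (srsub t u) (sradd e (srinv p)).
Definition sconverges (a q : N -> frac M -> Prop) : Prop := forall k p, sexp2 k p ->
  exists m0, forall m, m0 ⪯ m -> forall t, fvalid t -> a m t -> sdist_le t q (srinv p).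

Definition strip e x y := spr e (spr x y).
Definition sjustified Z D e x y : Prop :=
  (e = spr 0%:R 0 /\ y = 0) \/
  (e = spr 1%:R 0 /\ y = x + 1) \/
  (e = spr 2%:R 0 /\ exists b, x = spr y b) \/
  (e = spr 3%:R 0 /\ exists a, x = spr a y) \/
  (e = spr 4%:R 0 /\ ((inS x Z /\ y = 1) \/ (~ inS x Z /\ y = 0))) \/
  (exists f g, e = spr 5%:R (spr f g) /\
     exists u v, y = spr u v /\ smem (strip f x u) D /\ smem (strip g x v) D) \/
  (exists f g, e = spr 6%:R (spr f g) /\
     exists u, smem (strip g x u) D /\ smem (strip f u y) D) \/
  (exists f g, e = spr 7%:R (spr f g) /\
     exists a, (x = spr a 0 /\ smem (strip f a y) D) \/
           exists n u, x = spr a (n + 1) /\ smem (strip e (spr a n) u) D /\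
                   smem (strip g (spr a (spr n u)) y) D) \/
  (exists f, e = spr 8%:R f /\ smem (strip f (spr x y) 0) D /\
     forall n, n ≺ y -> exists u, smem (strip f (spr x n) u) D /\ 0 ≺ u).
Definition scomputes Z e x y : Prop := exists D, smem (strip e x y) D /\
  forall e' x' y', smem (strip e' x' y') D -> sjustified Z D e' x' y'.
Definition sleT X Z : Prop := exists e, forall n,
  (inS n X -> scomputes Z e n 1) /\ (~ inS n X -> scomputes Z e n 0).

Definition sminimal s b : Prop := smem s b /\ ~ exists r, smem r b /\ sproper_prefix r s.
Definition sfin_measure b t : Prop := sprim_rec
  (fun u => exists t', fvalid t' /\ u = scode t' /\ sreq t' (srnat 0))
  (fun j v u => exists t1, fvalid t1 /\ exists t2, fvalid t2 /\ v = scode t1 /\ u = scode t2 /\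
     ((sminimal j b /\ exists l p, slen j l /\ sexp2 l p /\ sreq t2 (sradd t1 (srinv p)))
      \/ (~ sminimal j b /\ sreq t2 t1)))
  b (scode t).
Definition sopen_seq F : Prop := sis_fun sis_pair sis_string_set F.
Definition sin_open X F n : Prop := exists i b, inS (spr (spr n i) b) F /\ sin_cyl X b.
Definition sstage_measure F n m t : Prop := exists c,
  (forall s, smem s c <-> exists i b, i ⪯ m /\ inS (spr (spr n i) b) F /\ smem s b) /\
  sfin_measure c t.
Definition smeasure_le F n (r : frac M) : Prop := forall m, exists t, fvalid t /\
  sstage_measure F n m t /\ srle t r.
Definition sreal_term R n k t : Prop := inS (spr (spr n k) (scode t)) R.
Definition sreal_seq R : Prop :=
  sis_fun sis_pair (fun y => exists t, fvalid t /\ y = scode t) R /\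
  forall n, srapid (sreal_term R n).
Definition sschnorr_test F Z : Prop := sopen_seq F /\ sleT F Z /\
  (forall n p, sexp2 n p -> smeasure_le F n (srinv p)) /\
  exists R, sreal_seq R /\ sleT R Z /\
    forall n, sconverges (sstage_measure F n) (sreal_term R n).
Definition sschnorr_random X Z : Prop := forall F, sschnorr_test F Z -> ~ forall n, sin_open X F n.
Definition ssupermartingale S : Prop :=
  sis_fun (fun s => 0 ≺ s) (fun y => exists t, fvalid t /\ y = scode t /\ srle (srnat 0) t) S /\
  forall s, 0 ≺ s -> forall t1, fvalid t1 -> forall t2, fvalid t2 -> forall t3, fvalid t3 ->
    inS (spr (s + s) (scode t1)) S -> inS (spr (s + s + 1) (scode t2)) S ->
    inS (spr s (scode t3)) S -> srle (sradd t1 t2) (sradd t3 t3).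
Definition ssucceeds S X : Prop := forall k, exists n s, srestr X n s /\
  exists t, fvalid t /\ inS (spr s (scode t)) S /\ srlt (srnat k) t.
Definition scomputably_random X Z : Prop := forall S, ssupermartingale S -> sleT S Z -> ~ ssucceeds S X.

(* Worlds are the stacks of enclosing binders; denotations are required to be
   stable under pushing further binders. *)
Record world := World { wd : nat; ws : nat; wr : nat -> num_of M; we : nat -> Om }.

Inductive ext (W : world) : world -> Prop :=
| ext_refl : ext W W
| ext_num d s r h x : ext W (World d s r h) -> ext W (World (S d) s (scons x r) h)
| ext_set d s r h A : ext W (World d s r h) -> ext W (World d (S s) r (scons A h)).

Implicit Types (W : world) (P Q : Prop).
Definition num_denotes W (x : nexp) v : Prop := forall W', ext W W' -> eval (wr W') (x (wd W')) = v.
Definition set_denotes W (X : sexp) A : Prop := forall W', ext W W' -> we W' (X (ws W')) = A.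
Definition frm_denotes W (p : frm) (P : Prop) : Prop :=
  forall W', ext W W' -> sat (wr W') (we W') (p (wd W') (ws W')) <-> P.

Lemma ext_trans W1 W2 W3 : ext W1 W2 -> ext W2 W3 -> ext W1 W3.
Proof. by move=> H; elim=> //= *; [apply: ext_num|apply: ext_set]. Qed.
Lemma ext_n W x : ext W (World (S (wd W)) (ws W) (scons x (wr W)) (we W)).
Proof. by case: W => d s r h; apply: ext_num; apply: ext_refl. Qed.
Lemma ext_s W A : ext W (World (wd W) (S (ws W)) (wr W) (scons A (we W))).
Proof. by case: W => d s r h; apply: ext_set; apply: ext_refl. Qed.

Lemma num_denotes_mono W W' a x : ext W W' -> num_denotes W a x -> num_denotes W' a x.
Proof. by move=> E H W2 E2; apply: H; apply: ext_trans E2. Qed.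
Lemma set_denotes_mono W W' a A : ext W W' -> set_denotes W a A -> set_denotes W' a A.
Proof. by move=> E H W2 E2; apply: H; apply: ext_trans E2. Qed.

Lemma num_denotes_var W x : num_denotes (World (S (wd W)) (ws W) (scons x (wr W)) (we W))
  (fun d' => TVar (d' - S (wd W))%coq_nat) x.
Proof.
have H W' : ext (World (S (wd W)) (ws W) (scons x (wr W)) (we W)) W' ->
    (S (wd W) <= wd W')%coq_nat /\ eval (wr W') (TVar (wd W' - S (wd W))%coq_nat) = x.
  elim=> /= [|d s r h y _ [L IH]|d s r h A' _ [L IH]] //; first by rewrite PeanoNat.Nat.sub_diag.
  split; first by apply: le_S.
  by rewrite -IH; have -> : (d - wd W)%coq_nat = S (d - S (wd W))%coq_nat by lia.
by move=> W' /H[].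
Qed.
Lemma set_denotes_var W A : set_denotes (World (wd W) (S (ws W)) (wr W) (scons A (we W)))
  (fun s' => (s' - S (ws W))%coq_nat) A.
Proof.
have H W' : ext (World (wd W) (S (ws W)) (wr W) (scons A (we W))) W' ->
    (S (ws W) <= ws W')%coq_nat /\ we W' (ws W' - S (ws W))%coq_nat = A.
  elim=> /= [|d s r h y _ [L IH]|d s r h A' _ [L IH]] //; first by rewrite PeanoNat.Nat.sub_diag.
  split; first by apply: le_S.
  by rewrite -IH; have -> : (s - ws W)%coq_nat = S (s - S (ws W))%coq_nat by lia.
by move=> W' /H[].
Qed.

Lemma num_denotes_add W a b x y : num_denotes W a x -> num_denotes W b y -> num_denotes W (fun d => TAdd (a d) (b d)) (x + y).
Proof. by move=> H K W' E /=; rewrite H // K. Qed.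
Lemma num_denotes_mul W a b x y : num_denotes W a x -> num_denotes W b y -> num_denotes W (fun d => TMul (a d) (b d)) (x * y).
Proof. by move=> H K W' E /=; rewrite H // K. Qed.
Lemma num_denotes_0 W : num_denotes W (fun _ => TZero) 0. Proof. by []. Qed.
Lemma num_denotes_1 W : num_denotes W (fun _ => TOne) 1. Proof. by []. Qed.
Lemma num_denotes_num W (n : nat) : num_denotes W (num n) n%:R.
Proof.
move=> W' _; rewrite /num; elim: n => //= n IH.
by rewrite -natr1 IH.
Qed.
Lemma num_denotes_pr W a b x y : num_denotes W a x -> num_denotes W b y -> num_denotes W (pr a b) (spr x y).
Proof. by move=> H K; do !(apply: num_denotes_add || apply: num_denotes_mul). Qed.
Lemma num_denotes_trip W (a b c : nexp) x y z :
  num_denotes W a x -> num_denotes W b y -> num_denotes W c z -> num_denotes W (trip a b c) (strip x y z).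
Proof. by move=> *; do 2!apply: num_denotes_pr => //. Qed.

Definition rat_denotes W (a : Defs.rat) t : Prop :=
  [/\ num_denotes W (rpos a) (fnum t), num_denotes W (rneg a) (fneg t) & num_denotes W (rden a) (fden t)].
Lemma rat_denotes_mono W W' a t : ext W W' -> rat_denotes W a t -> rat_denotes W' a t.
Proof. by move=> E [H1 H2 H3]; split; apply: num_denotes_mono E _. Qed.
Lemma rat_denotes_Rat W (a b c : nexp) x y z : num_denotes W a x -> num_denotes W b y -> num_denotes W c z -> rat_denotes W (Defs.Rat a b c) (Frac x y z).
Proof. by []. Qed.
Lemma rat_denotes_radd W a b (t u : frac M) : rat_denotes W a t -> rat_denotes W b u -> rat_denotes W (radd a b) (sradd t u).
Proof. by move=> [? ? ?] [? ? ?]; split; do !(apply: num_denotes_add || apply: num_denotes_mul). Qed.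
Lemma rat_denotes_ropp W a t : rat_denotes W a t -> rat_denotes W (ropp a) (sropp t).
Proof. by move=> [? ? ?]; split. Qed.
Lemma rat_denotes_rsub W a b (t u : frac M) : rat_denotes W a t -> rat_denotes W b u -> rat_denotes W (rsub a b) (srsub t u).
Proof. by move=> H K; apply: rat_denotes_radd => //; apply: rat_denotes_ropp. Qed.
Lemma rat_denotes_rnat W a x : num_denotes W a x -> rat_denotes W (rnat a) (srnat x).
Proof. by move=> H; split. Qed.
Lemma rat_denotes_rinv W a x : num_denotes W a x -> rat_denotes W (rinv a) (srinv x).
Proof. by move=> H; split. Qed.
Lemma num_denotes_qcode W a t : rat_denotes W a t -> num_denotes W (qcode a) (scode t).
Proof. by move=> [? ? ?]; do 2!apply: num_denotes_pr => //. Qed.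

Lemma frm_denotes_eq W a b x y : num_denotes W a x -> num_denotes W b y -> frm_denotes W (fun d _ => FEq (a d) (b d)) (x = y).
Proof. by move=> H K W' E /=; rewrite H // K. Qed.
Lemma frm_denotes_lt W a b x y : num_denotes W a x -> num_denotes W b y -> frm_denotes W (fun d _ => FLt (a d) (b d)) (x ≺ y).
Proof. by move=> H K W' E /=; rewrite H // K. Qed.
Lemma frm_denotes_in W a (X : sexp) x A : num_denotes W a x -> set_denotes W X A -> frm_denotes W (fun d s => FIn (a d) (X s)) (inS x A).
Proof. by move=> H K W' E /=; rewrite H // K. Qed.
Lemma frm_denotes_imp W p q P Q : frm_denotes W p P -> frm_denotes W q Q -> frm_denotes W (fun d s => FImp (p d s) (q d s)) (P -> Q).
Proof. by move=> H K W' E /=; rewrite H // K. Qed.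
Lemma frm_denotes_not W p P : frm_denotes W p P -> frm_denotes W (fun d s => FNot (p d s)) (~ P).
Proof. by move=> H W' E /=; rewrite H. Qed.
Lemma frm_denotes_and W p q P Q : frm_denotes W p P -> frm_denotes W q Q -> frm_denotes W (fun d s => FAnd (p d s) (q d s)) (P /\ Q).
Proof. by move=> H K W' E; rewrite sat_and H // K. Qed.
Lemma frm_denotes_or W p q P Q : frm_denotes W p P -> frm_denotes W q Q -> frm_denotes W (fun d s => FOr (p d s) (q d s)) (P \/ Q).
Proof. by move=> H K W' E; rewrite sat_or H // K. Qed.
Lemma frm_denotes_iff W p q P Q : frm_denotes W p P -> frm_denotes W q Q -> frm_denotes W (fun d s => FIff (p d s) (q d s)) (P <-> Q).
Proof. by move=> H K W' E; rewrite sat_iff H // K. Qed.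

Lemma frm_denotes_allN W f (P : N -> Prop) :
  (forall W' a x, ext W W' -> num_denotes W' a x -> frm_denotes W' (f a) (P x)) -> frm_denotes W (allN f) (forall x, P x).
Proof.
move=> H W' E; have R x := H _ _ x (ext_trans E (ext_n W' x)) (@num_denotes_var W' x) _ (ext_refl _).
by split=> K x; apply/R; apply: K.
Qed.
Lemma frm_denotes_exN W f (P : N -> Prop) :
  (forall W' a x, ext W W' -> num_denotes W' a x -> frm_denotes W' (f a) (P x)) -> frm_denotes W (exN f) (exists x, P x).
Proof.
move=> H W' E; rewrite sat_exN.
have R x := H _ _ x (ext_trans E (ext_n W' x)) (@num_denotes_var W' x) _ (ext_refl _).
by split=> -[x /R K]; exists x.
Qed.
Lemma frm_denotes_allS W f (P : Om -> Prop) :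
  (forall W' a A, ext W W' -> set_denotes W' a A -> frm_denotes W' (f a) (P A)) -> frm_denotes W (allS f) (forall A, P A).
Proof.
move=> H W' E; have R A := H _ _ A (ext_trans E (ext_s W' A)) (@set_denotes_var W' A) _ (ext_refl _).
by split=> K A; apply/R; apply: K.
Qed.
Lemma frm_denotes_exS W f (P : Om -> Prop) :
  (forall W' a A, ext W W' -> set_denotes W' a A -> frm_denotes W' (f a) (P A)) -> frm_denotes W (exS f) (exists A, P A).
Proof.
move=> H W' E; rewrite sat_exS.
have R A := H _ _ A (ext_trans E (ext_s W' A)) (@set_denotes_var W' A) _ (ext_refl _).
by split=> -[A /R K]; exists A.
Qed.
Lemma frm_denotes_equiv W p (P Q : Prop) : (P <-> Q) -> frm_denotes W p P -> frm_denotes W p Q.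
Proof. by move=> E H W' E'; rewrite H. Qed.

Lemma frm_denotes_allQ W f (P : frac M -> Prop) :
  (forall W' a t, ext W W' -> rat_denotes W' a t -> frm_denotes W' (f a) (P t)) ->
  frm_denotes W (allQ f) (forall t, fvalid t -> P t).
Proof.
move=> H; apply: (@frm_denotes_equiv _ _ (forall x y z : N, 0 ≺ z -> P (Frac x y z))).
  by split=> [K [x y z]|K x y z V]; [apply: K|apply: K].
apply: frm_denotes_allN => W1 a x E1 Ha; apply: frm_denotes_allN => W2 b y E2 Hb; apply: frm_denotes_allN => W3 c z E3 Hc.
apply: frm_denotes_imp; first by apply: frm_denotes_lt.
have E13 := ext_trans E2 E3.
apply: H; first exact: ext_trans E1 E13.
by apply: rat_denotes_Rat => //; [apply: num_denotes_mono E13 _|apply: num_denotes_mono E3 _].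
Qed.
Lemma frm_denotes_exQ W f (P : frac M -> Prop) :
  (forall W' a t, ext W W' -> rat_denotes W' a t -> frm_denotes W' (f a) (P t)) ->
  frm_denotes W (exQ f) (exists t, fvalid t /\ P t).
Proof.
move=> H; apply: (@frm_denotes_equiv _ _ (exists x y z : N, 0 ≺ z /\ P (Frac x y z))).
  split=> [[x [y [z [V K]]]]|[[x y z] [V K]]]; first by exists (Frac x y z).
  by exists x, y, z.
apply: frm_denotes_exN => W1 a x E1 Ha; apply: frm_denotes_exN => W2 b y E2 Hb; apply: frm_denotes_exN => W3 c z E3 Hc.
apply: frm_denotes_and; first by apply: frm_denotes_lt.
have E13 := ext_trans E2 E3.
apply: H; first exact: ext_trans E1 E13.
by apply: rat_denotes_Rat => //; [apply: num_denotes_mono E13 _|apply: num_denotes_mono E3 _].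
Qed.

Lemma num_denotes_rpos W a t : rat_denotes W a t -> num_denotes W (rpos a) (fnum t). Proof. by case. Qed.
Lemma num_denotes_rneg W a t : rat_denotes W a t -> num_denotes W (rneg a) (fneg t). Proof. by case. Qed.
Lemma num_denotes_rden W a t : rat_denotes W a t -> num_denotes W (rden a) (fden t). Proof. by case. Qed.
End Meaning.

Ltac push := repeat match goal with
  | E : ext ?W ?W', H : num_denotes ?W _ _ |- _ => apply (num_denotes_mono E) in H
  | E : ext ?W ?W', H : set_denotes ?W _ _ |- _ => apply (set_denotes_mono E) in H
  | E : ext ?W ?W', H : rat_denotes ?W _ _ |- _ => apply (rat_denotes_mono E) in H
  end; repeat match goal with E : ext _ _ |- _ => clear E end.

Ltac sem_frm := lazymatch goal with
  | |- frm_denotes _ (allN _) _ => apply: frm_denotes_allN; intros ? ? ? ? ?; push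
  | |- frm_denotes _ (exN _) _ => apply: frm_denotes_exN; intros ? ? ? ? ?; push
  | |- frm_denotes _ (allS _) _ => apply: frm_denotes_allS; intros ? ? ? ? ?; push
  | |- frm_denotes _ (exS _) _ => apply: frm_denotes_exS; intros ? ? ? ? ?; push
  | |- frm_denotes _ (allQ _) _ => apply: frm_denotes_allQ; intros ? ? ? ? ?; push
  | |- frm_denotes _ (exQ _) _ => apply: frm_denotes_exQ; intros ? ? ? ? ?; push
  | |- frm_denotes _ (fun d s => FEq _ _) _ => apply: frm_denotes_eq
  | |- frm_denotes _ (fun d s => FLt _ _) _ => apply: frm_denotes_lt
  | |- frm_denotes _ (fun d s => FIn _ _) _ => apply: frm_denotes_in
  | |- frm_denotes _ (fun d s => FAnd _ _) _ => apply: frm_denotes_and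
  | |- frm_denotes _ (fun d s => FOr _ _) _ => apply: frm_denotes_or
  | |- frm_denotes _ (fun d s => FIff _ _) _ => apply: frm_denotes_iff
  | |- frm_denotes _ (fun d s => FNot _) _ => apply: frm_denotes_not
  | |- frm_denotes _ (fun d s => FImp _ _) _ => apply: frm_denotes_imp
  | |- num_denotes _ (fun d => TAdd _ _) _ => apply: num_denotes_add
  | |- num_denotes _ (fun d => TMul _ _) _ => apply: num_denotes_mul
  | |- num_denotes _ (fun d => TZero) _ => apply: num_denotes_0
  | |- num_denotes _ (fun d => TOne) _ => apply: num_denotes_1
  end.
Ltac sem_term := lazymatch goal with
  | |- num_denotes _ (pr _ _) _ => apply: num_denotes_pr
  | |- num_denotes _ (trip _ _ _) _ => apply: num_denotes_trip
  | |- num_denotes _ (qcode _) _ => apply: num_denotes_qcode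
  | |- num_denotes _ (num _) _ => apply: num_denotes_num
  | |- num_denotes _ (app0 _) _ => rewrite /app0
  | |- num_denotes _ (app1 _) _ => rewrite /app1
  | |- rat_denotes _ (radd _ _) _ => apply: rat_denotes_radd
  | |- rat_denotes _ (ropp _) _ => apply: rat_denotes_ropp
  | |- rat_denotes _ (rsub _ _) _ => apply: rat_denotes_rsub
  | |- rat_denotes _ (rnat _) _ => apply: rat_denotes_rnat
  | |- rat_denotes _ (rinv _) _ => apply: rat_denotes_rinv
  | |- rat_denotes _ (Defs.Rat _ _ _) _ => apply: rat_denotes_Rat
  | |- num_denotes _ (rpos _) _ => apply: num_denotes_rpos
  | |- num_denotes _ (rneg _) _ => apply: num_denotes_rneg
  | |- num_denotes _ (rden _) _ => apply: num_denotes_rden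
  end.
Ltac sem := repeat (cbv beta; first [assumption | sem_frm | sem_term]).
(** Formulas and their meanings are unfolded together, so that [sem] can match the two sides
    connective by connective. *)
Ltac sem_unfold := cbv beta delta [
  schnorr_random computably_random succeeds supermartingale schnorr_test real_seq real_term measure_le
  stage_measure fin_measure converges in_open open_seq minimal leT dist_le rapid computes rabs_le req rle rlt
  in_cyl proper_prefix len justified is_string_set restr is_pair is_fun exp2 prim_rec mem is_string
  sschnorr_random scomputably_random ssucceeds ssupermartingale sschnorr_test sreal_seq sreal_term smeasure_le
  sstage_measure sfin_measure sconverges sin_open sopen_seq sminimal sleT sdist_le srapid scomputes srabs_le
  sreq srle srlt sin_cyl sproper_prefix slen sjustified sis_string_set srestr sis_pair sis_fun sexp2 sprim_rec
  smem].

Section Interpretation.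
Variable M : model.

Lemma sat_SR rho eta : @sat M rho eta SR <-> forall Z : set_of M, exists X, sschnorr_random X Z.
Proof.
have H : frm_denotes (World 0 0 rho eta) (AllS a, ExS b, schnorr_random b a)%so
  (forall Z : set_of M, exists X, sschnorr_random X Z) by sem_unfold; sem.
exact: H _ (ext_refl _).
Qed.
Lemma sat_CR rho eta : @sat M rho eta CR <-> forall Z : set_of M, exists X, scomputably_random X Z.
Proof.
have H : frm_denotes (World 0 0 rho eta) (AllS a, ExS b, computably_random b a)%so
  (forall Z : set_of M, exists X, scomputably_random X Z) by sem_unfold; sem.
exact: H _ (ext_refl _).
Qed.
End Interpretation.

(** * Bounded definability, induction and comprehension *)

Section IotaFacts.
Variable M : model.
Implicit Types x y : carrier M.
Lemma iotaD x y : iota (x + y) = iota x + iota y. Proof. exact: rmorphD. Qed.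
Lemma iotaM x y : iota (x * y) = iota x * iota y. Proof. exact: rmorphM. Qed.
Lemma iota0 : iota (0 : carrier M) = 0. Proof. exact: rmorph0. Qed.
Lemma iota1 : iota (1 : carrier M) = 1. Proof. exact: rmorph1. Qed.
Lemma iota_nat n : iota (n%:R : carrier M) = n%:R. Proof. exact: rmorph_nat. Qed.
Lemma iota_ge0 x : 0 <= iota x. Proof. by rewrite -iota0; apply/iota_le/leN0. Qed.
Lemma leNK x y : x ⪯ y <-> iota x <= iota y. Proof. by rewrite iota_le. Qed.
Lemma ltN_S x y : x ≺ y <-> x + 1 ⪯ y.
Proof.
split=> [H|H].
- have [z E] := ltN_subE H; case: (leN0 z) => [/ltN_ge1 K|K].
  + by rewrite -E ![x + _]addrC; apply/leN_addP.
  + by move: H; rewrite -E -K addr0 => /ltNn.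
- have K : x ≺ x + 1 by have := ltND x (@ltN01 M); rewrite add0r addrC.
  by case: H => [|<- //]; exact: ltN_trans K.
Qed.
Lemma ltNK x y : x ≺ y <-> iota x + 1 <= iota y.
Proof. by rewrite ltN_S leNK iotaD iota1. Qed.
Lemma ltNK' x y : iota x < iota y -> x ≺ y. Proof. by move/iota_lt. Qed.
Lemma not_ltN x y : ~ x ≺ y <-> y ⪯ x. Proof. by rewrite leN_ltN. Qed.
Lemma not_leN x y : ~ x ⪯ y <-> y ≺ x.
Proof. by rewrite leN_ltN; split=> [/contrapT //|H K]; exact: K H. Qed.
End IotaFacts.

Ltac nk_hyps := repeat match goal with
  | H : _ ≺ _ |- _ => apply -> ltNK in H
  | H : _ ⪯ _ |- _ => apply -> leNK in H
  | H : ~ _ ≺ _ |- _ => apply -> not_ltN in H; apply -> leNK in H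
  | H : ~ _ ⪯ _ |- _ => apply -> not_leN in H; apply -> ltNK in H
  | H : _ = _ |- _ => apply (congr1 (@iota _)) in H
  end.
Ltac nk_leaf e := lazymatch e with
  | (?a + ?b)%R => nk_leaf a; nk_leaf b
  | (?a * ?b)%R => nk_leaf a; nk_leaf b
  | 0%R => idtac
  | 1%R => idtac
  | (1 *+ _)%R => idtac
  | _ => lazymatch goal with
         | H : is_true (0 <= iota e) |- _ => idtac
         | _ => let H := fresh "Hge" in pose proof (iota_ge0 e) as H
         end
  end.
Ltac nk_push := repeat match goal with
  | |- context [iota (?a + ?b)%R] => rewrite (iotaD a b)
  | |- context [iota (?a * ?b)%R] => rewrite (iotaM a b)
  | |- context [iota (@GRing.zero _)] => rewrite iota0
  | |- context [iota (@GRing.one _)] => rewrite iota1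
  | H : context [iota (?a + ?b)%R] |- _ => rewrite (iotaD a b) in H
  | H : context [iota (?a * ?b)%R] |- _ => rewrite (iotaM a b) in H
  | H : context [iota (@GRing.zero _)] |- _ => rewrite iota0 in H
  | H : context [iota (@GRing.one _)] |- _ => rewrite iota1 in H
  end.
Ltac nk_atoms := repeat match goal with
  | |- context [iota ?x] => lazymatch goal with H : is_true (0 <= iota x) |- _ => fail | _ => nk_leaf x end
  | _ : context [iota ?x] |- _ => lazymatch goal with H : is_true (0 <= iota x) |- _ => fail | _ => nk_leaf x end
  end.
(** Moves a goal about numbers into the field, where subtraction exists: strict inequalities become
    x + 1 <= y by discreteness, and every atom is recorded as nonnegative, after which [lra] or
    [nra] can finish. *)
Ltac nk := repeat match goal with H : _ <> _ |- _ => clear H end; nk_hyps;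
  lazymatch goal with
  | |- _ ≺ _ => apply/ltNK'
  | |- _ ⪯ _ => apply/leNK
  | |- ~ _ ≺ _ => apply/not_ltN/leNK
  | |- ~ _ ⪯ _ => apply/not_leN/ltNK'
  | |- @eq (ratio _) _ _ => idtac
  | |- @eq _ _ _ => try apply: iota_inj
  | _ => idtac
  end;
  nk_push; nk_atoms.
Ltac nlra := nk; lra.
Ltac nnra := nk; nra.

(** * Injectivity of the pairing *)

Section PairFacts.
Variable M : model.
Implicit Types x y z a b c d : carrier M.
Lemma spr_lel x y : x ⪯ spr x y. Proof. rewrite /spr; nnra. Qed.
Lemma spr_ler x y : y ⪯ spr x y.
Proof.
rewrite /spr; case: (leN0 y) => [H|<-]; last exact: leN0.
nnra.
Qed.
(** The pair of a and b lies between (a+b)^2 and (a+b+1)^2, and these blocks are disjoint for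
    different sums. *)
Lemma spr_lt a b c d : a + b ≺ c + d -> spr a b ≺ spr c d.
Proof.
rewrite /spr => H; nk.
have : 0 <= (iota c + iota d - (iota a + iota b + 1)) * (iota c + iota d + (iota a + iota b + 1)).
  by apply: mulr_ge0; lra.
lra.
Qed.
Lemma spr_inj a b c d : spr a b = spr c d -> a = c /\ b = d.
Proof.
move=> E; have S : a + b = c + d.
  by case: (ltN_cmp (a + b) (c + d)) => // /spr_lt; rewrite E => /ltNn.
have E1 : a = c by rewrite /spr S in E; nlra.
by split=> //; nlra.
Qed.
End PairFacts.

(** * Bounded definable predicates *)

Section Definability.
Variable M : model.
Local Notation N := (carrier M).
Local Notation Om := (set_of M).
Local Notation npred := ((nat -> N) -> (nat -> Om) -> Prop).
Implicit Types (P Q : npred) (t u : (nat -> N) -> N) (r : nat -> N) (h : nat -> Om).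

(** Predicates on assignments, up to equivalence, take the place of formulas: definability is then
    found by a syntax-directed search, and no de Bruijn formula has to be written down. *)
Definition D0 P : Prop := exists q, Delta0 q /\ forall r h, P r h <-> @sat M r h q.
Definition Tm t : Prop := exists s, forall r, t r = @eval M r s.

Lemma Tm_var k : Tm (fun r => r k). Proof. by exists (TVar k). Qed.
Lemma Tm_0 : Tm (fun _ => 0). Proof. by exists TZero. Qed.
Lemma Tm_1 : Tm (fun _ => 1). Proof. by exists TOne. Qed.
Lemma Tm_nat n : Tm (fun _ => n%:R).
Proof.
elim: n => [|n [s E]]; first by exists TZero.
by exists (TAdd s TOne) => r; rewrite /= -E -natr1.
Qed.
Lemma Tm_add t u : Tm t -> Tm u -> Tm (fun r => t r + u r).
Proof. by move=> [a A] [b B]; exists (TAdd a b) => r; rewrite A B. Qed.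
Lemma Tm_mul t u : Tm t -> Tm u -> Tm (fun r => t r * u r).
Proof. by move=> [a A] [b B]; exists (TMul a b) => r; rewrite A B. Qed.
Lemma Tm_spr t u : Tm t -> Tm u -> Tm (fun r => spr (t r) (u r)).
Proof. by move=> *; do !(apply: Tm_add || apply: Tm_mul). Qed.
Lemma Tm_strip t u (v : (nat -> N) -> N) : Tm t -> Tm u -> Tm v -> Tm (fun r => strip (t r) (u r) (v r)).
Proof. by move=> *; do 2!apply: Tm_spr => //. Qed.

Lemma eval_tsub r (s : nat -> tm) (a : tm) :
  @eval M r (tsub s a) = @eval M (fun n => @eval M r (s n)) a.
Proof. by elim: a => //= a -> b ->. Qed.
Lemma Tm_ren (f : nat -> nat) t : Tm t -> Tm (fun r => t (fun n => r (f n))).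
Proof. by move=> [a A]; exists (tsub (fun n => TVar (f n)) a) => r; rewrite A eval_tsub. Qed.

Lemma D0_ext P Q : (forall r h, P r h <-> Q r h) -> D0 Q -> D0 P.
Proof. by move=> E [q [D H]]; exists q; split=> // r h; rewrite E. Qed.
Lemma D0_eq t u : Tm t -> Tm u -> D0 (fun r _ => t r = u r).
Proof.
move=> [a A] [b B]; exists (FEq a b); split; first exact: Defs.D0_eq.
by move=> r h /=; rewrite A B.
Qed.
Lemma D0_lt t u : Tm t -> Tm u -> D0 (fun r _ => t r ≺ u r).
Proof.
move=> [a A] [b B]; exists (FLt a b); split; first exact: Defs.D0_lt.
by move=> r h /=; rewrite A B.
Qed.
Lemma D0_in t k : Tm t -> D0 (fun r h => inS (t r) (h k)).
Proof.
move=> [a A]; exists (FIn a k); split; first exact: Defs.D0_in.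
by move=> r h /=; rewrite A.
Qed.
Lemma D0_False : D0 (fun _ _ => False).
Proof. by exists FBot; split=> //; exact: Defs.D0_bot. Qed.
Lemma D0_imp P Q : D0 P -> D0 Q -> D0 (fun r h => P r h -> Q r h).
Proof.
move=> [a [DA A]] [b [DB B]]; exists (FImp a b); split; first exact: Defs.D0_imp.
by move=> r h /=; rewrite A B.
Qed.
Lemma D0_not P : D0 P -> D0 (fun r h => ~ P r h).
Proof. by move=> H; apply: D0_imp => //; apply: D0_False. Qed.
Lemma D0_and P Q : D0 P -> D0 Q -> D0 (fun r h => P r h /\ Q r h).
Proof.
move=> [a [DA A]] [b [DB B]]; exists (FAnd a b); split; last by move=> r h; rewrite sat_and A B.
by do !apply: Defs.D0_imp => //; exact: Defs.D0_bot.
Qed.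
Lemma D0_or P Q : D0 P -> D0 Q -> D0 (fun r h => P r h \/ Q r h).
Proof.
move=> [a [DA A]] [b [DB B]]; exists (FOr a b); split; last by move=> r h; rewrite sat_or A B.
by do !apply: Defs.D0_imp => //; exact: Defs.D0_bot.
Qed.
Lemma D0_iff P Q : D0 P -> D0 Q -> D0 (fun r h => P r h <-> Q r h).
Proof.
by move=> A B; apply: D0_and; apply: D0_imp.
Qed.
Lemma D0_le t u : Tm t -> Tm u -> D0 (fun r _ => t r ⪯ u r).
Proof. by move=> A B; apply: D0_or; [apply: D0_lt|apply: D0_eq]. Qed.
Lemma D0_ball t (P : N -> npred) : Tm t -> D0 (fun r h => P (r 0%N) (fun n => r (S n)) h) ->
  D0 (fun r h => forall x, x ≺ t r -> P x r h).
Proof.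
move=> [a A] [b [DB B]]; exists (FBall a b); split; first exact: Defs.D0_ball.
have E (x : N) r : eval (scons x r) (tshift a) = t r.
  by rewrite A /tshift; elim: (a) => //= s -> w ->.
move=> r h; split=> /= H x.
- by rewrite E => /H K; apply/B.
- by move: (H x); rewrite E => {}H /H /B.
Qed.
Lemma D0_bex t (P : N -> npred) : Tm t -> D0 (fun r h => P (r 0%N) (fun n => r (S n)) h) ->
  D0 (fun r h => exists x, x ≺ t r /\ P x r h).
Proof.
move=> A B; apply: (@D0_ext _ (fun r h => ~ forall x, x ≺ t r -> ~ P x r h)).
  move=> r h; split=> [[x [L H]] K|H]; first exact: K L H.
  by apply: contrapT => K; apply: H => x L H; apply: K; exists x.
by apply: D0_not; apply: D0_ball => //; apply: D0_not.
Qed.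

Definition bex (b : N) (P : N -> Prop) := exists x, x ≺ b + 1 /\ P x.
Lemma bexE b (P0 : N -> Prop) : (forall x, P0 x -> x ⪯ b) -> (exists x, P0 x) <-> bex b P0.
Proof.
move=> H; split=> [[x Px]|[x [_ Px]]]; exists x => //; split=> //.
by have := H _ Px => L; nlra.
Qed.

(** The components of a pair are at most the pair, and the quotient [w] is at most [n], so every
    witness in the formal membership is bounded by the code. *)
Lemma smemE (x c : N) : smem x c <-> bex c (fun k => bex c (fun m => bex c (fun n =>
  c = spr k (spr m n) /\ x ≺ k /\ bex n (fun w => n = w * (m * (x + 1) + 1))))).
Proof.
split=> [[k [m [n [E [L [w Ew]]]]]]|[k [_ [m [_ [n [_ [E [L [w [_ Ew]]]]]]]]]]]; last first.
  by exists k, m, n; split=> //; split=> //; exists w.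
have Lk : k ⪯ c by rewrite E; apply: spr_lel.
have Lc : spr m n ⪯ c by rewrite E; apply: spr_ler.
have Lm := spr_lel m n; have Ln := spr_ler m n.
have Lw : w ⪯ n by rewrite Ew mulrDr mulr1 addrC; apply: leN_addr.
exists k; split; first by nlra.
exists m; split; first by nlra.
exists n; split; first by nlra.
do 2!split=> //; exists w; split=> //; nlra.
Qed.

End Definability.

Ltac tm := repeat first [ assumption | lazymatch goal with
  | |- Tm (fun r => r _) => apply: Tm_var
  | |- Tm (fun _ => 0) => apply: Tm_0
  | |- Tm (fun _ => 1) => apply: Tm_1
  | |- Tm (fun r => _ + _) => apply: Tm_add
  | |- Tm (fun r => _ * _) => apply: Tm_mul
  | |- Tm (fun r => spr _ _) => apply: Tm_spr
  | |- Tm (fun r => strip _ _ _) => apply: Tm_strip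
  | |- Tm (fun r => _%:R) => apply: Tm_nat
  end | match goal with H : Tm ?t |- Tm (fun r => ?t _) => apply: (Tm_ren _ H) end ].
Ltac d0_known := fail.
Ltac d0 := repeat (cbv beta; first [ d0_known | lazymatch goal with
  | |- Tm _ => solve [tm]
  | |- D0 (fun r h => _ = _) => apply: D0_eq
  | |- D0 (fun r h => _ ≺ _) => apply: D0_lt
  | |- D0 (fun r h => _ ⪯ _) => apply: D0_le
  | |- D0 (fun r h => inS _ (h _)) => apply: D0_in
  | |- D0 (fun r h => False) => apply: D0_False
  | |- D0 (fun r h => _ /\ _) => apply: D0_and
  | |- D0 (fun r h => _ \/ _) => apply: D0_or
  | |- D0 (fun r h => _ <-> _) => apply: D0_iff
  | |- D0 (fun r h => ~ _) => apply: D0_not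
  | |- D0 (fun r h => bex _ _) => apply: D0_bex
  | |- D0 (fun r h => exists x, x ≺ _ /\ _) => apply: D0_bex
  | |- D0 (fun r h => forall x, x ≺ _ -> _) => apply: D0_ball
  | |- D0 (fun r h => _ -> _) => apply: D0_imp
  end ]).

Section DefinabilityDvd.
Variable M : model.
Local Notation N := (carrier M).
Local Notation Om := (set_of M).
Local Notation npred := ((nat -> N) -> (nat -> Om) -> Prop).
Implicit Types (P Q : npred) (t u : (nat -> N) -> N) (r : nat -> N) (h : nat -> Om).
Lemma D0_smem t u : Tm t -> Tm u -> D0 (fun r _ => smem (t r) (u r)).
Proof.
move=> A B; apply: D0_ext; first by move=> r h; apply: smemE.
d0.
Qed.
Definition dvd (a b : N) : Prop := exists q, b = q * a.
Lemma dvdE a b : dvd a b <-> bex b (fun q => b = q * a).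
Proof.
split=> [[q E]|[q [_ E]]]; last by exists q.
case: (leN0 a) => [Ha|E0]; last first.
  by exists 0; rewrite E -E0 !mulr0; split=> //; rewrite add0r; apply: ltN01.
exists q; split=> //; rewrite E; nk; nra.
Qed.
Lemma D0_dvd t u : Tm t -> Tm u -> D0 (fun r _ => dvd (t r) (u r)).
Proof. move=> A B; apply: D0_ext; first by move=> r h; apply: dvdE. d0. Qed.

End DefinabilityDvd.
Ltac d0_known ::= lazymatch goal with
  | |- D0 (fun r h => smem _ _) => apply: D0_smem
  | |- D0 (fun r h => dvd _ _) => apply: D0_dvd
  end.

(** * Induction, comprehension and coding of finite sets *)

Section Schemes.
Variable M : model.
Local Notation N := (carrier M).
Local Notation Om := (set_of M).
Local Notation npred := ((nat -> N) -> (nat -> Om) -> Prop).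
Implicit Types (P Q : npred) (t u : (nat -> N) -> N) (r : nat -> N) (h : nat -> Om).

Lemma sat_fsub (p : fm) (s : nat -> tm) (f : nat -> nat) r h :
  @sat M r h (fsub s f p) <-> @sat M (fun n => @eval M r (s n)) (fun X => h (f X)) p.
Proof.
elim: p s f r h => [a b|a b|a X||p IHp q IHq|p IHp|p IHp] s f r h /=.
- by rewrite !eval_tsub.
- by rewrite !eval_tsub.
- by rewrite !eval_tsub.
- by [].
- by rewrite IHp IHq.
- have E x : (fun n => eval (M := M) (scons x r) (upN s n)) = scons x (fun n => eval (M := M) r (s n)).
    by apply: funext; case=> //= n; rewrite /tshift eval_tsub.
  by split=> H x; have := H x; rewrite IHp E.
- have E A : (fun X => scons A h (upS f X)) = scons A (fun X => h (f X)).
    by apply: funext; case.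
  by split=> H A; have := H A; rewrite IHp E.
Qed.

Lemma sat_closure p c : is_closure p c -> (forall r h, @sat M r h c) -> forall r h, @sat M r h p.
Proof.
move=> [m [k [_ ->]]]; elim: m => [|m IH] /= H; last first.
  apply: IH => r h; have := H (fun n => r (S n)) h (r 0%N).
  by congr sat; apply: funext; case.
elim: k H => [|k IH] //= H; apply: IH => r h; have := H r (fun n => h (S n)) (h 0%N).
by congr sat; apply: funext; case.
Qed.

Lemma closure_ex p : exists c, is_closure p c.
Proof. by have [m H] := fbelow_ex p; exists (Nat.iter m FAllN (Nat.iter m FAllS p)), m, m. Qed.

(** Index 0 is the existential witness, index 1 the induction variable, and the parameters start at
    index 2. *)
Lemma sigma_ind (P : N -> N -> npred) :
  D0 (fun r h => P (r 0%N) (r 1%N) (fun k => r (S (S k))) h) -> forall r h,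
  (exists w, P w 0 r h) -> (forall n, (exists w, P w n r h) -> exists w, P w (n + 1) r h) ->
  forall n, exists w, P w n r h.
Proof.
move=> [q [Dq Hq]] r h H0 HS.
have [c Hc] := closure_ex (induction_ax (FExN q)).
have Ax : @sat M r h (induction_ax (FExN q)).
  apply: (sat_closure Hc) => r' h'; apply: model_sat; apply: RCA0_induction Hc.
  by exists q.
have E n : @sat M (scons n r) h (FExN q) <-> exists w, P w n r h.
  by rewrite sat_exN; split=> -[w H]; exists w; move: H; rewrite -Hq.
move: Ax; rewrite /induction_ax; set ps := fsub _ _ _ => Ax n; apply/E.
suff H : @sat M r h (FAnd (instN (FExN q) TZero) (FAllN (FImp (FExN q) ps))) by exact: (Ax H n).
apply/sat_and; split.
- rewrite /instN sat_fsub.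
  rewrite (_ : (fun _ => _) = scons (0 : N) r); last by apply: funext; case.
  by apply/E.
- move=> {}n /E /HS /E; rewrite -/(sat _ _ _) /ps sat_fsub; congr sat.
  by apply: funext; case.
Qed.

Lemma comprehension (P Q : N -> N -> npred) :
  D0 (fun r h => P (r 0%N) (r 1%N) (fun k => r (S (S k))) h) ->
  D0 (fun r h => Q (r 0%N) (r 1%N) (fun k => r (S (S k))) h) -> forall r h,
  (forall n, (exists w, P w n r h) <-> (forall w, Q w n r h)) ->
  exists A, forall n, inS n A <-> exists w, P w n r h.
Proof.
move=> [p [Dp Hp]] [q [Dq Hq]] r h H.
have [c Hc] := closure_ex (comprehension_ax (FExN p) (FAllN q)).
have Ax : @sat M r h (comprehension_ax (FExN p) (FAllN q)).
  apply: (sat_closure Hc) => r' h'; apply: model_sat; apply: RCA0_comprehension Hc.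
  - by exists p.
  - by exists q.
have E n : @sat M (scons n r) h (FExN p) <-> exists w, P w n r h.
  by rewrite sat_exN; split=> -[w K]; exists w; move: K; rewrite -Hp.
have F n : @sat M (scons n r) h (FAllN q) <-> forall w, Q w n r h.
  by split=> K w; apply: (proj2 (Hq _ _) (K w)) || apply: (proj1 (Hq _ _) (K w)).
have /sat_exS[A HA] : @sat M r h (FExS (FAllN (FIff (FIn (TVar 0) 0) (shiftS (FExN p))))).
  have K n : @sat M (scons n r) h (FIff (FExN p) (FAllN q)) by rewrite sat_iff E F.
  exact: (Ax K).
have K n : @sat M (scons n r) (scons A h) (FIff (FIn (TVar 0) 0) (shiftS (FExN p))) := HA n.
by exists A => n; rewrite -E; have := K n; rewrite sat_iff sat_fsub.
Qed.

Lemma Delta0_sub s f q : Delta0 q -> Delta0 (fsub s f q).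
Proof.
move=> H; elim: H s => {q} /= [t u|t u|t X||p q _ IHp _ IHq|t p _ IH] s.
- exact: Defs.D0_eq.
- exact: Defs.D0_lt.
- exact: Defs.D0_in.
- exact: Defs.D0_bot.
- exact: Defs.D0_imp.
- rewrite (_ : FAllN _ = FBall (tsub s t) (fsub (upN s) f p)); first exact: Defs.D0_ball.
  by rewrite /FBall /= /tshift !tsub_comp.
Qed.

Lemma D0_ren (g : nat -> nat) P : D0 P -> D0 (fun r h => P (fun k => r (g k)) h).
Proof.
move=> [q [Dq Hq]]; exists (fsub (fun k => TVar (g k)) id q); split; first exact: Delta0_sub.
by move=> r h; rewrite Hq sat_fsub.
Qed.

Lemma D0_weak (P : N -> npred) : D0 (fun r h => P (r 0%N) (fun k => r (S k)) h) ->
  D0 (fun r h => P (r 1%N) (fun k => r (S (S k))) h).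
Proof. by move=> /(D0_ren S). Qed.

Lemma D0_comprehension (P : N -> npred) :
  D0 (fun r h => P (r 0%N) (fun k => r (S k)) h) -> forall r h,
  exists A, forall n, inS n A <-> P n r h.
Proof.
move=> /D0_weak HP r h.
have [|A HA] := comprehension (P := fun _ => P) (Q := fun _ => P) HP HP (r := r) (h := h).
  by move=> n; split=> [[_ H]//|H]; exists 0; apply: H; exact: 0.
by exists A => n; rewrite HA; split=> [[]//|H]; exists 0.
Qed.

Lemma set_ind (A : Om) : inS 0 A -> (forall n, inS n A -> inS (n + 1) A) -> forall n, inS n A.
Proof.
move=> H0 HS n; pose P (w n : N) (r : nat -> N) h := @inS M n (h 0%N).
have D : D0 (fun r h => P (r 0%N) (r 1%N) (fun k => r (S (S k))) h) by rewrite /P; d0.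
have := @sigma_ind P D (fun _ => 0) (fun _ => A).
rewrite /P => /(_ _ _ n)[||_ //]; first by exists 0.
by move=> m [_ Hm]; exists 0; apply: HS.
Qed.

Lemma D0_ind (P : N -> npred) : D0 (fun r h => P (r 0%N) (fun k => r (S k)) h) -> forall r h,
  P 0 r h -> (forall n, P n r h -> P (n + 1) r h) -> forall n, P n r h.
Proof.
move=> /D0_comprehension HP r h H0 HS n; have [A HA] := HP r h.
by apply/HA; apply: set_ind => [|m /HA Hm]; apply/HA => //; apply: HS.
Qed.

Implicit Types A : Om.
Definition env (s : seq N) : nat -> N := nth 0 s.
Definition senv (s : seq Om) : nat -> Om := nth (inh M) s.

(** A factorial, obtained by Sigma_1 induction before any recursion is available. It will make the
    moduli of the set coding pairwise coprime. *)
Lemma common_multiple (k : N) : exists m, 0 ≺ m /\ forall x, x ≺ k -> dvd (x + 1) m.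
Proof.
pose P (m k : N) (r : nat -> N) (h : nat -> Om) := 0 ≺ m /\ forall x, x ≺ k -> dvd (x + 1) m.
have D : D0 (fun r h => P (r 0%N) (r 1%N) (fun k => r (S (S k))) h) by rewrite /P; d0.
apply: (sigma_ind D (r := env [::]) (h := senv [::])).
- by exists 1; split; [exact: ltN01|move=> x H; nlra].
- move=> n [m [Hm H]]; exists (m * (n + 1)); split=> [|x L]; first by nnra.
  case: (ltN_cmp x n) => [/H[q ->]|->|K]; last by nlra.
  + by exists (q * (n + 1)); ring.
  + by exists m.
Qed.

(* A Bezout identity: if [d] divides [m] then [(x+1)^2 (m/d) (b-a) = (a-1)^2] for
   [a = m(x+1)+1] and [b = a + md]. *)
Lemma coprime_up (m d m' x n : N) : m = d * m' ->
  dvd (m * (x + 1) + 1) (n * (m * (x + d + 1) + 1)) <-> dvd (m * (x + 1) + 1) n.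
Proof.
move=> Em; set a := m * (x + 1) + 1; have Eb : m * (x + d + 1) + 1 = a + m * d by rewrite /a; ring.
rewrite Eb; split=> [[w Hw]|[q ->]]; last by exists (q * (a + m * d)); ring.
pose e := (x + 1) * (x + 1) * m'.
have E1 : iota n * (iota a * (iota a - 2) + 1 + iota e * iota a) = iota e * iota w * iota a.
  transitivity (iota e * (iota n * iota (a + m * d))); last first.
    by rewrite -iotaM Hw iotaM; ring.
  rewrite /e Em /a Em !(iotaD, iotaM) iota1; ring.
have Ha : 1 <= iota a by rewrite /a iotaD iota1 lerDr; apply: iota_ge0.
clearbody e a.
(* The quotient is e w + 2n - n (a + e), as [E1] shows; numbers have no subtraction, so its
   nonnegativity is proved before it is named. *)
have : n * (a + e) ⪯ e * w + n + n.
  apply/leNK; rewrite !(iotaD, iotaM).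
  rewrite -(ler_pM2l (lt_le_trans ltr01 Ha)).
  have -> : iota a * (iota e * iota w + iota n + iota n) =
     iota a * (iota n * (iota a + iota e)) + iota n.
    transitivity (iota e * iota w * iota a + 2 * iota n * iota a); first by ring.
    by rewrite -E1; ring.
  by rewrite lerDl iota_ge0.
case/leN_subE => q /(congr1 (@iota _)); rewrite !(iotaD, iotaM) => Hq.
exists q; apply: iota_inj; rewrite !iotaM.
have {}Hq : iota q = iota e * iota w + iota n + iota n - iota n * (iota a + iota e).
  by rewrite -Hq addrC addKr.
rewrite Hq; lra.
Qed.
(** The same identity with the larger modulus in the role of [a], so that the difference of the
    moduli changes sign. *)
Lemma coprime_down (m d m' x n : N) : m = d * m' ->
  dvd (m * (x + d + 1) + 1) (n * (m * (x + 1) + 1)) <-> dvd (m * (x + d + 1) + 1) n.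
Proof.
move=> Em; set b := m * (x + 1) + 1; have Ea : m * (x + d + 1) + 1 = b + m * d by rewrite /b; ring.
rewrite Ea; set a := b + m * d; split=> [[w Hw]|[q ->]]; last by exists (q * b); ring.
pose e := (x + d + 1) * (x + d + 1) * m'.
have E1 : iota n * (iota a * (iota a - 2) + 1 - iota e * iota a) = - (iota e * iota w * iota a).
  transitivity (- iota e * (iota n * iota b)); last first.
    by rewrite -iotaM Hw iotaM; ring.
  rewrite /e /a /b Em !(iotaD, iotaM) iota1; ring.
have Ha : 1 <= iota a by rewrite /a /b addrAC iotaD iota1 lerDr; apply: iota_ge0.
clearbody e a.
have : n * a + e * w ⪯ e * n + n + n.
  apply/leNK; rewrite !(iotaD, iotaM).
  rewrite -(ler_pM2l (lt_le_trans ltr01 Ha)).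
  have -> : iota a * (iota e * iota n + iota n + iota n) =
     iota a * (iota n * iota a + iota e * iota w) + iota n.
    transitivity (iota n * (iota a * (iota a - 2) + 1) + 2 * iota n * iota a
      - iota n * (iota a * (iota a - 2) + 1 - iota e * iota a)); first by ring.
    by rewrite E1; ring.
  by rewrite lerDl iota_ge0.
case/leN_subE => q /(congr1 (@iota _)); rewrite !(iotaD, iotaM) => Hq.
exists q; apply: iota_inj; rewrite !iotaM.
have {}Hq : iota q = iota e * iota n + iota n + iota n - (iota n * iota a + iota e * iota w).
  by rewrite -Hq addrC addKr.
rewrite Hq; lra.
Qed.
(** The difference of the two indices is at most [k], hence divides [m], and its sign decides which
    of the two preceding lemmas applies. *)
Lemma coprime (m k x j n : N) : (forall z, z ≺ k -> dvd (z + 1) m) -> x ≺ k -> j ≺ k -> x <> j ->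
  dvd (m * (x + 1) + 1) (n * (m * (j + 1) + 1)) <-> dvd (m * (x + 1) + 1) n.
Proof.
move=> Hm Hx Hj; case: (ltN_cmp x j) => [/ltN_S/leN_subE[d E]|//|/ltN_S/leN_subE[d E]] _.
- have [m' Em] : dvd (d + 1) m by apply: Hm; nlra.
  rewrite -E (_ : x + 1 + d = x + (d + 1)); last by ring.
  by apply: coprime_up; rewrite Em mulrC.
- have [m' Em] : dvd (d + 1) m by apply: Hm; nlra.
  rewrite -E (_ : j + 1 + d = j + (d + 1)); last by ring.
  by apply: coprime_down; rewrite Em mulrC.
Qed.

(** [n] is the product of the moduli m(x+1)+1 over the members x below [k], built up one candidate
    at a time. By coprimality a new factor affects no membership but its own. *)
Lemma code_set A (k : N) : exists c, forall x, smem x c <-> x ≺ k /\ inS x A.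
Proof.
have [m [Hm Hd]] := common_multiple k.
pose P (n j : N) (r : nat -> N) h := forall x, x ≺ r 0%N ->
  dvd (r 1%N * (x + 1) + 1) n <-> x ≺ j /\ @inS M x (h 0%N).
have D : D0 (fun r h => P (r 0%N) (r 1%N) (fun k => r (S (S k))) h) by rewrite /P; d0.
have [||n Hn] := sigma_ind D (r := env [:: k; m]) (h := senv [:: A]) _ _ k.
(* The empty product: every modulus is at least 2 and so does not divide 1. *)
- exists 1 => x; rewrite /env /= => Hx; split=> [[q E]|[L]]; last by nlra.
  exfalso; case: (leN0 q) => [Hq|E0]; last by rewrite -E0 in E; nlra.
  have L : 1 + 1 ⪯ m * (x + 1) + 1 by clear E; nnra.
  have : 1 + 1 ⪯ q * (m * (x + 1) + 1).
    by clear E; set a := m * _ + 1 in L *; clearbody a; nnra.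
  by rewrite -E => H; nlra.
- move=> j [n]; rewrite /P /env /= => IH.
  have [[Lj Aj]|C] := pselect (j ≺ k /\ inS j A); last first.
    exists n => x Hx; rewrite IH //; split=> -[L Ax]; split=> //; first by nlra.
    by case: (ltN_cmp x j) => // [E|K]; [case: C; rewrite -E|nlra].
  exists (n * (m * (j + 1) + 1)) => x Hx.
  have [E|E] := pselect (x = j).
    by rewrite E; split=> [_|_]; [split=> //; nlra|exists n].
  rewrite (coprime _ Hd) // IH //; split=> -[L Ax]; split=> //; first by nlra.
  by case: (ltN_cmp x j) => // K; nlra.
exists (spr k (spr m n)) => x; rewrite /P /env /= in Hn.
split=> [[k' [m' [n' [/spr_inj[<- /spr_inj[<- <-]] [L W]]]]]|[L Ax]].
- by split=> //; move: (Hn x L) => [H _]; case: H.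
- by exists k, m, n; split=> //; split=> //; apply/Hn.
Qed.

Lemma smem_lt (x c : N) : smem x c -> x ≺ c.
Proof.
move=> [k [m [n [-> [L _]]]]]; have := spr_lel k (spr m n) => H.
by set s := spr _ _ in H *; clearbody s; nlra.
Qed.

Lemma code_D0 (P : N -> npred) : D0 (fun r h => P (r 0%N) (fun k => r (S k)) h) ->
  forall r h k, exists c, forall x, smem x c <-> x ≺ k /\ P x r h.
Proof.
move=> D r h k; have [A HA] := D0_comprehension D r h; have [c Hc] := code_set A k.
by exists c => x; rewrite Hc HA.
Qed.

Lemma code_union (c c' : N) : exists d, forall x, smem x d <-> smem x c \/ smem x c'.
Proof.
pose P (x : N) (r : nat -> N) (h : nat -> Om) := smem x (r 0%N) \/ smem x (r 1%N).
have D : D0 (fun r h => P (r 0%N) (fun k => r (S k)) h) by rewrite /P; d0.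
have [d Hd] := code_D0 D (env [:: c; c']) (senv [::]) (c + c').
exists d => x; rewrite Hd /P /env /=; split=> [[]//|H]; split=> //.
by case: H => /smem_lt H; nlra.
Qed.

Lemma code_single (y : N) : exists d, forall x, smem x d <-> x = y.
Proof.
pose P (x : N) (r : nat -> N) (h : nat -> Om) := x = r 0%N.
have D : D0 (fun r h => P (r 0%N) (fun k => r (S k)) h) by rewrite /P; d0.
have [d Hd] := code_D0 D (env [:: y]) (senv [::]) (y + 1).
by exists d => x; rewrite Hd /P /env /=; split=> [[]//|->]; split=> //; nlra.
Qed.
End Schemes.

(** * Computations *)

Section Computations.
Variables (M : model) (Z : set_of M).
Local Notation N := (carrier M).
Local Notation Om := (set_of M).
Implicit Types (D e x y z u v w a f g n : N).

Lemma leN_trans x y z : x ⪯ y -> y ⪯ z -> x ⪯ z.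
Proof. by move=> H K; nlra. Qed.
Lemma strip_le e x y : [/\ e ⪯ strip e x y, x ⪯ strip e x y & y ⪯ strip e x y].
Proof.
split; first exact: spr_lel.
- exact: leN_trans (spr_lel x y) (spr_ler e _).
- exact: leN_trans (spr_ler x y) (spr_ler e _).
Qed.
Lemma strip_inj e x y e' x' y' : strip e x y = strip e' x' y' -> [/\ e = e', x = x' & y = y'].
Proof. by case/spr_inj => -> /spr_inj[-> ->]. Qed.
Lemma smem_strip e x y D : smem (strip e x y) D -> [/\ e ⪯ D, x ⪯ D & y ⪯ D].
Proof.
move=> /smem_lt; have [] := strip_le e x y; move: (strip e x y) => s *.
by split; nlra.
Qed.

Lemma or_iff_compat (P Q P' Q' : Prop) : (P <-> P') -> (Q <-> Q') -> (P \/ Q <-> P' \/ Q').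
Proof. tauto. Qed.
Lemma and_iff_compat_l (P Q Q' : Prop) : (Q <-> Q') -> (P /\ Q <-> P /\ Q').
Proof. tauto. Qed.

Definition good D : Prop := forall e x y, smem (strip e x y) D -> sjustified Z D e x y.

(** [sjustified] with each quantifier bounded by the index, the argument, the value or the code of
    the computation, which makes it Delta_0. *)
Definition bjustified (A : Om) D e x y : Prop :=
  (e = spr 0%:R 0 /\ y = 0) \/
  (e = spr 1%:R 0 /\ y = x + 1) \/
  (e = spr 2%:R 0 /\ bex x (fun b => x = spr y b)) \/
  (e = spr 3%:R 0 /\ bex x (fun a => x = spr a y)) \/
  (e = spr 4%:R 0 /\ ((inS x A /\ y = 1) \/ (~ inS x A /\ y = 0))) \/
  (bex e (fun f => bex e (fun g => e = spr 5%:R (spr f g) /\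
     bex y (fun u => bex y (fun v => y = spr u v /\ smem (strip f x u) D /\ smem (strip g x v) D))))) \/
  (bex e (fun f => bex e (fun g => e = spr 6%:R (spr f g) /\
     bex D (fun u => smem (strip g x u) D /\ smem (strip f u y) D)))) \/
  (bex e (fun f => bex e (fun g => e = spr 7%:R (spr f g) /\
     bex x (fun a => (x = spr a 0 /\ smem (strip f a y) D) \/
       bex x (fun n => bex D (fun u => x = spr a (n + 1) /\ smem (strip e (spr a n) u) D /\
                   smem (strip g (spr a (spr n u)) y) D)))))) \/
  (bex e (fun f => e = spr 8%:R f /\ smem (strip f (spr x y) 0) D /\
     forall n, n ≺ y -> bex D (fun u => smem (strip f (spr x n) u) D /\ 0 ≺ u))).

Lemma ex_bex b (P Q : N -> Prop) : (forall x, P x -> x ⪯ b) -> (forall x, P x <-> Q x) ->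
  (exists x, P x) <-> bex b Q.
Proof.
by move=> H E; rewrite (bexE H); split=> -[x [L /E K]]; exists x.
Qed.

Lemma bjustifiedE A D e x y : sjustified A D e x y <-> bjustified A D e x y.
Proof.
have T k f g : e = spr k%:R (spr f g) -> f ⪯ e /\ g ⪯ e.
  by move=> ->; split; apply: leN_trans (spr_ler _ _); [apply: spr_lel|apply: spr_ler].
have T2 k f : e = spr k%:R f -> f ⪯ e by move=> ->; apply: spr_ler.
do 2!(apply: or_iff_compat; first by []).
apply: or_iff_compat.
  apply: and_iff_compat_l; apply: ex_bex => // b ->; apply: spr_ler.
apply: or_iff_compat.
  apply: and_iff_compat_l; apply: ex_bex => // b ->; apply: spr_lel.
apply: or_iff_compat; first by [].
apply: or_iff_compat.
  apply: ex_bex => [f [g [/T[]//]]|f]; apply: ex_bex => [g [/T[]//]|g].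
  apply: and_iff_compat_l; apply: ex_bex => [u [v [-> _]]|u]; first exact: spr_lel.
  by apply: ex_bex => // v [-> _]; apply: spr_ler.
apply: or_iff_compat.
  apply: ex_bex => [f [g [/T[]//]]|f]; apply: ex_bex => [g [/T[]//]|g].
  by apply: and_iff_compat_l; apply: ex_bex => // u [/smem_strip[]].
apply: or_iff_compat.
  apply: ex_bex => [f [g [/T[]//]]|f]; apply: ex_bex => [g [/T[]//]|g].
  apply: and_iff_compat_l; apply: ex_bex => [a [[-> _]|[n [u [-> _]]]]|a]; try exact: spr_lel.
  apply: or_iff_compat => //; apply: ex_bex => [n [u [-> _]]|n].
    by apply: leN_trans (spr_ler _ _); apply: leN_addr.
  by apply: ex_bex => // u [_ [/smem_strip[]]].
apply: ex_bex => [f [/T2]//|f]; do 2!apply: and_iff_compat_l.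
have R n : (exists u, smem (strip f (spr x n) u) D /\ 0 ≺ u) <->
    bex D (fun u => smem (strip f (spr x n) u) D /\ 0 ≺ u).
  by apply: ex_bex => // u [/smem_strip[]].
by split=> H n L; apply/R; apply: H.
Qed.

Definition bgood A D : Prop := forall t, t ≺ D -> smem t D ->
  forall e, e ≺ t + 1 -> forall x, x ≺ t + 1 -> forall y, y ≺ t + 1 -> t = strip e x y ->
  bjustified A D e x y.
Lemma bgoodE D : good D <-> bgood Z D.
Proof.
split=> [H t Lt Ht e Le x Lx y Ly E|H e x y Hm].
  by apply/bjustifiedE/H; rewrite -E.
have [Le Lx Ly] := strip_le e x y; apply/bjustifiedE.
by apply: (H _ (smem_lt Hm) Hm) => //; move: (strip e x y) Le Lx Ly => s *; nlra.
Qed.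
Lemma D0_bjustified k (t1 t2 t3 t4 : (nat -> N) -> N) : Tm t1 -> Tm t2 -> Tm t3 -> Tm t4 ->
  D0 (fun r h => bjustified (h k) (t1 r) (t2 r) (t3 r) (t4 r)).
Proof. by move=> *; rewrite /bjustified; d0. Qed.
End Computations.

Ltac d0_known ::= lazymatch goal with
  | |- D0 (fun r h => smem _ _) => apply: D0_smem
  | |- D0 (fun r h => bjustified (h _) _ _ _ _) => apply: D0_bjustified
  end.
Lemma D0_bgood (M : model) k (t : (nat -> carrier M) -> carrier M) :
  Tm t -> D0 (fun r h => bgood (h k) (t r)).
Proof. by move=> *; rewrite /bgood; d0. Qed.
Ltac d0_known ::= lazymatch goal with
  | |- D0 (fun r h => smem _ _) => apply: D0_smem
  | |- D0 (fun r h => bgood (h _) _) => apply: D0_bgood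
  end.

(** * Building computations, and the uniqueness of their values *)

Section Closure.
Variables (M : model) (Z : set_of M).
Local Notation N := (carrier M).
Local Notation Om := (set_of M).
Local Notation good := (good Z).
Local Notation cmp := (scomputes Z).
Implicit Types (D e x y z u v w a f g n : N).

Definition sub D D' : Prop := forall z, smem z D -> smem z D'.

(** The computation occurs only positively in a justification. *)
Lemma sjustified_mono D D' e x y : sub D D' -> sjustified Z D e x y -> sjustified Z D' e x y.
Proof.
move=> S [H|[H|[H|[H|[H|[[f [g [E [u [v [H1 [H2 H3]]]]]]]|[[f [g [E [u [H1 H2]]]]]|[[f [g [E [a H]]]]|[f [E [H1 H2]]]]]]]]]]].
- by left.
- by right; left.
- by do 2!right; left.
- by do 3!right; left.
- by do 4!right; left.
- by do 5!right; left; exists f, g; split=> //; exists u, v; split=> //; split; apply: S.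
- by do 6!right; left; exists f, g; split=> //; exists u; split; apply: S.
- do 7!right; left; exists f, g; split=> //; exists a.
  case: H => [[H1 H2]|[n [u [H1 [H2 H3]]]]]; [left|right]; first by split=> //; apply: S.
  by exists n, u; split=> //; split; apply: S.
- do 8!right; exists f; split=> //; split=> [|n /H2[u [H3 H4]]]; first exact: S.
  by exists u; split=> //; apply: S.
Qed.

Lemma good_union D D' : good D -> good D' -> exists D2, [/\ good D2, sub D D2 & sub D' D2].
Proof.
move=> G G'; have [D2 H] := code_union D D'.
have S : sub D D2 by move=> z Hz; apply/H; left.
have S' : sub D' D2 by move=> z Hz; apply/H; right.
exists D2; split=> // e x y /H[/G|/G']; exact: sjustified_mono.
Qed.

Lemma good_add D e x y : good D -> sjustified Z D e x y -> cmp e x y.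
Proof.
move=> G J; have [D1 H1] := code_single (strip e x y); have [D2 H2] := code_union D D1.
have S : sub D D2 by move=> z Hz; apply/H2; left.
exists D2; split; first by apply/H2; right; apply/H1.
move=> e' x' y' /H2[/G|/H1/strip_inj[-> -> ->]]; first exact: sjustified_mono.
exact: sjustified_mono J.
Qed.

Lemma good0 : good 0.
Proof. by move=> e x y /smem_lt H; nlra. Qed.

Lemma cmp_zero x : cmp (spr 0%:R 0) x 0.
Proof. by apply: (good_add good0); left. Qed.
Lemma cmp_succ x : cmp (spr 1%:R 0) x (x + 1).
Proof. by apply: (good_add good0); right; left. Qed.
Lemma cmp_fst x y : cmp (spr 2%:R 0) (spr x y) x.
Proof. by apply: (good_add good0); do 2!right; left; split=> //; exists y. Qed.
Lemma cmp_snd x y : cmp (spr 3%:R 0) (spr x y) y.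
Proof. by apply: (good_add good0); do 3!right; left; split=> //; exists x. Qed.
Lemma cmp_or1 x : inS x Z -> cmp (spr 4%:R 0) x 1.
Proof. by move=> H; apply: (good_add good0); do 4!right; left; split=> //; left. Qed.
Lemma cmp_or0 x : ~ inS x Z -> cmp (spr 4%:R 0) x 0.
Proof. by move=> H; apply: (good_add good0); do 4!right; left; split=> //; right. Qed.

Lemma cmp2 e x y e' x' y' : cmp e x y -> cmp e' x' y' ->
  exists D, [/\ good D, smem (strip e x y) D & smem (strip e' x' y') D].
Proof.
move=> [D [H G]] [D' [H' G']]; have [D2 [G2 S S']] := good_union G G'.
by exists D2; split=> //; [apply: S|apply: S'].
Qed.

Lemma cmp_pair f g x u v : cmp f x u -> cmp g x v -> cmp (spr 5%:R (spr f g)) x (spr u v).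
Proof.
move=> H K; have [D [G H1 H2]] := cmp2 H K; apply: (good_add G).
by do 5!right; left; exists f, g; split=> //; exists u, v.
Qed.
Lemma cmp_comp f g x u y : cmp g x u -> cmp f u y -> cmp (spr 6%:R (spr f g)) x y.
Proof.
move=> H K; have [D [G H1 H2]] := cmp2 H K; apply: (good_add G).
by do 6!right; left; exists f, g; split=> //; exists u.
Qed.
Lemma cmp_rec0 f g a y : cmp f a y -> cmp (spr 7%:R (spr f g)) (spr a 0) y.
Proof.
move=> [D [H G]]; apply: (good_add G).
by do 7!right; left; exists f, g; split=> //; exists a; left.
Qed.
Lemma cmp_recS f g a n u y : cmp (spr 7%:R (spr f g)) (spr a n) u ->
  cmp g (spr a (spr n u)) y -> cmp (spr 7%:R (spr f g)) (spr a (n + 1)) y.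
Proof.
move=> H K; have [D [G H1 H2]] := cmp2 H K; apply: (good_add G).
by do 7!right; left; exists f, g; split=> //; exists a; right; exists n, u.
Qed.

(** A bounded number of computations is merged into one by Sigma_1 induction on [k]. The guard
    [n ≺ r 2%N] is there because the induction runs through all numbers while computations are given
    only below [y]. *)
Lemma cmp_collect f x y : (forall n, n ≺ y -> exists u, 0 ≺ u /\ cmp f (spr x n) u) ->
  exists D, good D /\ forall n, n ≺ y -> exists u, smem (strip f (spr x n) u) D /\ 0 ≺ u.
Proof.
move=> H.
pose P (D k : N) (r : nat -> N) (h : nat -> Om) := bgood (h 0%N) D /\
  forall n, n ≺ k -> n ≺ r 2%N -> exists u, u ≺ D /\ (smem (strip (r 0%N) (spr (r 1%N) n) u) D /\ 0 ≺ u).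
have D0P : D0 (fun r h => P (r 0%N) (r 1%N) (fun k => r (S (S k))) h) by rewrite /P; d0.
have [||D [G HD]] := sigma_ind D0P (r := env [:: f; x; y]) (h := senv [:: Z]) _ _ y.
- by exists 0; split=> [|n L]; [apply/bgoodE; apply: good0|nlra].
- move=> k [D]; rewrite /P /env /senv /= => -[/bgoodE G HD].
  have [Lk|Lk] := pselect (k ≺ y); last first.
    exists D; split=> [|n L Ly]; first exact/bgoodE.
    by apply: HD => //; nlra.
  have [u [Hu [D' [Hm G']]]] := H _ Lk.
  have [D2 [G2 S S']] := good_union G G'.
  have B e' x' y' : smem (strip e' x' y') D2 -> y' ≺ D2.
    by move=> /smem_lt; have [_ _] := strip_le e' x' y'; move: (strip _ _ _) => s; clear; move=> *; nlra.
  exists D2; split=> [|n L Ly]; first exact/bgoodE.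
  have [E|E] := pselect (n = k).
    exists u; rewrite E; split; last by split=> //; apply: S'.
    by apply: B; apply: S' Hm.
  have [||v [_ [Hv Hv0]]] := HD n; [by case: (ltN_cmp n k) => // ?; nlra|by []|].
  by exists v; split; [apply: B; apply: S Hv|split=> //; apply: S].
exists D; split; first by apply/bgoodE; apply: G.
by move=> n L; have [u [_ Hu]] := HD n L L; exists u.
Qed.

Lemma cmp_min f x y : cmp f (spr x y) 0 ->
  (forall n, n ≺ y -> exists u, 0 ≺ u /\ cmp f (spr x n) u) -> cmp (spr 8%:R f) x y.
Proof.
move=> [D [H G]] /cmp_collect[D' [G' H']].
have [D2 [G2 S S']] := good_union G G'; apply: (good_add G2).
do 8!right; exists f; split=> //; split=> [|n /H'[u [Hu1 Hu2]]]; first exact: S.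
by exists u; split=> //; apply: S'.
Qed.

Lemma spr_tag i j x y : spr (i%:R : N) x = spr j%:R y -> i = j /\ x = y.
Proof.
move=> /spr_inj[E ->]; split=> //; apply/eqP.
by rewrite -(eqr_nat (ratio M)) -!iota_nat E.
Qed.

(** Subindices are smaller numbers, which permits induction on the index inside the model. *)
Lemma tag_lt k x : x ≺ spr k.+1%:R x.
Proof.
have H : (0 : N) ≺ k.+1%:R by apply/ltNK'; rewrite iota_nat iota0 ltr0n.
by rewrite /spr; move: (k.+1%:R) H => c H; nnra.
Qed.
Lemma leN_ltN_trans x y z : x ⪯ y -> y ≺ z -> x ≺ z.
Proof. by move=> *; nlra. Qed.

Lemma rec_inv D e f g a n y : e = spr 7%:R (spr f g) -> sjustified Z D e (spr a n) y ->
  (n = 0 /\ smem (strip f a y) D) \/ exists m u, n = m + 1 /\ smem (strip e (spr a m) u) D /\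
    smem (strip g (spr a (spr m u)) y) D.
Proof.
move=> E'' J; case: J => [[E' J']|[[E' J']|[[E' J']|[[E' J']|[[E' J']|[[f' [g' [E' J']]]|[[f' [g' [E' J']]]|[[f' [g' [E' J']]]|[f' [E' J']]]]]]]]]];
  have [] := spr_tag (etrans (esym E'') E') => //= _ Es.
case/spr_inj: Es => Ef Eg; subst f' g'.
case: J' => a' [[/spr_inj[<- ->]]|[m [u [/spr_inj[<- ->] H]]]]; first by left.
by right; exists m, u.
Qed.

(** Induction on the index: a justification refers to smaller indices, except in primitive
    recursion, which needs an inner induction. All numbers involved lie below D + D', and with this
    bound the induction statement is Delta_0. For minimisation, the smaller of two distinct values
    would be given both 0 and a positive number. *)
Lemma good_unique D D' : good D -> good D' -> forall e x y y',
  smem (strip e x y) D -> smem (strip e x y') D' -> y = y'.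
Proof.
move=> G G'.
pose s := D + D'.
pose Q e := forall x, x ≺ s -> forall y, y ≺ s -> forall y', y' ≺ s ->
  smem (strip e x y) D -> smem (strip e x y') D' -> y = y'.
have B e x y y' : smem (strip e x y) D -> smem (strip e x y') D' -> [/\ x ≺ s, y ≺ s & y' ≺ s].
  rewrite /s => /smem_lt + /smem_lt; have [_] := strip_le e x y; have [_ _] := strip_le e x y'.
  by move: (strip _ _ _) (strip _ _ _) => s1 s2; clear; move=> *; split; nlra.
have QE e : Q e <-> forall x y y', smem (strip e x y) D -> smem (strip e x y') D' -> y = y'.
  split=> H; last by move=> x _ y _ y' _; apply: H.
  by move=> x y y' H1 H2; have [? ? ?] := B _ _ _ _ H1 H2; apply: (H x).
suff R : forall k e, e ≺ k -> Q e by move=> e; apply/QE; apply: (R (e + 1)); nlra.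
pose P k (r : nat -> N) (h : nat -> Om) := forall e, e ≺ k ->
  forall x, x ≺ r 0%N -> forall y, y ≺ r 0%N -> forall y', y' ≺ r 0%N ->
  smem (strip e x y) (r 1%N) -> smem (strip e x y') (r 2%N) -> y = y'.
have D0P : D0 (fun r h => P (r 0%N) (fun k => r (S k)) h) by rewrite /P; d0.
apply: (D0_ind D0P (r := env [:: s; D; D']) (h := senv [::])); rewrite /P /env /=.
  by move=> e L; nlra.
move=> e0 IH e Le.
have [/IH //|L] := pselect (e ≺ e0).
have IH' : forall f, f ≺ e -> forall x y y', smem (strip f x y) D -> smem (strip f x y') D' -> y = y'.
  by move=> f Lf; apply/QE; apply: IH; nlra.
move: IH' => {e0 Le L} {}IH.
have T1 k f : e = spr k.+1%:R f -> f ≺ e by move=> ->; apply: tag_lt.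
have T k f g : e = spr k.+1%:R (spr f g) -> f ≺ e /\ g ≺ e.
  by move=> /T1 L; split; apply: leN_ltN_trans L; [apply: spr_lel|apply: spr_ler].
apply/QE => x y y' H H'.
have J := G _ _ _ H; have J' := G' _ _ _ H'.
case: J => [[E J]|[[E J]|[[E J]|[[E J]|[[E J]|[[f [g [E J]]]|[[f [g [E J]]]|[[f [g [E J]]]|[f [E J]]]]]]]]]];
  case: J' => [[E' J']|[[E' J']|[[E' J']|[[E' J']|[[E' J']|[[f' [g' [E' J']]]|[[f' [g' [E' J']]]|[[f' [g' [E' J']]]|[f' [E' J']]]]]]]]]];
  have [] := spr_tag (etrans (esym E) E') => //= _ Es.
- by rewrite J J'.
- by rewrite J J'.
- by case: J J' => b -> [b' /spr_inj[]].
- by case: J J' => b -> [b' /spr_inj[]].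
- by case: J => [[Hx ->]|[Hx ->]]; case: J' => [[Hx' ->]|[Hx' ->]].
- have [Lf Lg] := T _ _ _ E; case/spr_inj: Es => Ef Eg; subst f' g'.
  case: J => u [v [-> [H1 H2]]]; case: J' => u' [v' [-> [H1' H2']]].
  by rewrite (IH _ Lf _ _ _ H1 H1') (IH _ Lg _ _ _ H2 H2').
- have [Lf Lg] := T _ _ _ E; case/spr_inj: Es => Ef Eg; subst f' g'.
  case: J => u [H1 H2]; case: J' => u' [H1' H2'].
  by rewrite (IH _ Lg _ _ _ H1 H1') in H2; apply: IH Lf _ _ _ H2 H2'.
- have [Lf Lg] := T _ _ _ E.
  (* Inner induction on the recursion argument, since primitive recursion calls its own index
     [e]. *)
  pose R k (r : nat -> N) (h : nat -> Om) := forall a, a ≺ r 0%N ->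
    forall y, y ≺ r 0%N -> forall y', y' ≺ r 0%N -> smem (strip (r 3%N) (spr a k) y) (r 1%N) ->
    smem (strip (r 3%N) (spr a k) y') (r 2%N) -> y = y'.
  have D0R : D0 (fun r h => R (r 0%N) (fun k => r (S k)) h) by rewrite /R; d0.
  have RE k : R k (env [:: s; D; D'; e]) (senv [::]) <->
      forall a y y', smem (strip e (spr a k) y) D -> smem (strip e (spr a k) y') D' -> y = y'.
    split=> K; last by move=> a _ y1 _ y2 _; apply: K.
    move=> a y1 y2 H1 H2; have [L1 L2 L3] := B _ _ _ _ H1 H2.
    by apply: (K a _ _ _ _ _ H1 H2) => //; apply: leN_ltN_trans L1; apply: spr_lel.
  have {RE} RT n : forall a y y', smem (strip e (spr a n) y) D -> smem (strip e (spr a n) y') D' -> y = y'.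
    apply/RE; apply: (D0_ind D0R) n => [|n /RE IHn]; apply/RE => a y1 y2 H1 H2.
    + case: (rec_inv E (G _ _ _ H1)) => [[_ K1]|[m [u [Em _]]]]; last by nlra.
      case: (rec_inv E (G' _ _ _ H2)) => [[_ K2]|[m [u [Em _]]]]; last by nlra.
      exact: IH Lf _ _ _ K1 K2.
    + case: (rec_inv E (G _ _ _ H1)) => [[En _]|[m [u [Em [K1 K2]]]]]; first by nlra.
      case: (rec_inv E (G' _ _ _ H2)) => [[En _]|[m' [u' [Em' [K1' K2']]]]]; first by nlra.
      have Enm := addNI Em; have Enm' := addNI Em'; subst m m'.
      rewrite (IHn _ _ _ K1 K1') in K2; exact: IH Lg _ _ _ K2 K2'.
  by case: J => a [[Hx _]|[n [u [Hx _]]]]; move: (H) (H'); rewrite Hx; apply: RT.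
- have Lf := T1 _ _ E; subst f'; case: J => [J0 JS]; case: J' => [J0' JS'].
  case: (ltN_cmp y y') => // L.
  + by case: (JS' _ L) => u [Hu Lu]; have := IH _ Lf _ _ _ J0 Hu => Eu; move: Lu; rewrite -Eu => /ltNn.
  + by case: (JS _ L) => u [Hu Lu]; have := IH _ Lf _ _ _ Hu J0' => Eu; move: Lu; rewrite Eu => /ltNn.
Qed.
End Closure.

Definition ite {T : Type} (P : Prop) (a b : T) : T := if pselect P then a else b.
Lemma iteT T (P : Prop) (a b : T) : P -> ite P a b = a.
Proof. by rewrite /ite; case: pselect. Qed.
Lemma iteF T (P : Prop) (a b : T) : ~ P -> ite P a b = b.
Proof. by rewrite /ite; case: pselect. Qed.

(** * Computable functions, predicates and rationals *)

Section Arithmetic.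
Variable M : model.
Local Notation N := (carrier M).
Implicit Types x y z n s : N.

Lemma nsub_ex x n : exists y, (y + n = x) \/ (x ≺ n /\ y = 0).
Proof.
case: (leN_total n x) => [/leN_subE[z E]|[L|->]]; first by exists z; left; rewrite addrC.
- by exists 0; right.
- by exists 0; left; rewrite add0r.
Qed.
Definition nsub x n : N := projT1 (cid (nsub_ex x n)).
Lemma nsubP x n : (nsub x n + n = x) \/ (x ≺ n /\ nsub x n = 0).
Proof. by rewrite /nsub; case: cid. Qed.
Lemma nsubE x y n : (y + n = x) \/ (x ≺ n /\ y = 0) -> nsub x n = y.
Proof.
case: (nsubP x n) => [E|[L ->]]; case=> [E'|[L' E']]; first by apply: (addNI (z := n)); rewrite E E'.
- by exfalso; nlra.
- by exfalso; nlra.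
- by [].
Qed.
Lemma nsubK x n : n ⪯ x -> iota (nsub x n) = iota x - iota n.
Proof. by case: (nsubP x n) => [E|[L E]] H; nlra. Qed.
Lemma nsub0 x n : nsub x n = 0 <-> x ⪯ n.
Proof.
case: (nsubP x n) => [E|[L ->]]; last by split=> // _; left.
split=> [H|H]; first by rewrite -E H add0r; right.
by rewrite -[X in X ⪯ _]E in H; nlra.
Qed.

Lemma nsqrt_ex x : exists s, s * s ⪯ x /\ x ≺ (s + 1) * (s + 1).
Proof.
pose P s (x : N) (r : nat -> N) (h : nat -> set_of M) := s * s ⪯ x /\ x ≺ (s + 1) * (s + 1).
have D : D0 (fun r h => P (r 0%N) (r 1%N) (fun k => r (S (S k))) h) by rewrite /P; d0.
apply: (sigma_ind D (r := env [::]) (h := senv [::])) x.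
- by exists 0; split; nlra.
- move=> n [s [H1 H2]]; case: (leN_total ((s + 1) * (s + 1)) (n + 1)) => H.
  + by exists (s + 1); split=> //; nlra.
  + case: H => [H|H]; first by exists s; split=> //; nlra.
    by exists (s + 1); split; [right|nlra].
Qed.
Definition nsqrt x : N := projT1 (cid (nsqrt_ex x)).
Lemma nsqrtP x : nsqrt x * nsqrt x ⪯ x /\ x ≺ (nsqrt x + 1) * (nsqrt x + 1).
Proof. by rewrite /nsqrt; case: cid. Qed.
Lemma sqr_le x y : x * x ≺ (y + 1) * (y + 1) -> x ⪯ y.
Proof.
move=> H; apply/leN_ltN => L.
have : 0 <= (iota x - (iota y + 1)) * (iota x + iota y + 1).
  by apply: mulr_ge0; nlra.
by nlra.
Qed.
Lemma nsqrtE x s : s * s ⪯ x -> x ≺ (s + 1) * (s + 1) -> nsqrt x = s.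
Proof.
have [H1 H2] := nsqrtP x => H3 H4.
by apply: leN_anti; apply: sqr_le; nlra.
Qed.

(** The integer square root of a pair is the sum of its components, and the remainder is the first
    component. *)
Definition p1 x : N := nsub x (nsqrt x * nsqrt x).
Definition p2 x : N := nsub (nsqrt x) (p1 x).
Lemma nsqrt_spr x y : nsqrt (spr x y) = x + y.
Proof. by apply: nsqrtE; rewrite /spr; nlra. Qed.
Lemma p1E x y : p1 (spr x y) = x.
Proof. by rewrite /p1 nsqrt_spr; apply: nsubE; left; rewrite /spr addrC. Qed.
Lemma p2E x y : p2 (spr x y) = y.
Proof. by rewrite /p2 nsqrt_spr p1E; apply: nsubE; left; rewrite addrC. Qed.
End Arithmetic.

(** * Indices for arithmetic from the basic functions *)

Section Bootstrap.
Variables (M : model) (Z : set_of M).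
Local Notation N := (carrier M).
Local Notation cmp := (scomputes Z).
Implicit Types x y z n a e f g : N.

Definition Comp (F : N -> N) := exists e, forall x, cmp e x (F x).
Definition CompP (F : N -> N -> N) := exists e, forall x y, cmp e (spr x y) (F x y).

(** That a computation with a value satisfying [Q] exists is a Sigma_1 statement, so totality of a
    recursion and an invariant of its values are proved together by Sigma_1 induction. *)
Lemma cmp_ind (Q : N -> N -> N -> Prop) : D0 (fun r (_ : nat -> set_of M) => Q (r 0%N) (r 1%N) (r 2%N)) ->
  forall e a c, (exists y, Q y 0 c /\ cmp e (spr a 0) y) ->
  (forall n y, Q y n c -> cmp e (spr a n) y -> exists y', Q y' (n + 1) c /\ cmp e (spr a (n + 1)) y') ->
  forall n, exists y, Q y n c /\ cmp e (spr a n) y.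
Proof.
move=> HQ e a c H0 HS.
have D3 i j k : D0 (fun r (_ : nat -> set_of M) => Q (r i) (r j) (r k)).
  exact: (D0_ren (nth 0%N [:: i; j; k]) HQ).
pose P w n (r : nat -> N) h := bgood (h 0%N) w /\
  exists y, y ≺ w /\ (Q y n (r 2%N) /\ smem (strip (r 0%N) (spr (r 1%N) n) y) w).
have D : D0 (fun r h => P (r 0%N) (r 1%N) (fun k => r (S (S k))) h).
  by rewrite /P; d0; apply: D3.
have PE n : (exists w, P w n (env [:: e; a; c]) (senv [:: Z])) <-> exists y, Q y n c /\ cmp e (spr a n) y.
  split=> [[w [/bgoodE G [y [_ [Hq Hm]]]]]|[y [Hq [w [Hm G]]]]]; first by exists y; split=> //; exists w.
  exists w; split; first exact/bgoodE.
  exists y; split=> //.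
  have [_ _] := strip_le e (spr a n) y => L; exact: leN_ltN_trans L (smem_lt Hm).
move=> n; apply/PE; apply: (sigma_ind D) n; first by apply/PE.
by move=> n /PE [y [Hq Hc]]; apply/PE; apply: HS Hq Hc.
Qed.

Lemma CompP_fst : CompP (fun x y => x). Proof. by exists (spr 2%:R 0); apply: cmp_fst. Qed.
Lemma CompP_snd : CompP (fun x y => y). Proof. by exists (spr 3%:R 0); apply: cmp_snd. Qed.
Lemma Comp_zero : Comp (fun _ => 0). Proof. by exists (spr 0%:R 0); apply: cmp_zero. Qed.
Lemma Comp_succ : Comp (fun x => x + 1). Proof. by exists (spr 1%:R 0); apply: cmp_succ. Qed.
Lemma CompP_comp1 F (G : N -> N -> N) : Comp F -> CompP G -> CompP (fun x y => F (G x y)).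
Proof. by move=> [e H] [d K]; exists (spr 6%:R (spr e d)) => x y; apply: cmp_comp. Qed.
Lemma Comp_comp F G : Comp F -> Comp G -> Comp (fun x => F (G x)).
Proof. by move=> [e H] [d K]; exists (spr 6%:R (spr e d)) => x; apply: cmp_comp. Qed.
Lemma CompP_spr (F G : N -> N -> N) : CompP F -> CompP G -> CompP (fun x y => spr (F x y) (G x y)).
Proof. by move=> [e H] [d K]; exists (spr 5%:R (spr e d)) => x y; apply: cmp_pair. Qed.
Lemma Comp_spr (F G : N -> N) : Comp F -> Comp G -> Comp (fun x => spr (F x) (G x)).
Proof. by move=> [e H] [d K]; exists (spr 5%:R (spr e d)) => x; apply: cmp_pair. Qed.
Lemma CompP_comp2 H (F G : N -> N -> N) : CompP H -> CompP F -> CompP G -> CompP (fun x y => H (F x y) (G x y)).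
Proof.
move=> [e He] HF HG; have [d Hd] := CompP_spr HF HG.
by exists (spr 6%:R (spr e d)) => x y; apply: cmp_comp.
Qed.
Lemma Comp_comp2 H (F G : N -> N) : CompP H -> Comp F -> Comp G -> Comp (fun x => H (F x) (G x)).
Proof.
move=> [e He] HF HG; have [d Hd] := Comp_spr HF HG.
by exists (spr 6%:R (spr e d)) => x; apply: cmp_comp.
Qed.

Lemma nsubS x n : nsub x (n + 1) = nsub (nsub x n) 1.
Proof.
apply: nsubE; case: (nsubP x n) => [E|[L ->]]; case: (nsubP (nsub x n) 1) => [E'|[L' E']].
- by left; nlra.
- by right; split=> //; nlra.
- by right; split; [nlra|apply/nsub0; left; exact: ltN01].
- by right; split; [nlra|apply/nsub0; left; exact: ltN01].
Qed.
Lemma nsub_0 x : nsub x 0 = x. Proof. by apply: nsubE; left; rewrite addr0. Qed.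
Lemma nsubSK n : nsub (n + 1) 1 = n. Proof. by apply: nsubE; left. Qed.

Lemma Comp_pred : Comp (fun x => nsub x 1).
Proof.
have [g Hg] : exists g, forall a n u, cmp g (spr a (spr n u)) n.
  exists (spr 6%:R (spr (spr 2%:R 0) (spr 3%:R 0))) => a n u.
  by apply: cmp_comp; [apply: cmp_snd|apply: cmp_fst].
pose e := spr 7%:R (spr (spr 0%:R 0) g).
have D : D0 (fun r (_ : nat -> set_of M) => (r 0%N + 1 = r 1%N \/ (r 1%N = 0 /\ r 0%N = 0))).
  by d0.
have He a n : cmp e (spr a n) (nsub n 1).
  have [||y [Hy Hc]] := cmp_ind (Q := fun y n _ => y + 1 = n \/ (n = 0 /\ y = 0)) D (e := e) (a := a) (c := 0) _ _ n.
  - by exists 0; split; [right|apply: cmp_rec0; apply: cmp_zero].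
  - move=> m y _ Hc; exists m; split; first by left.
    exact: cmp_recS Hc _.
  suff -> : nsub n 1 = y by [].
  by apply: nsubE; case: Hy => [|[-> ->]]; [left|right; split=> //; exact: ltN01].
(* The recursion needs the pair (0, x), but the basic functions contain no identity; the inner part
   recovers x as the predecessor of x + 1. *)
exists (spr 6%:R (spr e (spr 5%:R (spr (spr 0%:R 0) (spr 6%:R (spr e (spr 5%:R (spr (spr 0%:R 0) (spr 1%:R 0))))))))) => x.
apply: cmp_comp (He 0 x); apply: cmp_pair; first exact: cmp_zero.
rewrite -[X in cmp _ _ X](nsubSK x); apply: cmp_comp (He 0 (x + 1)).
by apply: cmp_pair; [apply: cmp_zero|apply: cmp_succ].
Qed.

(** The parameter is a pair of [x] and a dummy, so that the first projection can serve as base of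
    the recursion; no index for the identity has been given yet. *)
Lemma cmp_nsub : exists e, forall x z n, cmp e (spr (spr x z) n) (nsub x n).
Proof.
have [p Hp] := Comp_pred.
have [g Hg] : exists g, forall a n u, cmp g (spr a (spr n u)) (nsub u 1).
  exists (spr 6%:R (spr p (spr 6%:R (spr (spr 3%:R 0) (spr 3%:R 0))))) => a n u.
  by apply: cmp_comp (Hp u); apply: cmp_comp; [apply: cmp_snd|apply: cmp_snd].
exists (spr 7%:R (spr (spr 2%:R 0) g)) => x z n.
have D : D0 (fun r (_ : nat -> set_of M) => (r 0%N + r 1%N = r 2%N \/ (r 2%N ≺ r 1%N /\ r 0%N = 0))).
  by d0.
have [||y [Hy Hc]] := cmp_ind (Q := fun y n x => y + n = x \/ (x ≺ n /\ y = 0)) D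
    (e := spr 7%:R (spr (spr 2%:R 0) g)) (a := spr x z) (c := x) _ _ n.
- exists x; split; first by left; rewrite addr0.
  by apply: cmp_rec0; apply: cmp_fst.
- move=> m y Hy Hc; exists (nsub y 1); split; last exact: cmp_recS Hc _.
  by rewrite -(nsubE Hy) -nsubS; apply: nsubP.
by rewrite (nsubE Hy).
Qed.

(** The projections converge only on pairs, so the identity is found by search: x is the least n
    with truncated difference x - n equal to 0. *)
Lemma Comp_id : Comp id.
Proof.
have [e He] := cmp_nsub.
have [d Hd] : CompP (fun x n => spr (spr x n) n).
  by apply: CompP_spr; [apply: CompP_spr; [exact: CompP_fst|exact: CompP_snd]|exact: CompP_snd].
exists (spr 8%:R (spr 6%:R (spr e d))) => x; apply: cmp_min.
- rewrite -[X in cmp _ _ X](proj2 (nsub0 x x)); last by right.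
  exact: cmp_comp (Hd _ _) (He _ _ _).
- move=> n L; exists (nsub x n); split; last exact: cmp_comp (Hd _ _) (He _ _ _).
  by case: (leN0 (nsub x n)) => // E; move/nsub0: (esym E) => K; nlra.
Qed.

Lemma CompP_nsub : CompP (@nsub M).
Proof.
have [e He] := cmp_nsub; have [d Hd] : CompP (fun x n => spr (spr x n) n).
  by apply: CompP_spr; [apply: CompP_spr; [exact: CompP_fst|exact: CompP_snd]|exact: CompP_snd].
by exists (spr 6%:R (spr e d)) => x y; apply: cmp_comp (Hd _ _) (He _ _ _).
Qed.

Lemma CompP_add : CompP (fun x y => x + y).
Proof.
have [i Hi] := Comp_id; have [g Hg] : exists g, forall a n u, cmp g (spr a (spr n u)) (u + 1).
  exists (spr 6%:R (spr (spr 1%:R 0) (spr 6%:R (spr (spr 3%:R 0) (spr 3%:R 0))))) => a n u.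
  by apply: cmp_comp (cmp_succ Z u); apply: cmp_comp; [apply: cmp_snd|apply: cmp_snd].
exists (spr 7%:R (spr i g)) => x n.
have D : D0 (fun r (_ : nat -> set_of M) => r 0%N = r 2%N + r 1%N) by d0.
have [||y [-> Hc //]] := cmp_ind (Q := fun y n x => y = x + n) D (e := spr 7%:R (spr i g)) (a := x) (c := x) _ _ n.
- by exists x; rewrite addr0; split=> //; apply: cmp_rec0.
- by move=> m y -> Hc; exists (x + m + 1); rewrite addrA; split=> //; apply: cmp_recS Hc _.
Qed.

Lemma CompP_mul : CompP (fun x y => x * y).
Proof.
have [s Hs] := CompP_add; have [g Hg] : exists g, forall a n u, cmp g (spr a (spr n u)) (u + a).
  exists (spr 6%:R (spr s (spr 5%:R (spr (spr 6%:R (spr (spr 3%:R 0) (spr 3%:R 0))) (spr 2%:R 0))))) => a n u.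
  apply: cmp_comp (Hs u a); apply: cmp_pair; last exact: cmp_fst.
  by apply: cmp_comp; [apply: cmp_snd|apply: cmp_snd].
exists (spr 7%:R (spr (spr 0%:R 0) g)) => x n.
have D : D0 (fun r (_ : nat -> set_of M) => r 0%N = r 2%N * r 1%N) by d0.
have [||y [-> Hc //]] := cmp_ind (Q := fun y n x => y = x * n) D (e := spr 7%:R (spr (spr 0%:R 0) g)) (a := x) (c := x) _ _ n.
- by exists 0; rewrite mulr0; split=> //; apply: cmp_rec0; apply: cmp_zero.
- by move=> m y -> Hc; exists (x * m + x); rewrite mulrDr mulr1; split=> //; apply: cmp_recS Hc _.
Qed.

(** The root is the least s for which x + 1 - (s + 1)^2 truncates to 0. With it the decoding of
    pairs becomes computable at every number, whereas the basic projections converge only on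
    pairs. *)
Lemma Comp_nsqrt : Comp (@nsqrt M).
Proof.
have H1 (F : N -> N -> N) : CompP F -> CompP (fun x y => F x y + 1) by move=> HF; exact: (CompP_comp1 Comp_succ HF).
have HS := H1 _ CompP_snd.
have [e He] := CompP_comp2 CompP_nsub (H1 _ CompP_fst) (CompP_comp2 CompP_mul HS HS).
exists (spr 8%:R e) => x; have [L1 L2] := nsqrtP x; apply: cmp_min.
- rewrite -[X in cmp _ _ X](proj2 (nsub0 (x + 1) ((nsqrt x + 1) * (nsqrt x + 1)))) //.
  by move: (nsqrt x) L2 => s L2; nlra.
- move=> n L; exists (nsub (x + 1) ((n + 1) * (n + 1))); split=> //.
  case: (leN0 (nsub (x + 1) ((n + 1) * (n + 1)))) => // E; move/nsub0: (esym E) => K.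
  have : nsqrt x ⪯ n by apply: sqr_le; move: (nsqrt x) L1 {L L2} => s L1; nlra.
  by move=> ?; nlra.
Qed.
End Bootstrap.

(** * Computable functions, decidable predicates and search *)

Section Computable.
Variables (M : model) (Z : set_of M).
Local Notation N := (carrier M).
Local Notation cmp := (scomputes Z).
Local Notation Comp := (Comp Z).
Implicit Types (x y z n a e k : N) (f g h : N -> N) (P Q : N -> Prop).

Lemma cmp_unique e x y y' : cmp e x y -> cmp e x y' -> y = y'.
Proof. by move=> [D [H G]] [D' [H' G']]; exact: good_unique G G' _ _ _ _ H H'. Qed.

Lemma Comp_ext f g : (forall x, f x = g x) -> Comp f -> Comp g.
Proof. by move=> E; rewrite (_ : f = g) //; apply: funext. Qed.

Definition Comp2 (h : N -> N -> N) := Comp (fun z => h (p1 z) (p2 z)).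

Lemma Comp_add f g : Comp f -> Comp g -> Comp (fun x => f x + g x).
Proof. exact: Comp_comp2 (CompP_add Z). Qed.
Lemma Comp_mul f g : Comp f -> Comp g -> Comp (fun x => f x * g x).
Proof. exact: Comp_comp2 (CompP_mul Z). Qed.
Lemma Comp_sub f g : Comp f -> Comp g -> Comp (fun x => nsub (f x) (g x)).
Proof. exact: Comp_comp2 (CompP_nsub Z). Qed.
Lemma Comp_p1 f : Comp f -> Comp (fun x => p1 (f x)).
Proof.
move=> Hf; have Hs := Comp_comp (Comp_nsqrt Z) Hf.
by apply: Comp_sub => //; apply: Comp_mul.
Qed.
Lemma Comp_p2 f : Comp f -> Comp (fun x => p2 (f x)).
Proof.
move=> Hf; have Hs := Comp_comp (Comp_nsqrt Z) Hf.
by apply: Comp_sub => //; apply: Comp_p1.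
Qed.
Lemma Comp2_app (h : N -> N -> N) f g : Comp2 h -> Comp f -> Comp g -> Comp (fun x => h (f x) (g x)).
Proof.
move=> Hh Hf Hg; apply: Comp_ext (Comp_comp Hh (Comp_spr Hf Hg)) => x.
by rewrite p1E p2E.
Qed.
Lemma CompP_Comp2 (h : N -> N -> N) : CompP Z h -> Comp2 h.
Proof.
by move=> H; apply: (Comp_comp2 H); [apply: Comp_p1|apply: Comp_p2]; exact: Comp_id.
Qed.

Lemma Comp_rec f g : Comp f -> Comp g -> exists h : N -> N -> N, [/\ Comp2 h,
  forall a, h a 0 = f a & forall a n, h a (n + 1) = g (spr a (spr n (h a n)))].
Proof.
move=> [d Hd] [e He]; pose r := spr 7%:R (spr d e).
have T a n : exists y, cmp r (spr a n) y.
  have D : D0 (fun r (_ : nat -> set_of M) => r 0%N = r 0%N) by d0.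
  have [||y [_ Hy]] := @cmp_ind _ Z (fun y _ _ => y = y) D r a 0 _ _ n; last by exists y.
  - by exists (f a); split=> //; apply: cmp_rec0.
  - by move=> m y _ Hy; exists (g (spr a (spr m y))); split=> //; apply: cmp_recS Hy _.
pose h a n := projT1 (cid (T a n)).
have Hh a n : cmp r (spr a n) (h a n) by rewrite /h; case: cid.
exists h; split.
- by apply: CompP_Comp2; exists r.
- by move=> a; apply: cmp_unique (Hh a 0) _; apply: cmp_rec0.
- by move=> a n; apply: cmp_unique (Hh a (n + 1)) _; apply: cmp_recS (Hh a n) _.
Qed.

Lemma Comp_natr (k : nat) : Comp (fun _ => k%:R).
Proof.
elim: k => [|k IH]; first exact: Comp_zero.
by apply: Comp_ext (Comp_comp (Comp_succ Z) IH) => x; rewrite -natr1.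
Qed.

(** [c] may be nonstandard, so its index cannot be assembled by recursion outside the model. A
    recursion inside computes an index [h 0 n] for each constant n by composing with the successor,
    and Sigma_1 induction shows that it is correct. *)
Lemma Comp_const c : Comp (fun _ => c).
Proof.
have HS : Comp (fun z => spr 6%:R (spr (spr 1%:R 0) (p2 (p2 z)))).
  apply: Comp_spr; first exact: Comp_natr.
  apply: Comp_spr; last by do 2!apply: Comp_p2; exact: Comp_id.
  by apply: Comp_spr; [exact: Comp_natr|exact: Comp_zero].
have H0 : Comp (fun _ => spr 0%:R 0).
  by apply: Comp_spr; [exact: Comp_natr|exact: Comp_zero].
have [h [[e He] h0 hS]] := Comp_rec H0 HS.
exists (h 0 c) => x.
pose P w n (r : nat -> N) hs := bgood (M := M) (hs 0%N) w /\ exists v, v ≺ w /\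
  (smem (strip (r 0%N) (spr 0 n) v) w /\ smem (strip v (r 1%N) n) w).
have D : D0 (fun r s => P (r 0%N) (r 1%N) (fun i => r i.+2) s) by rewrite /P; d0.
have He' n : cmp e (spr 0 n) (h 0 n) by have := He (spr 0 n); rewrite p1E p2E.
have PE n : (exists w, P w n (env [:: e; x]) (senv [:: Z])) <-> cmp (h 0 n) x n.
  split=> [[w [/bgoodE G [v [_ [H1 H2]]]]]|H].
    by rewrite (@cmp_unique e (spr 0 n) (h 0 n) v) //; exists w.
  have [w [G H1 H2]] := cmp2 (He' n) H.
  exists w; split; first exact/bgoodE.
  exists (h 0 n); split=> //.
  have [_ _] := strip_le e (spr 0 n) (h 0 n) => L; exact: leN_ltN_trans L (smem_lt H1).
apply/PE; apply: (sigma_ind D) c; first by apply/PE; rewrite h0; apply: cmp_zero.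
move=> n /PE H; apply/PE; rewrite hS !p2E; apply: cmp_comp H _; exact: cmp_succ.
Qed.

Definition chi P x : N := ite (P x) 1 0.
Definition CP P := Comp (chi P).
Definition CP2 (P : N -> N -> Prop) := CP (fun z => P (p1 z) (p2 z)).

Lemma CP_ext P Q : (forall x, P x <-> Q x) -> CP P -> CP Q.
Proof. by move=> E; rewrite (_ : P = Q) //; apply: funext => x; apply: propext. Qed.
Lemma CP_zero f P : Comp f -> (forall x, P x <-> f x = 0) -> CP P.
Proof.
move=> Hf E; apply: (Comp_ext (f := fun x => nsub 1 (f x))); last first.
  by apply: Comp_sub => //; apply: Comp_const.
move=> x; rewrite /chi; have [H|H] := pselect (P x).
- by rewrite iteT // (proj1 (E x)) // nsub_0.
- rewrite iteF //; apply/nsub0; case: (leN0 (f x)) => [/ltN_ge1 //|E0].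
  by case: H; apply/E.
Qed.
Lemma chi0 P x : nsub 1 (chi P x) = 0 <-> P x.
Proof.
rewrite /chi; have [H|H] := pselect (P x); [rewrite iteT //|rewrite iteF //].
- by split=> // _; apply/nsub0; right.
- by rewrite nsub_0; split=> // E; have := @ltN01 M; rewrite E => /ltNn.
Qed.
Lemma chi0' P x : chi P x = 0 <-> ~ P x.
Proof.
rewrite /chi; have [H|H] := pselect (P x); [rewrite iteT //|rewrite iteF //].
by split=> // E; have := @ltN01 M; rewrite -E => /ltNn.
Qed.
Lemma Comp_chi P : CP P -> Comp (fun x => nsub 1 (chi P x)).
Proof. by move=> H; apply: Comp_sub => //; apply: Comp_const. Qed.

Lemma CP_le f g : Comp f -> Comp g -> CP (fun x => f x ⪯ g x).
Proof. by move=> Hf Hg; apply: (CP_zero (Comp_sub Hf Hg)) => x; rewrite nsub0. Qed.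
Lemma CP_lt f g : Comp f -> Comp g -> CP (fun x => f x ≺ g x).
Proof.
move=> Hf Hg; apply: (CP_ext (P := fun x => f x + 1 ⪯ g x)) => [x|]; first by rewrite ltN_S.
by apply: CP_le => //; apply: Comp_add => //; apply: Comp_const.
Qed.
Lemma addN_eq0 x y : x + y = 0 <-> x = 0 /\ y = 0.
Proof.
split=> [E|[-> ->]]; last by rewrite addr0.
by split; apply: leN_anti; try exact: leN0; rewrite -E; [|rewrite addrC]; apply: leN_addr.
Qed.
Lemma CP_and P Q : CP P -> CP Q -> CP (fun x => P x /\ Q x).
Proof.
move=> HP HQ; apply: (CP_zero (Comp_add (Comp_chi HP) (Comp_chi HQ))) => x.
by rewrite addN_eq0 !chi0.
Qed.
Lemma CP_not P : CP P -> CP (fun x => ~ P x).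
Proof. by move=> H; apply: (CP_zero H) => x; rewrite chi0'. Qed.
Lemma CP_imp P Q : CP P -> CP Q -> CP (fun x => P x -> Q x).
Proof.
move=> HP HQ; apply: (CP_ext (P := fun x => ~ (P x /\ ~ Q x))) => [x|]; last first.
  by apply: CP_not; apply: CP_and => //; apply: CP_not.
split=> [H K|H [K L]]; last exact: L (H K).
by apply: contrapT => L; apply: H.
Qed.
Lemma CP_or P Q : CP P -> CP Q -> CP (fun x => P x \/ Q x).
Proof.
move=> HP HQ; apply: (CP_ext (P := fun x => ~ P x -> Q x)) => [x|]; last first.
  by apply: CP_imp => //; apply: CP_not.
split=> [H|[]//]; have [K|K] := pselect (P x); [by left|right; exact: H].
Qed.
Lemma CP_iff P Q : CP P -> CP Q -> CP (fun x => P x <-> Q x).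
Proof. by move=> HP HQ; apply: CP_and; apply: CP_imp. Qed.
Lemma CP_eq f g : Comp f -> Comp g -> CP (fun x => f x = g x).
Proof.
move=> Hf Hg; apply: (CP_ext (P := fun x => f x ⪯ g x /\ g x ⪯ f x)) => [x|].
  by split=> [[]|->]; [exact: leN_anti|split; right].
by apply: CP_and; apply: CP_le.
Qed.
(** A classical case distinction outside the model; with it [comp] discharges every condition on
    parameters alone. *)
Lemma CP_prop (P : Prop) : CP (fun _ => P).
Proof.
have [H|H] := pselect P.
- by apply: (CP_ext (P := fun x => x = x)) => //; apply: CP_eq; exact: Comp_id.
- apply: (CP_ext (P := fun x => x <> x)) => [x|]; first by split=> [[]|].
  by apply: CP_not; apply: CP_eq; exact: Comp_id.
Qed.
Lemma CP_app P f : CP P -> Comp f -> CP (fun x => P (f x)).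
Proof. by move=> HP Hf; exact: (Comp_comp HP Hf). Qed.
Lemma CP2_app (P : N -> N -> Prop) f g : CP2 P -> Comp f -> Comp g -> CP (fun x => P (f x) (g x)).
Proof.
move=> Hh Hf Hg; apply: CP_ext (CP_app Hh (Comp_spr Hf Hg)) => x.
by rewrite p1E p2E.
Qed.
Lemma CP_oracle f : Comp f -> CP (fun x => inS (f x) Z).
Proof.
apply: (@CP_app (fun x => inS x Z)); exists (spr 4%:R 0) => x; rewrite /chi.
have [H|H] := pselect (inS x Z); first by rewrite iteT //; apply: cmp_or1.
by rewrite iteF //; apply: cmp_or0.
Qed.
Lemma Comp_ite P f g : CP P -> Comp f -> Comp g -> Comp (fun x => ite (P x) (f x) (g x)).
Proof.
move=> HP Hf Hg; apply: (Comp_ext (f := fun x => chi P x * f x + nsub 1 (chi P x) * g x)); last first.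
  by apply: Comp_add; apply: Comp_mul => //; apply: Comp_chi.
move=> x; rewrite /chi; have [H|H] := pselect (P x).
- by rewrite !iteT // (proj2 (nsub0 1 1)); [ring|right].
- by rewrite !iteF // nsub_0; ring.
Qed.

Lemma CP_leT X : CP (fun x => inS x X) <-> sleT X Z.
Proof.
split=> [[e He]|[e He]]; exists e => x; move: (He x); rewrite /chi; have [H|H] := pselect (inS x X).
- by rewrite iteT.
- by rewrite iteF.
- by rewrite iteT // => -[] /(_ H).
- by rewrite iteF // => -[_] /(_ H).
Qed.

(** A total index with values 0 and 1 makes the predicate Delta_1: some computation has value 1
    exactly when none has value 0. *)
Lemma CP_set P : CP P -> exists A, forall x, inS x A <-> P x.
Proof.
move=> [e He].
pose R w n (r : nat -> N) s := bgood (M := M) (s 0%N) w /\ smem (strip (r 0%N) n 1) w.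
pose S w n (r : nat -> N) s := ~ (bgood (M := M) (s 0%N) w /\ smem (strip (r 0%N) n 0) w).
have DR : D0 (fun r s => R (r 0%N) (r 1%N) (fun i => r i.+2) s) by rewrite /R; d0.
have DS : D0 (fun r s => S (r 0%N) (r 1%N) (fun i => r i.+2) s) by rewrite /S; d0.
have RE y n : (exists w, bgood (M := M) Z w /\ smem (strip e n y) w) <-> cmp e n y.
  by split=> [[w [/bgoodE G H]]|[w [H /bgoodE G]]]; exists w.
have He0 n : cmp e n 0 <-> ~ cmp e n 1.
  move: (He n); rewrite /chi; have [H|H] := pselect (P n); [rewrite iteT //|rewrite iteF //].
  - move=> K; split=> // K'; have := cmp_unique K K' => E.
    by have := @ltN01 M; rewrite E => /ltNn.
  - move=> K; split=> // _ K'; have := cmp_unique K K' => E.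
    by have := @ltN01 M; rewrite E => /ltNn.
have [n|A HA] := comprehension DR DS (r := env [:: e]) (h := senv [:: Z]).
  rewrite /R /S RE; split=> [H w K|H].
    by case: (He0 n) => H1 _; apply: H1 H; apply/RE; exists w.
  apply: contrapT => K; have /RE[w Hw] : cmp e n 0 by apply/He0.
  exact: H w Hw.
exists A => x; rewrite HA /R RE; move: (He x); rewrite /chi.
have [H|H] := pselect (P x); [rewrite iteT //|rewrite iteF //].
by move/He0 => K; split.
Qed.

Lemma cp_ind P : CP P -> P 0 -> (forall n, P n -> P (n + 1)) -> forall n, P n.
Proof.
move=> /CP_set[A HA] H0 HS n; apply/HA; apply: set_ind; first exact/HA.
by move=> m /HA /HS /HA.
Qed.

Lemma cp_least P : CP P -> (exists x, P x) -> exists x, P x /\ forall y, y ≺ x -> ~ P y.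
Proof.
move=> /CP_set[A HA] [x Px]; apply: contrapT => H.
pose Q n (r : nat -> N) s := forall x, x ≺ n -> ~ inS (M := M) x (s 0%N).
have D : D0 (fun r s => Q (r 0%N) (fun i => r i.+1) s) by rewrite /Q; d0.
suff K n : Q n (env [::]) (senv [:: A]) by apply: (K (x + 1) x); [nlra|apply/HA].
apply: (D0_ind D) n => [y L|n IH y L /HA Hy]; first by nlra.
have [Ly|Ly] := pselect (y ≺ n); first by apply: IH Ly _; apply/HA.
by apply: H; exists y; split=> // z Lz /HA; apply: IH; nlra.
Qed.

Lemma cp_sigma_ind (P : N -> N -> Prop) : CP2 P ->
  (exists w, P w 0) -> (forall n, (exists w, P w n) -> exists w, P w (n + 1)) ->
  forall n, exists w, P w n.
Proof.
move=> /CP_set[A HA] H0 HS.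
pose Q w n (r : nat -> N) s := inS (M := M) (spr w n) (s 0%N).
have D : D0 (fun r s => Q (r 0%N) (r 1%N) (fun i => r i.+2) s) by rewrite /Q; d0.
have QE n : (exists w, Q w n (env [::]) (senv [:: A])) <-> exists w, P w n.
  by split=> -[w Hw]; exists w; move: Hw; rewrite /Q HA p1E p2E.
move=> n; apply/QE; apply: (sigma_ind D) n; first exact/QE.
by move=> n /QE /HS /QE.
Qed.

Lemma Comp_least (P : N -> N -> Prop) : CP2 P -> (forall x, exists y, P x y) ->
  exists m, Comp m /\ forall x, P x (m x) /\ forall y, y ≺ m x -> ~ P x y.
Proof.
move=> HP T.
have L x : exists y, P x y /\ forall z, z ≺ y -> ~ P x z.
  by apply: cp_least => //; apply: (CP2_app HP); [exact: Comp_const|exact: Comp_id].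
pose m x := projT1 (cid (L x)).
have Hm x : P x (m x) /\ forall z, z ≺ m x -> ~ P x z by rewrite /m; case: cid.
exists m; split=> //.
have [e He] := Comp_chi HP.
have E x y : cmp e (spr x y) (nsub 1 (chi (fun z => P (p1 z) (p2 z)) (spr x y))) by apply: He.
exists (spr 8%:R e) => x; have [H1 H2] := Hm x; apply: cmp_min.
- suff <- : nsub 1 (chi (fun z => P (p1 z) (p2 z)) (spr x (m x))) = 0 by [].
  by apply/chi0; rewrite p1E p2E.
- move=> n /H2 K; exists (nsub 1 (chi (fun z => P (p1 z) (p2 z)) (spr x n))); split=> //.
  case: (leN0 (nsub 1 (chi (fun z => P (p1 z) (p2 z)) (spr x n)))) => // /esym /chi0.
  by rewrite p1E p2E.
Qed.

(** Search for the least y that is a counterexample or equals the bound; the quantified statement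
    holds exactly when this y is not below the bound. *)
Lemma CP_ball (t : N -> N) (P : N -> N -> Prop) : Comp t -> CP2 P ->
  CP (fun x => forall y, y ≺ t x -> P x y).
Proof.
move=> Ht HP; pose Q x y := y = t x \/ ~ P x y.
have HQ : CP2 Q.
  apply: CP_or; last exact: CP_not.
  apply: CP_eq; first by apply: Comp_p2; exact: Comp_id.
  by apply: Comp_comp Ht _; apply: Comp_p1; exact: Comp_id.
have [m [Hm Hmin]] := Comp_least HQ (fun x => ex_intro _ (t x) (or_introl erefl)).
apply: (CP_ext (P := fun x => t x ⪯ m x)) => [x|]; last exact: CP_le.
have [Q1 Q2] := Hmin x; split=> [L y Ly|H].
- by apply: contrapT => K; apply: (Q2 y); [nlra|right].
- case: Q1 => [->|K]; first by right.
  by apply/leN_ltN => /H.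
Qed.
Lemma CP_bex (t : N -> N) (P : N -> N -> Prop) : Comp t -> CP2 P ->
  CP (fun x => exists y, y ≺ t x /\ P x y).
Proof.
move=> Ht HP; apply: (CP_ext (P := fun x => ~ forall y, y ≺ t x -> ~ P x y)) => [x|].
  split=> [H|[y [L H]] K]; last exact: K L H.
  by apply: contrapT => K; apply: H => y L H; apply: K; exists y.
by apply: CP_not; apply: CP_ball => //; apply: CP_not.
Qed.
End Computable.

(** Extension points of [comp], redefined as further computable operations become available. *)
Ltac comp_known := fail.
Ltac comp_string := fail.
Ltac comp_var := match goal with
  | H : Comp _ ?h |- Comp _ (fun x => ?h (@?f x)) => apply: (Comp_comp H)
  | H : Comp2 _ ?h |- Comp _ (fun x => ?h (@?f x) (@?g x)) => apply: (Comp2_app H)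
  | H : CP _ (fun x => inS x ?A) |- CP _ (fun x => inS (@?f x) ?A) => apply: (CP_app H)
  | H : CP _ ?h |- CP _ (fun x => ?h (@?f x)) => apply: (CP_app H)
  | H : CP2 _ ?h |- CP _ (fun x => ?h (@?f x) (@?g x)) => apply: (CP2_app H)
  end.
Ltac comp1 := lazymatch goal with
  | |- Comp2 _ _ => rewrite /Comp2
  | |- CP2 _ _ => rewrite /CP2
  | |- Comp _ (fun x => x) => exact: Comp_id
  | |- Comp _ (fun _ => ?c) => exact: Comp_const
  | |- Comp _ (fun x => _ + _) => apply: Comp_add
  | |- Comp _ (fun x => _ * _) => apply: Comp_mul
  | |- Comp _ (fun x => nsub _ _) => apply: Comp_sub
  | |- Comp _ (fun x => p1 _) => apply: Comp_p1
  | |- Comp _ (fun x => p2 _) => apply: Comp_p2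
  | |- Comp _ (fun x => spr _ _) => apply: Comp_spr
  | |- Comp _ (fun x => strip _ _ _) => rewrite /strip
  | |- Comp _ (fun x => ite _ _ _) => apply: Comp_ite
  | |- CP _ (fun _ => ?P) => exact: CP_prop
  | |- CP _ (fun x => _ = _) => apply: CP_eq
  | |- CP _ (fun x => _ ≺ _) => apply: CP_lt
  | |- CP _ (fun x => _ ⪯ _) => apply: CP_le
  | |- CP _ (fun x => _ /\ _) => apply: CP_and
  | |- CP _ (fun x => _ \/ _) => apply: CP_or
  | |- CP _ (fun x => _ <-> _) => apply: CP_iff
  | |- CP _ (fun x => ~ _) => apply: CP_not
  | |- CP _ (fun x => bex _ _) => rewrite /bex
  | |- CP _ (fun x => forall y, y ≺ _ -> _) => apply: CP_ball
  | |- CP _ (fun x => exists y, y ≺ _ /\ _) => apply: CP_bex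
  | |- CP _ (fun x => _ -> _) => apply: CP_imp
  end.
Ltac comp_eta := lazymatch goal with
  | |- Comp ?Z ?f => lazymatch f with (fun _ => _) => fail | _ => change (Comp Z (fun x => f x)) end
  | |- CP ?Z ?f => lazymatch f with (fun _ => _) => fail | _ => change (CP Z (fun x => f x)) end
  end.
Ltac comp := repeat (cbv beta; first [assumption | comp_eta | comp_var | comp_known | comp_string | comp1]).

Section Recursion.
Variables (M : model) (Z : set_of M).
Local Notation N := (carrier M).
Local Notation Comp := (Comp Z).
Local Notation Comp2 := (Comp2 Z).
Local Notation CP := (CP Z).
Local Notation CP2 := (CP2 Z).
Implicit Types (x y z n a c i u v : N).

Lemma CP_smem (f g : N -> N) : Comp f -> Comp g -> CP (fun x => smem (f x) (g x)).
Proof.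
move=> Hf Hg; have H : CP2 (@smem M).
  by apply: (CP_ext (fun z => iff_sym (smemE (p1 z) (p2 z)))); comp.
by comp.
Qed.

(** In one direction, induction on i shows that every justified pair (i, u) of a witnessing set has
    u = h i. In the other, Sigma_1 induction codes the set of all pairs (i, h i) up to n. *)
Lemma prim_rec_eq (h : N -> N) (base : N -> Prop) (step : N -> N -> N -> Prop) :
  Comp h -> (forall u, base u <-> u = h 0) -> (forall i u, step i (h i) u <-> u = h (i + 1)) ->
  forall n y, sprim_rec base step n y <-> y = h n.
Proof.
move=> Hh Hb Hs n y; split.
  move=> [c [Hm HJ]].
  have K : forall i, forall u, u ≺ c -> smem (spr i u) c -> u = h i.
    have D : CP (fun i => forall u, u ≺ c -> smem (spr i u) c -> u = h i).
      by comp; apply: CP_smem; comp.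
    apply: (cp_ind D) => [u _ /HJ [[_ /Hb //]|[j [v [E _]]]]|i IH u _ /HJ [[E _]|[j [v [E [Hv Hst]]]]]].
    - by exfalso; nlra.
    - by exfalso; nlra.
    - have E' := addNI E; subst j; apply/Hs; rewrite -(IH v) //.
      by apply: leN_ltN_trans (smem_lt Hv); apply: spr_ler.
  by apply: (K n y _ Hm); apply: leN_ltN_trans (smem_lt Hm); apply: spr_ler.
move=> ->.
pose Q c n := (forall z, z ≺ c -> smem z c -> p1 z ⪯ n /\ z = spr (p1 z) (h (p1 z))) /\
  forall i, i ≺ n + 1 -> smem (spr i (h i)) c.
have D : CP2 Q by rewrite /Q; comp; apply: CP_smem; comp.
have [||c [Hc1 Hc2]] := cp_sigma_ind D _ _ n.
- have [c Hc] := code_single (spr 0 (h 0)); exists c; split=> [z _ /Hc ->|i L].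
    by rewrite p1E; split=> //; right.
  by apply/Hc; have -> : i = 0 by nlra.
- move=> {}n [c [Hc1 Hc2]]; have [c1 H1] := code_single (spr (n + 1) (h (n + 1))).
  have [c2 H2] := code_union c c1; exists c2; split=> [z _ /H2[K|/H1 ->]|i L].
  + by have [L E] := Hc1 z (smem_lt K) K; split=> //; nlra.
  + by rewrite p1E; split=> //; right.
  + apply/H2; have [E|E] := pselect (i = n + 1); first by right; apply/H1; rewrite E.
    by left; apply: Hc2; case: (ltN_cmp i (n + 1)) => // ?; exfalso; nlra.
exists c; split=> [|i u Hi]; first by apply: Hc2; nlra.
have [L E] := Hc1 _ (smem_lt Hi) Hi; move: L E; rewrite p1E => L /spr_inj[_ Eu].
case: (leN0 i) => [Hi0|E0]; last by left; split=> //; apply/Hb; rewrite Eu -E0.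
have [j Ej] : exists j, j + 1 = i by have /leN_subE[j <-] := ltN_ge1 Hi0; exists j; ring.
right; exists j, (h j); rewrite -Ej; split=> //; split; first by apply: Hc2; nlra.
by apply/Hs; rewrite Ej.
Qed.
End Recursion.
Ltac comp_known ::= lazymatch goal with
  | |- CP _ (fun x => smem _ _) => apply: CP_smem
  end.

(** * Primitive recursion independent of the oracle *)

Section PrimitiveRecursion.
Variable M : model.
Local Notation N := (carrier M).
Implicit Types (x y z n a b c i u v : N) (Z : set_of M).

(** Taken from the formal recursion, without mention of an oracle, so that one and the same function
    is computable in every oracle that computes its data. *)
Definition prec b (g : N -> N -> N) n : N :=
  if pselect (exists y, sprim_rec (fun u => u = b) (fun i v u => u = g i v) n y) is left E
  then projT1 (cid E) else 0.

Definition Comp3 Z (g : N -> N -> N -> N) := Comp Z (fun z => g (p1 z) (p1 (p2 z)) (p2 (p2 z))).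

Lemma Comp3_app Z (g : N -> N -> N -> N) (f1 f2 f3 : N -> N) : Comp3 Z g ->
  Comp Z f1 -> Comp Z f2 -> Comp Z f3 -> Comp Z (fun x => g (f1 x) (f2 x) (f3 x)).
Proof.
move=> Hg H1 H2 H3; apply: Comp_ext (Comp_comp Hg (Comp_spr H1 (Comp_spr H2 H3))) => x.
by rewrite !(p1E, p2E).
Qed.

Lemma precP Z (b : N -> N) (g : N -> N -> N -> N) : Comp Z b -> Comp3 Z g ->
  exists h : N -> N -> N, [/\ Comp2 Z h, forall a, h a 0 = b a,
    forall a n, h a (n + 1) = g a n (h a n) & forall a n, prec (b a) (g a) n = h a n].
Proof.
move=> Hb Hg; have [h [Hh h0 hS]] := Comp_rec Hb Hg.
exists h; split=> // [a n|a n]; first by rewrite hS !(p1E, p2E).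
have Ha : Comp Z (fun n => h a n) by comp.
rewrite /prec.
have E y : sprim_rec (fun u => u = b a) (fun i v u => u = g a i v) n y <-> y = h a n.
  by apply: (prim_rec_eq Ha) => [u|i u]; rewrite ?h0 // hS !(p1E, p2E).
case: pselect => [H|[]]; last by exists (h a n); apply/E.
by case: cid => y /= /E.
Qed.

Lemma Comp_prec Z (b t : N -> N) (g : N -> N -> N -> N) : Comp Z b -> Comp3 Z g -> Comp Z t ->
  Comp Z (fun x => prec (b x) (g x) (t x)).
Proof.
move=> Hb Hg Ht; have [h [Hh _ _ E]] := precP Hb Hg.
by apply: (Comp_ext (f := fun x => h x (t x))) => [x|]; [rewrite E|comp].
Qed.
Lemma prec0 Z b (g : N -> N -> N) : Comp2 Z g -> prec b g 0 = b.
Proof.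
move=> Hg; have [|h [_ h0 _ E]] := @precP Z (fun _ => b) (fun _ => g) (Comp_const Z b); first by rewrite /Comp3; comp.
by rewrite (E 0) h0.
Qed.
Lemma precS Z b (g : N -> N -> N) n : Comp2 Z g -> prec b g (n + 1) = g n (prec b g n).
Proof.
move=> Hg; have [|h [_ _ hS E]] := @precP Z (fun _ => b) (fun _ => g) (Comp_const Z b); first by rewrite /Comp3; comp.
by rewrite !(E 0) hS.
Qed.
End PrimitiveRecursion.

Ltac comp_known ::= match goal with
  | |- CP _ (fun x => smem _ _) => apply: CP_smem
  | |- Comp _ (fun x => prec _ _ _) => apply: Comp_prec
  | |- Comp3 _ _ => rewrite /Comp3
  | H : Comp3 _ ?h |- Comp _ (fun x => ?h (@?f x) (@?g x) (@?k x)) => apply: (Comp3_app H)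
  end.

(** * Computable functions with rational values *)

Section Rationals.
Variable M : model.
Local Notation N := (carrier M).
Local Notation K := (ratio M).
Implicit Types (x y z n a b c i u v : N) (Z : set_of M) (t : frac M) (k l : K).

Definition qv t : K := (iota (fnum t) - iota (fneg t)) / iota (fden t).
Definition fr y : frac M := Frac (p1 (p1 y)) (p2 (p1 y)) (p2 y).
Definition qval y : K := qv (fr y).
Definition isq y : Prop := exists t, fvalid t /\ y = scode t.

Lemma fr_scode t : fr (scode t) = t.
Proof. by rewrite /fr /scode !(p1E, p2E); case: t. Qed.
Lemma qval_scode t : qval (scode t) = qv t.
Proof. by rewrite /qval fr_scode. Qed.
Lemma isqE y : isq y <-> 0 ≺ p2 y /\ y = spr (spr (p1 (p1 y)) (p2 (p1 y))) (p2 y).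
Proof.
split=> [[[a b c] [V ->]]|[V E]]; first by rewrite /scode /= !(p1E, p2E).
by exists (fr y).
Qed.
Lemma fvalid_gt0 t : fvalid t -> 0 < iota (fden t).
Proof. by move=> /iota_lt; rewrite iota0. Qed.

Lemma srleE t (u : frac M) : fvalid t -> fvalid u -> srle t u <-> qv t <= qv u.
Proof.
move=> /fvalid_gt0 Vt /fvalid_gt0 Vu; rewrite /qv ler_pdivrMr // mulrAC ler_pdivlMr //.
rewrite /srle leNK !(iotaD, iotaM); move: (iota _) (iota _) (iota _) (iota _) (iota _) (iota _) => p q r s w o.
by split=> H; lra.
Qed.
Lemma srltE t (u : frac M) : fvalid t -> fvalid u -> srlt t u <-> qv t < qv u.
Proof.
move=> Vt Vu; rewrite real_ltNge ?num_real //.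
have -> : srlt t u <-> ~ srle u t by rewrite /srlt /srle not_leN.
by rewrite srleE //; split=> /negP.
Qed.
Lemma qv_sropp t : qv (sropp t) = - qv t.
Proof. by rewrite /qv /= -mulNr opprB. Qed.
Lemma qv_sradd t (u : frac M) : fvalid t -> fvalid u -> qv (sradd t u) = qv t + qv u.
Proof.
move=> /fvalid_gt0 Vt /fvalid_gt0 Vu; rewrite /qv /= !(iotaD, iotaM).
by field; rewrite !gt_eqF.
Qed.
Lemma sradd_valid t (u : frac M) : fvalid t -> fvalid u -> fvalid (sradd t u).
Proof. exact: pos_mul. Qed.
Lemma qv_srnat n : qv (srnat n) = iota n.
Proof. by rewrite /qv /= iota0 iota1 subr0 divr1. Qed.
Lemma qv_srinv n : qv (srinv n) = (iota n)^-1.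
Proof. by rewrite /qv /= iota0 iota1 subr0 mul1r. Qed.
Lemma srnat_valid n : fvalid (srnat n). Proof. exact: ltN01. Qed.

Lemma qv_surj k : exists t, fvalid t /\ qv t = k.
Proof.
elim/ratioP: k => t V; exists t; split=> //; have Vt := fvalid_gt0 V.
apply: (mulIf (x := iota (fden t))); first by rewrite gt_eqF.
rewrite /qv divfK ?gt_eqF //; rewrite -[_ * _]/(rat_mul _ _) -[_ - _]/(rat_add _ (rat_opp _)).
by rewrite !iota_def rat_oppE rat_addE rat_mulE; apply/mkrE; rewrite /feq /=; ring.
Qed.

Lemma qv_eq t (u : frac M) : fvalid t -> fvalid u -> qv t = qv u <->
  fnum t * fden u + fneg u * fden t = fnum u * fden t + fneg t * fden u.
Proof.
move=> Vt Vu; split=> [E|E].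
- by apply: leN_anti; [apply/(srleE Vt Vu)|apply/(srleE Vu Vt)]; rewrite E.
- by apply/le_anti/andP; split; apply/srleE => //; rewrite /srle E; right.
Qed.

Lemma CP_isq Z (f : N -> N) : Comp Z f -> CP Z (fun x => isq (f x)).
Proof.
move=> Hf; apply: (CP_ext (P := fun x => 0 ≺ p2 (f x) /\ f x = spr (spr (p1 (p1 (f x))) (p2 (p1 (f x)))) (p2 (f x)))).
  by move=> x; rewrite isqE.
by comp.
Qed.

Definition same_q y z : Prop := isq z /\ isq y /\
  p1 (p1 y) * p2 z + p2 (p1 z) * p2 y = p1 (p1 z) * p2 y + p2 (p1 y) * p2 z.
Lemma same_qE y z : isq y -> same_q y z <-> isq z /\ qval z = qval y.
Proof.
move=> Hy; have [Vy _] := proj1 (isqE y) Hy.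
split=> [[Hz [_ E]]|[Hz E]]; have [Vz _] := proj1 (isqE z) Hz.
- by split=> //; apply/esym/qv_eq.
- by split=> //; split=> //; apply/(@qv_eq (fr y) (fr z)).
Qed.
Lemma CP_same_q Z (f g : N -> N) : Comp Z f -> Comp Z g -> CP Z (fun x => same_q (f x) (g x)).
Proof. by move=> *; rewrite /same_q; comp; apply: CP_isq; comp. Qed.

Lemma qc_ex k : exists y, (isq y /\ qval y = k) /\ forall z, z ≺ y -> ~ (isq z /\ qval z = k).
Proof.
have [t [V E]] := qv_surj k.
have Hy : isq (scode t) by exists t.
have T z : same_q (scode t) z <-> isq z /\ qval z = k by rewrite same_qE // qval_scode E.
have [||y [H1 H2]] := @cp_least M (inh M) (fun z => same_q (scode t) z).
- by apply: CP_same_q; comp.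
- by exists (scode t); apply/T; rewrite qval_scode.
- by exists y; split=> [|z /H2 H3]; [apply/T|move=> H4; apply: H3; apply/T].
Qed.
(** A rational has many codes. Its least code is canonical, and a rational-valued function counts as
    computable when this code is. *)
Definition qc k : N := projT1 (cid (qc_ex k)).
Lemma qc_isq k : isq (qc k). Proof. by rewrite /qc; case: cid => y [[]]. Qed.
Lemma qcK k : qval (qc k) = k. Proof. by rewrite /qc; case: cid => y [[]]. Qed.
Lemma qc_least k z : isq z -> qval z = k -> qc k ⪯ z.
Proof. by rewrite /qc; case: cid => y [_ H] /= Hz E; apply/leN_ltN => /H; apply. Qed.

Definition CQ Z (F : N -> K) := Comp Z (fun x => qc (F x)).

(** Codes of the same rational are recognised by cross-multiplication, so the least one is found by
    search from any code. *)
Lemma CQ_of Z (f : N -> N) (F : N -> K) :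
  Comp Z f -> (forall x, isq (f x)) -> (forall x, qval (f x) = F x) -> CQ Z F.
Proof.
move=> Hf Hq E.
have HP : CP2 Z (fun x y => same_q (f x) y) by comp; apply: CP_same_q; comp.
have [|m [Hm Hmin]] := Comp_least HP.
  by move=> x; exists (f x); apply/(same_qE _ (Hq x)).
apply: Comp_ext Hm => x; have [/(same_qE _ (Hq x))[I V] L] := Hmin x.
apply: leN_anti; last by apply: qc_least => //; rewrite V E.
apply/leN_ltN => /L; apply; apply/(same_qE _ (Hq x)); split; first exact: qc_isq.
by rewrite qcK E.
Qed.
Lemma CQ_frac Z (a b c : N -> N) (F : N -> K) : Comp Z a -> Comp Z b -> Comp Z c ->
  (forall x, 0 ≺ c x) -> (forall x, F x = (iota (a x) - iota (b x)) / iota (c x)) -> CQ Z F.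
Proof.
move=> Ha Hb Hc V E; apply: (@CQ_of _ (fun x => spr (spr (a x) (b x)) (c x))); first by comp.
- by move=> x; exists (Frac (a x) (b x) (c x)); split=> //; exact: V.
- by move=> x; rewrite E -[spr _ _]/(scode (Frac (a x) (b x) (c x))) qval_scode.
Qed.
Lemma CQ_destruct Z F : CQ Z F -> exists a b c : N -> N, [/\ Comp Z a, Comp Z b, Comp Z c,
  forall x, 0 ≺ c x & forall x, F x = (iota (a x) - iota (b x)) / iota (c x)].
Proof.
move=> H; exists (fun x => p1 (p1 (qc (F x)))), (fun x => p2 (p1 (qc (F x)))), (fun x => p2 (qc (F x))).
split.
- by do 2!apply: Comp_p1.
- by apply: Comp_p2; apply: Comp_p1.
- exact: Comp_p2.
- by move=> x; have [] := proj1 (isqE _) (qc_isq (F x)).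
- by move=> x; rewrite -{1}(qcK (F x)).
Qed.
End Rationals.

Section ComputableRationals.
Variables (M : model) (Z : set_of M).
Local Notation N := (carrier M).
Local Notation K := (ratio M).
Local Notation CQ := (CQ Z).
Implicit Types (x y z n a b c i u v : N) (F G : N -> K) (k l : K).

Definition CQ2 (F : N -> N -> K) := CQ (fun z => F (p1 z) (p2 z)).

Lemma CQ_ext F G : (forall x, F x = G x) -> CQ F -> CQ G.
Proof. by move=> E; rewrite (_ : F = G) //; apply: funext. Qed.
Lemma CQ_app F (f : N -> N) : CQ F -> Comp Z f -> CQ (fun x => F (f x)).
Proof. by move=> HF Hf; exact: (Comp_comp HF Hf). Qed.
Lemma CQ2_app (F : N -> N -> K) (f g : N -> N) : CQ2 F -> Comp Z f -> Comp Z g -> CQ (fun x => F (f x) (g x)).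
Proof.
move=> HF Hf Hg; apply: CQ_ext (CQ_app HF (Comp_spr Hf Hg)) => x.
by rewrite p1E p2E.
Qed.
Lemma CQ_const k : CQ (fun _ => k).
Proof. exact: Comp_const. Qed.
Lemma CQ_iota (f : N -> N) : Comp Z f -> CQ (fun x => iota (f x)).
Proof.
move=> Hf; apply: (@CQ_frac _ _ f (fun _ => 0) (fun _ => 1)); rewrite ?Comp_const //; try exact: Comp_const.
- by move=> _; exact: ltN01.
- by move=> x; rewrite iota0 iota1 subr0 divr1.
Qed.
Lemma iota_gt0 x : 0 ≺ x -> 0 < iota x.
Proof. by move=> /iota_lt; rewrite iota0. Qed.
Lemma CQ_add F G : CQ F -> CQ G -> CQ (fun x => F x + G x).
Proof.
move=> /CQ_destruct[a [b [c [Ha Hb Hc V E]]]] /CQ_destruct[a' [b' [c' [Ha' Hb' Hc' V' E']]]].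
apply: (@CQ_frac _ _ (fun x => a x * c' x + a' x * c x) (fun x => b x * c' x + b' x * c x) (fun x => c x * c' x)); comp.
- by move=> x; apply: pos_mul.
- move=> x; rewrite E E' !(iotaD, iotaM); field; rewrite !gt_eqF //; exact: iota_gt0.
Qed.
Lemma CQ_opp F : CQ F -> CQ (fun x => - F x).
Proof.
move=> /CQ_destruct[a [b [c [Ha Hb Hc V E]]]].
by apply: (@CQ_frac _ _ b a c) => // x; rewrite E -mulNr opprB.
Qed.
Lemma CQ_sub F G : CQ F -> CQ G -> CQ (fun x => F x - G x).
Proof. by move=> HF HG; apply: CQ_add => //; apply: CQ_opp. Qed.
Lemma CQ_mul F G : CQ F -> CQ G -> CQ (fun x => F x * G x).
Proof.
move=> /CQ_destruct[a [b [c [Ha Hb Hc V E]]]] /CQ_destruct[a' [b' [c' [Ha' Hb' Hc' V' E']]]].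
apply: (@CQ_frac _ _ (fun x => a x * a' x + b x * b' x) (fun x => a x * b' x + b x * a' x) (fun x => c x * c' x)); comp.
- by move=> x; apply: pos_mul.
- move=> x; rewrite E E' !(iotaD, iotaM); field; rewrite !gt_eqF //; exact: iota_gt0.
Qed.
Lemma CP_leK F G : CQ F -> CQ G -> CP Z (fun x => F x <= G x).
Proof.
move=> /CQ_destruct[a [b [c [Ha Hb Hc V E]]]] /CQ_destruct[a' [b' [c' [Ha' Hb' Hc' V' E']]]].
apply: (CP_ext (P := fun x => srle (Frac (a x) (b x) (c x)) (Frac (a' x) (b' x) (c' x)))).
  by move=> x; rewrite srleE /qv /= ?E ?E' //; apply: V || apply: V'.
by rewrite /srle /=; comp.
Qed.
Lemma CP_ltK F G : CQ F -> CQ G -> CP Z (fun x => F x < G x).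
Proof.
move=> HF HG; apply: (CP_ext (P := fun x => ~ G x <= F x)) => [x|]; last by apply: CP_not; apply: CP_leK.
by rewrite real_ltNge ?num_real //; split=> /negP.
Qed.
Lemma CP_eqK F G : CQ F -> CQ G -> CP Z (fun x => F x = G x).
Proof.
move=> HF HG; apply: (CP_ext (P := fun x => F x <= G x /\ G x <= F x)) => [x|]; last by apply: CP_and; apply: CP_leK.
by split=> [[H1 H2]|->]; [apply/le_anti/andP|split].
Qed.
Lemma CQ_ite P F G : CP Z P -> CQ F -> CQ G -> CQ (fun x => ite (P x) (F x) (G x)).
Proof.
move=> HP HF HG; apply: Comp_ext (Comp_ite HP HF HG) => x.
by rewrite /ite; case: pselect.
Qed.
Lemma CQ_inv F : CQ F -> CQ (fun x => (F x)^-1).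
Proof.
move=> /CQ_destruct[a [b [c [Ha Hb Hc V E]]]].
(* The summand [nsub 1] of the difference is 1 when the truncated difference vanishes and 0
   otherwise; it keeps the denominators positive also in the branch that is not taken. *)
apply: (CQ_ext (F := fun x => ite (a x = b x) 0 (ite (b x ≺ a x)
    (iota (c x) / (iota (nsub (a x) (b x)) + iota (nsub 1 (nsub (a x) (b x)))))
    (- (iota (c x) / (iota (nsub (b x) (a x)) + iota (nsub 1 (nsub (b x) (a x))))))))).
  move=> x; have [H|H] := pselect (a x = b x); first by rewrite iteT // E H subrr mul0r invr0.
  rewrite iteF //; have [L|L] := pselect (b x ≺ a x).
    have Lab : b x ⪯ a x by left.
    rewrite iteT // E invf_div (_ : nsub 1 _ = 0); last first.
      by apply/nsub0; apply/leNK; rewrite nsubK // iota1; nlra.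
    by rewrite iota0 addr0 nsubK.
  have L' : a x ≺ b x by case: (ltN_cmp (a x) (b x)).
  have Lab : a x ⪯ b x by left.
  rewrite iteF // E invf_div (_ : nsub 1 _ = 0); last first.
    by apply/nsub0; apply/leNK; rewrite nsubK // iota1; nlra.
  by rewrite iota0 addr0 nsubK // -[in RHS]opprB invrN mulrN.
have D (f : N -> N) : Comp Z f -> CQ (fun x => iota (c x) / (iota (f x) + iota (nsub 1 (f x)))).
  move=> Hf; apply: (@CQ_frac _ _ c (fun _ => 0) (fun x => f x + nsub 1 (f x))); comp.
  - move=> x; case: (leN0 (f x)) => [H|<-]; first by apply/ltNK; nlra.
    by rewrite nsub_0 add0r; exact: ltN01.
  - by move=> x; rewrite iota0 subr0 iotaD.
apply: CQ_ite; [comp|exact: CQ_const|apply: CQ_ite; [comp|apply: D; comp|apply: CQ_opp; apply: D; comp]].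
Qed.
Lemma CQ_div F G : CQ F -> CQ G -> CQ (fun x => F x / G x).
Proof. by move=> HF HG; apply: CQ_mul => //; apply: CQ_inv. Qed.
Lemma CQ_qval (f : N -> N) : Comp Z f -> CQ (fun x => qval (f x)).
Proof.
move=> Hf; rewrite /qval /qv /=; apply: CQ_div; last by apply: CQ_iota; comp.
by apply: CQ_sub; apply: CQ_iota; comp.
Qed.
Lemma CQ_exp F (n : nat) : CQ F -> CQ (fun x => F x ^+ n).
Proof.
move=> HF; elim: n => [|n IH]; first exact: CQ_const.
by apply: (CQ_ext (F := fun x => F x * F x ^+ n)) => [x|]; [rewrite exprS|apply: CQ_mul].
Qed.
End ComputableRationals.

Ltac comp_known ::= match goal with
  | |- CP _ (fun x => smem _ _) => apply: CP_smem
  | |- Comp _ (fun x => prec _ _ _) => apply: Comp_prec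
  | |- Comp3 _ _ => rewrite /Comp3
  | H : Comp3 _ ?h |- Comp _ (fun x => ?h (@?f x) (@?g x) (@?k x)) => apply: (Comp3_app H)
  | H : CQ _ ?h |- CQ _ (fun x => ?h (@?f x)) => apply: (CQ_app H)
  | H : CQ2 _ ?h |- CQ _ (fun x => ?h (@?f x) (@?g x)) => apply: (CQ2_app H)
  | |- CQ2 _ _ => rewrite /CQ2
  | |- CQ ?Z ?f => lazymatch f with (fun _ => _) => fail | _ => change (CQ Z (fun x => f x)) end
  | |- CQ _ (fun _ => ?c) => exact: CQ_const
  | |- CQ _ (fun x => iota _) => apply: CQ_iota
  | |- CQ _ (fun x => _ + _) => apply: CQ_add
  | |- CQ _ (fun x => - _) => apply: CQ_opp
  | |- CQ _ (fun x => _ * _) => apply: CQ_mul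
  | |- CQ _ (fun x => _ ^-1) => apply: CQ_inv
  | |- CQ _ (fun x => _ ^+ _) => apply: CQ_exp
  | |- CQ _ (fun x => ite _ _ _) => apply: CQ_ite
  | |- CQ _ (fun x => qval _) => apply: CQ_qval
  | |- Comp ?Z (fun x => qc (@?F x)) => change (CQ Z F)
  | |- CP _ (fun x => is_true (_ <= _)) => apply: CP_leK
  | |- CP _ (fun x => is_true (_ < _)) => apply: CP_ltK
  | |- CP _ (fun x => @eq (ratio _) _ _) => apply: CP_eqK
  end.

(** * Finite sums of rationals *)

Section Sums.
Variable M : model.
Local Notation N := (carrier M).
Local Notation K := (ratio M).
Implicit Types (x y z n a b c i u v : N) (F G : N -> K) (k l : K) (Z : set_of M).

(** The number of summands may be nonstandard, so the sum is an internal recursion on canonical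
    codes. It is sealed so that conversion does not unfold this recursion. *)
Lemma ksum_sig : {s : (N -> K) -> N -> K |
  forall F n, s F n = qval (prec (qc 0) (fun i v => qc (qval v + F i)) n)}.
Proof. by eexists. Qed.
Definition ksum := sval ksum_sig.
Lemma ksumE F n : ksum F n = qval (prec (qc 0) (fun i v => qc (qval v + F i)) n).
Proof. exact: (svalP ksum_sig). Qed.

Lemma CQ_ksum Z (F : N -> N -> K) (t : N -> N) : CQ2 Z F -> Comp Z t -> CQ Z (fun x => ksum (F x) (t x)).
Proof.
move=> HF Ht; apply: (CQ_ext (F := fun x => qval (prec (qc 0) (fun i v => qc (qval v + F x i)) (t x)))).
  by move=> x; rewrite ksumE.
by comp.
Qed.
Lemma ksum0 Z F : CQ Z F -> ksum F 0 = 0.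
Proof. by move=> HF; rewrite !ksumE (@prec0 _ Z) ?qcK //; comp. Qed.
Lemma ksumS Z F n : CQ Z F -> ksum F (n + 1) = ksum F n + F n.
Proof. by move=> HF; rewrite !ksumE (@precS _ Z) ?qcK //; comp. Qed.
End Sums.

(** * Strings and measure *)

Section Powers.
Variable M : model.
Local Notation N := (carrier M).
Local Notation Z0 := (inh M).
Implicit Types (x y z n a b c i j k u v s t : N) (Z : set_of M).

Definition pow2 n : N := prec 1 (fun _ v => v + v) n.
Lemma pow20 : pow2 0 = 1. Proof. by rewrite /pow2 (@prec0 _ Z0) //; comp. Qed.
Lemma pow2S n : pow2 (n + 1) = pow2 n + pow2 n.
Proof. by rewrite /pow2 (@precS _ Z0) //; comp. Qed.
Lemma Comp_pow2 Z (f : N -> N) : Comp Z f -> Comp Z (fun x => pow2 (f x)).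
Proof. by move=> Hf; rewrite /pow2; comp. Qed.
Ltac comp_string ::= lazymatch goal with
  | |- Comp _ (fun x => pow2 _) => apply: Comp_pow2
  end.
Lemma sexp2E n p : sexp2 n p <-> p = pow2 n.
Proof.
apply: (prim_rec_eq (Z := Z0)) => [|u|i u]; rewrite ?pow20 ?pow2S //.
by apply: Comp_pow2; comp.
Qed.
Lemma pow2_gt0 n : 0 ≺ pow2 n.
Proof.
have D : CP Z0 (fun n => 0 ≺ pow2 n) by comp.
by apply: (cp_ind D) => [|m IH]; rewrite ?pow20 ?pow2S; [exact: ltN01|nlra].
Qed.
Lemma pow2D m n : pow2 (m + n) = pow2 m * pow2 n.
Proof.
have D : CP Z0 (fun n => pow2 (m + n) = pow2 m * pow2 n) by comp.
apply: (cp_ind D) n => [|n IH]; first by rewrite addr0 pow20 mulr1.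
by rewrite addrA !pow2S IH mulrDr.
Qed.
Lemma lt_pow2 n : n ≺ pow2 n.
Proof.
have D : CP Z0 (fun n => n ≺ pow2 n) by comp.
by apply: (cp_ind D) n => [|m IH]; rewrite ?pow20 ?pow2S; [exact: ltN01|nlra].
Qed.
Lemma pow2_mono m n : m ⪯ n -> pow2 m ⪯ pow2 n.
Proof.
move=> /leN_subE[d <-]; rewrite pow2D.
by have := pow2_gt0 d; have := pow2_gt0 m; move: (pow2 m) (pow2 d) => a b *; nnra.
Qed.
Lemma pow2_lt_inv m n : pow2 m ≺ pow2 (n + 1) -> m ⪯ n.
Proof.
move=> L; apply/leN_ltN => /ltN_S /pow2_mono H.
by move: (pow2 m) (pow2 (n + 1)) L H => a b *; nlra.
Qed.

Lemma hlf_ex n : exists h, n = h + h \/ n = h + h + 1.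
Proof.
have D : CP2 Z0 (fun h n => n = h + h \/ n = h + h + 1) by comp.
apply: (cp_sigma_ind D) => [|m [h [->|->]]]; first by exists 0; left; rewrite addr0.
- by exists h; right.
- by exists (h + 1); left; ring.
Qed.
Definition hlf n : N := projT1 (cid (hlf_ex n)).
Lemma hlfP n : n = hlf n + hlf n \/ n = hlf n + hlf n + 1.
Proof. by rewrite /hlf; case: cid. Qed.
Lemma hlf_unique n h : n = h + h \/ n = h + h + 1 -> hlf n = h.
Proof.
move=> H; move: (hlf n) (hlfP n) => a [E|E]; case: H => E'; rewrite {}E' in E.
- by nlra.
- by case: (ltN_cmp a h) => [L|L|L]; exfalso; nlra.
- by case: (ltN_cmp a h) => [L|L|L]; exfalso; nlra.
- by nlra.
Qed.
Lemma hlf0 s : hlf (s + s) = s. Proof. by apply: hlf_unique; left. Qed.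
Lemma hlf1 s : hlf (s + s + 1) = s. Proof. by apply: hlf_unique; right. Qed.
Lemma Comp_hlf Z (f : N -> N) : Comp Z f -> Comp Z (fun x => hlf (f x)).
Proof.
move=> Hf; have H : CP2 Z (fun n h => n = h + h \/ n = h + h + 1) by comp.
have [m [Hm Hmin]] := Comp_least H hlf_ex.
apply: Comp_ext (Comp_comp Hm Hf) => x.
by have [H1 _] := Hmin (f x); rewrite (hlf_unique H1).
Qed.

Ltac comp_string ::= lazymatch goal with
  | |- Comp _ (fun x => pow2 _) => apply: Comp_pow2
  | |- Comp _ (fun x => hlf _) => apply: Comp_hlf
  end.
Lemma lh_ex s : exists n, s ≺ pow2 (n + 1) /\ (0 ≺ s -> pow2 n ⪯ s).
Proof.
have D : CP Z0 (fun n => s ≺ pow2 (n + 1)) by comp.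
have [|n [H1 H2]] := cp_least D.
  exists s; have := lt_pow2 (s + 1); move: (pow2 _) => a H; nlra.
exists n; split=> // Hs; case: (leN0 n) => [Hn|<-]; last by rewrite pow20; apply: ltN_ge1.
have [k Ek] : exists k, k + 1 = n by have /leN_subE[j <-] := ltN_ge1 Hn; exists j; ring.
by apply/leN_ltN; rewrite -Ek; apply: H2; rewrite -Ek; nlra.
Qed.
Definition lh s : N := projT1 (cid (lh_ex s)).
Lemma lh_lt s : s ≺ pow2 (lh s + 1). Proof. by rewrite /lh; case: cid => ? []. Qed.
Lemma lh_le s : 0 ≺ s -> pow2 (lh s) ⪯ s. Proof. by rewrite /lh; case: cid => ? []. Qed.
Lemma lh_unique s n : pow2 n ⪯ s -> s ≺ pow2 (n + 1) -> lh s = n.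
Proof.
move=> H1 H2; have H0 : 0 ≺ s.
  by have := pow2_gt0 n; move: (pow2 n) H1 => a *; nlra.
apply: leN_anti; apply: pow2_lt_inv; first exact: leN_ltN_trans (lh_le H0) H2.
exact: leN_ltN_trans H1 (lh_lt s).
Qed.
Lemma slenE s n : 0 ≺ s -> slen s n <-> n = lh s.
Proof.
move=> Hs; split=> [[p [/sexp2E -> [H1 H2]]]|->]; first by rewrite (@lh_unique s n) // pow2S.
by exists (pow2 (lh s)); split; [apply/sexp2E|split; [apply: lh_le|rewrite -pow2S; apply: lh_lt]].
Qed.
Lemma lh_hlf s : 0 ≺ hlf s -> lh s = lh (hlf s) + 1.
Proof.
move=> Hh; have H1 := lh_le Hh; have H2 := lh_lt (hlf s); rewrite pow2S in H2.
apply: lh_unique; rewrite !pow2S.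
- by case: (hlfP s) => E; move: (hlf s) (pow2 _) H1 H2 E => a b *; nlra.
- by case: (hlfP s) => E; move: (hlf s) (pow2 _) H1 H2 E => a b *; nlra.
Qed.
Lemma lh0 s : 0 ≺ s -> lh (s + s) = lh s + 1.
Proof. by move=> Hs; rewrite (@lh_hlf (s + s)) hlf0. Qed.
Lemma lh1 s : 0 ≺ s -> lh (s + s + 1) = lh s + 1.
Proof. by move=> Hs; rewrite (@lh_hlf (s + s + 1)) hlf1. Qed.
Lemma lh_one : lh 1 = 0.
Proof.
apply: lh_unique; first by rewrite pow20; right.
by rewrite pow2S pow20; nlra.
Qed.
Lemma Comp_lh Z (f : N -> N) : Comp Z f -> Comp Z (fun x => lh (f x)).
Proof.
move=> Hf; have H : CP2 Z (fun s n => s ≺ pow2 (n + 1) /\ (0 ≺ s -> pow2 n ⪯ s)).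
  by comp.
have [m [Hm Hmin]] := Comp_least H lh_ex.
(* 0 is not a string, and [lh 0] is an unspecified constant; it needs a branch of its own. *)
apply: (Comp_ext (f := fun x => ite (0 ≺ f x) (m (f x)) (lh 0))); last by comp.
move=> x; have [H1 _] := Hmin (f x).
case: (leN0 (f x)) => [Hx|<-]; last by rewrite iteF //; exact: ltNn.
by rewrite iteT //; case: H1 => H1 H2; rewrite (@lh_unique (f x) (m (f x))) //; apply: H2.
Qed.

Ltac comp_string ::= lazymatch goal with
  | |- Comp _ (fun x => pow2 _) => apply: Comp_pow2
  | |- Comp _ (fun x => hlf _) => apply: Comp_hlf
  | |- Comp _ (fun x => lh _) => apply: Comp_lh
  end.
Lemma lh_lt_self s : 0 ≺ s -> lh s ≺ s.
Proof.
move=> /lh_le; have := lt_pow2 (lh s); move: (lh s) (pow2 _) => a b *; nlra.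
Qed.

Definition anc s j : N := prec s (fun _ v => hlf v) j.
Lemma Comp_anc Z (f g : N -> N) : Comp Z f -> Comp Z g -> Comp Z (fun x => anc (f x) (g x)).
Proof. by move=> Hf Hg; rewrite /anc; comp. Qed.
Lemma anc0 s : anc s 0 = s. Proof. by rewrite /anc (@prec0 _ Z0) //; comp. Qed.
Lemma ancS s j : anc s (j + 1) = hlf (anc s j). Proof. by rewrite /anc (@precS _ Z0) //; comp. Qed.
Ltac comp_string ::= lazymatch goal with
  | |- Comp _ (fun x => pow2 _) => apply: Comp_pow2
  | |- Comp _ (fun x => hlf _) => apply: Comp_hlf
  | |- Comp _ (fun x => lh _) => apply: Comp_lh
  | |- Comp _ (fun x => anc _ _) => apply: Comp_anc
  end.
Lemma ancD s i j : anc s (i + j) = anc (anc s i) j.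
Proof.
have D : CP Z0 (fun j => anc s (i + j) = anc (anc s i) j) by comp.
by apply: (cp_ind D) j => [|j IH]; rewrite ?addr0 ?anc0 // addrA !ancS IH.
Qed.
Lemma hlf_gt0 s : 0 ≺ hlf s -> 0 ≺ s.
Proof. by case: (hlfP s) => E H; move: (hlf s) E H => a *; nlra. Qed.
Lemma anc_gt0 s j : 0 ≺ anc s j -> 0 ≺ s.
Proof.
have D : CP Z0 (fun j => 0 ≺ anc s j -> 0 ≺ s) by comp.
by apply: (cp_ind D) j => [|j IH]; rewrite ?anc0 // ancS => /hlf_gt0.
Qed.
Lemma anc_lh s j : 0 ≺ anc s j -> lh (anc s j) + j = lh s.
Proof.
have D : CP Z0 (fun j => 0 ≺ anc s j -> lh (anc s j) + j = lh s) by comp.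
apply: (cp_ind D) j => [|j IH]; first by rewrite anc0 addr0.
rewrite ancS => H; have H' := hlf_gt0 H.
by rewrite -IH // (lh_hlf H); ring.
Qed.
Lemma anc_mod s j t : t = anc s j <-> exists r, r ≺ pow2 j /\ s = t * pow2 j + r.
Proof.
have D : CP Z0 (fun j => exists r, r ≺ pow2 j /\ s = anc s j * pow2 j + r) by comp.
have H i : exists r, r ≺ pow2 i /\ s = anc s i * pow2 i + r.
  apply: (cp_ind D) i => [|i [r [L E]]].
    by exists 0; rewrite anc0 pow20 mulr1 addr0; split=> //; exact: ltN01.
  rewrite ancS pow2S; case: (hlfP (anc s i)) => Eh.
  - exists r; split; first by have := pow2_gt0 i; move: (pow2 i) L {E} => a *; nlra.
    rewrite {1}E {1}Eh; ring.
  - exists (r + pow2 i); split; first by move: (pow2 i) L {E} => a *; nlra.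
    rewrite {1}E {1}Eh; ring.
split=> [->|[r [L E]]]; first exact: H.
have [r' [L' E']] := H j; rewrite {1}E in E'.
have Hp := pow2_gt0 j; move: (anc s j) (pow2 j) L L' Hp E' => a p {D H E} L L' Hp E'.
case: (ltN_cmp t a) => // C; exfalso.
- have : (t + 1) * p ⪯ a * p by apply/leN_mulP => //; apply/ltN_S.
  by move=> ?; nlra.
- have : (a + 1) * p ⪯ t * p by apply/leN_mulP => //; apply/ltN_S.
  by move=> ?; nlra.
Qed.

(** Removing more bits than there are makes [anc] 0, which [0 ≺ t] excludes. The bound on [j] makes
    the relation decidable and loses nothing, as a string has fewer bits than its code. *)
Definition pre t s : Prop := 0 ≺ t /\ exists j, j ≺ s + 1 /\ t = anc s j.
Lemma preE t s : pre t s <-> 0 ≺ t /\ exists j, t = anc s j.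
Proof.
split=> [[H [j [_ E]]]|[H [j E]]]; split=> //; exists j => //; split=> //.
rewrite E in H; have := anc_lh H; have := lh_lt_self (anc_gt0 H).
by move: (lh _) (lh _) => a b *; nlra.
Qed.
Lemma CP_pre Z (f g : N -> N) : Comp Z f -> Comp Z g -> CP Z (fun x => pre (f x) (g x)).
Proof. by move=> Hf Hg; rewrite /pre; comp. Qed.
Lemma pre_refl s : 0 ≺ s -> pre s s.
Proof. by move=> H; apply/preE; split=> //; exists 0; rewrite anc0. Qed.
Lemma pre_trans r s t : pre r s -> pre s t -> pre r t.
Proof.
move=> [H [j [_ E]]] [_ [i [_ E']]]; apply/preE; split=> //.
by exists (i + j); rewrite ancD -E'.
Qed.
Lemma pre_lh t s : pre t s -> lh t ⪯ lh s.
Proof. by move=> [H [j [_ E]]]; rewrite E in H *; rewrite -(anc_lh H); apply: leN_addr. Qed.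
Lemma pre_eq t s : pre t s -> lh s ⪯ lh t -> t = s.
Proof.
move=> [H [j [_ E]]]; rewrite E in H *; rewrite -(anc_lh H) => L.
have E0 : j = 0 by nlra.
by rewrite E0 anc0.
Qed.
Lemma pre_comparable t t' s : pre t s -> pre t' s -> lh t ⪯ lh t' -> pre t t'.
Proof.
move=> [H [j [_ E]]] [H' [j' [_ E']]] L; apply/preE; split=> //.
have : j' ⪯ j.
  move: L; rewrite E E'; move: (H) (H'); rewrite E E' => {}H {}H'.
  by have := anc_lh H; have := anc_lh H'; move: (lh _) (lh _) (lh _) => a b c *; nlra.
by case/leN_subE => d Ed; exists d; rewrite E E' -ancD Ed.
Qed.
Definition kid s k : Prop := k = s + s \/ k = s + s + 1.
Lemma kid_hlf s k : kid s k -> hlf k = s.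
Proof. exact: hlf_unique. Qed.
Lemma kid_gt0 s k : 0 ≺ s -> kid s k -> 0 ≺ k.
Proof. by move=> H [->|->]; nlra. Qed.
Lemma kid_lh s k : 0 ≺ s -> kid s k -> lh k = lh s + 1.
Proof. by move=> H [->|->]; [apply: lh0|apply: lh1]. Qed.
Lemma pre_kid s k t : 0 ≺ s -> kid s k -> pre t k <-> t = k \/ pre t s.
Proof.
move=> Hs Hk; rewrite !preE; split=> [[H [j E]]|[->|[H [j E]]]].
- case: (leN0 j) => [Hj|E0]; last by left; rewrite E -E0 anc0.
  right; split=> //; have /leN_subE[i Ei] := ltN_ge1 Hj.
  by exists i; rewrite E -Ei ancD -{1}[1]add0r ancS anc0 (kid_hlf Hk).
- by split; [apply: kid_gt0 Hk|exists 0; rewrite anc0].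
- by split=> //; exists (1 + j); rewrite ancD -{1}[1]add0r ancS anc0 (kid_hlf Hk).
Qed.
Lemma pre_split s t : pre s t -> s <> t -> exists k, kid s k /\ pre k t.
Proof.
move=> [H [j [_ E]]] C; case: (leN0 j) => [Hj|E0]; last by case: C; rewrite E -E0 anc0.
have [i Ei] : exists i, i + 1 = j by have /leN_subE[i <-] := ltN_ge1 Hj; exists i; ring.
move: E; rewrite -Ei ancS => E; exists (anc t i); split; first by rewrite E; apply: hlfP.
by apply/preE; split; [rewrite E in H; apply: hlf_gt0 H|exists i].
Qed.
Lemma kid_pre s k : 0 ≺ s -> kid s k -> pre s k.
Proof. by move=> Hs Hk; apply/(pre_kid _ Hs Hk); right; apply: pre_refl. Qed.

Lemma sproper_prefixE t s : 0 ≺ t -> sproper_prefix t s <-> t <> s /\ pre t s.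
Proof.
move=> Ht; split=> [[C [k [p [r [/sexp2E -> H]]]]]|[C /preE[_ [j E]]]]; split=> //.
- by apply/preE; split=> //; exists k; apply/anc_mod; exists r.
- by have [r Hr] := proj1 (anc_mod s j t) E; exists j, (pow2 j), r; split=> //; apply/sexp2E.
Qed.

Definition rs (X : set_of M) n : N := prec 1 (fun i v => ite (inS i X) (v + v + 1) (v + v)) n.
Lemma rs_comp2 Z X : CP Z (fun x => inS x X) -> Comp2 Z (fun i v => ite (inS i X) (v + v + 1) (v + v)).
Proof. by move=> H; comp. Qed.
Lemma oracle_self X : CP X (fun x => inS x X). Proof. by apply: CP_oracle; comp. Qed.
Lemma rs0 X : rs X 0 = 1.
Proof. by rewrite /rs (@prec0 _ X) //; apply: rs_comp2; apply: oracle_self. Qed.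
Lemma rsS X n : rs X (n + 1) = ite (inS n X) (rs X n + rs X n + 1) (rs X n + rs X n).
Proof. by rewrite /rs (@precS _ X) //; apply: rs_comp2; apply: oracle_self. Qed.
Lemma Comp_rs Z X (f : N -> N) : CP Z (fun x => inS x X) -> Comp Z f -> Comp Z (fun x => rs X (f x)).
Proof. by move=> HX Hf; rewrite /rs; comp. Qed.
Lemma Comp_rs_self X (f : N -> N) : Comp X f -> Comp X (fun x => rs X (f x)).
Proof. by apply: Comp_rs; apply: oracle_self. Qed.
Lemma rs_kid X n : kid (rs X n) (rs X (n + 1)).
Proof. by rewrite rsS /ite; case: pselect; [right|left]. Qed.
Lemma srestrE X n s : srestr X n s <-> s = rs X n.
Proof.
apply: (prim_rec_eq (Z := X)) => [|u|i u]; rewrite ?rs0 //; first by apply: Comp_rs_self; comp.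
rewrite rsS; have [H|H] := pselect (inS i X); [rewrite iteT //|rewrite iteF //].
- by split=> [[[]|[]]|->] //; left.
- by split=> [[[]|[]]|->] //; right.
Qed.
Lemma rs_gt0 X n : 0 ≺ rs X n.
Proof.
have D : CP X (fun n => 0 ≺ rs X n) by comp; apply: Comp_rs_self; comp.
apply: (cp_ind D) n => [|n IH]; first by rewrite rs0; exact: ltN01.
exact: kid_gt0 IH (rs_kid X n).
Qed.
Lemma lh_rs X n : lh (rs X n) = n.
Proof.
have D : CP X (fun n => lh (rs X n) = n) by comp; apply: Comp_rs_self; comp.
apply: (cp_ind D) n => [|n IH]; first by rewrite rs0 lh_one.
by rewrite (kid_lh (rs_gt0 X n) (rs_kid X n)) IH.
Qed.
Lemma pre_rs X m n : m ⪯ n -> pre (rs X m) (rs X n).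
Proof.
case/leN_subE=> d <-; have D : CP X (fun d => pre (rs X m) (rs X (m + d))).
  by apply: CP_pre; apply: Comp_rs_self; comp.
apply: (cp_ind D) d => [|d IH]; first by rewrite addr0; apply: pre_refl; apply: rs_gt0.
apply: pre_trans IH _; rewrite addrA; apply: kid_pre (rs_gt0 _ _) (rs_kid _ _).
Qed.
Lemma rs_pre X t n : pre t (rs X n) -> t = rs X (lh t).
Proof.
move=> H; have L := pre_lh H; rewrite lh_rs in L.
apply: pre_eq; last by rewrite lh_rs; right.
by apply: pre_comparable H (pre_rs X L) _; rewrite lh_rs; right.
Qed.
End Powers.

Ltac comp_string ::= lazymatch goal with
  | |- Comp _ (fun x => pow2 _) => apply: Comp_pow2
  | |- Comp _ (fun x => hlf _) => apply: Comp_hlf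
  | |- Comp _ (fun x => lh _) => apply: Comp_lh
  | |- Comp _ (fun x => anc _ _) => apply: Comp_anc
  | |- CP _ (fun x => pre _ _) => apply: CP_pre
  | |- CQ _ (fun x => ksum _ _) => apply: CQ_ksum
  end.

Section SumLemmas.
Variables (M : model) (Z : set_of M).
Local Notation N := (carrier M).
Local Notation K := (ratio M).
Implicit Types (i j m n : N) (F G : N -> K) (k : K).

Lemma ksum_le F G n : CQ Z F -> CQ Z G -> (forall i, i ≺ n -> F i <= G i) -> ksum F n <= ksum G n.
Proof.
move=> HF HG H.
have D : CP Z (fun m => m ⪯ n -> ksum F m <= ksum G m) by comp.
suff R : forall m, m ⪯ n -> ksum F m <= ksum G m by apply: R; right.
apply: (cp_ind D) => [_|m IH L]; first by rewrite !(@ksum0 _ Z).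
by rewrite (ksumS m HF) (ksumS m HG); apply: lerD; [apply: IH|apply: H]; nlra.
Qed.
Lemma ksum_eq F G n : CQ Z F -> CQ Z G -> (forall i, i ≺ n -> F i = G i) -> ksum F n = ksum G n.
Proof.
by move=> HF HG H; apply/le_anti/andP; split; apply: ksum_le => // i L; rewrite H.
Qed.
Lemma ksum_const0 n : ksum (fun _ => 0) n = 0 :> K.
Proof.
have H : CQ Z (fun _ => 0) by comp.
have D : CP Z (fun m => ksum (fun _ => 0) m = 0 :> K) by apply: CP_eqK; comp.
by apply: (cp_ind D) n => [|m IH]; [rewrite (ksum0 H)|rewrite (ksumS m H) IH addr0].
Qed.
Lemma ksum_ge0 F n : CQ Z F -> (forall i, i ≺ n -> 0 <= F i) -> 0 <= ksum F n.
Proof. by move=> HF H; rewrite -(ksum_const0 n); apply: ksum_le => //; comp. Qed.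
Lemma ksum_zero F n : CQ Z F -> (forall i, i ≺ n -> F i = 0) -> ksum F n = 0.
Proof. by move=> HF H; rewrite -(ksum_const0 n); apply: ksum_eq => //; comp. Qed.
Lemma ksumD F G n : CQ Z F -> CQ Z G -> ksum (fun i => F i + G i) n = ksum F n + ksum G n.
Proof.
move=> HF HG; have H : CQ Z (fun i => F i + G i) by comp.
have D : CP Z (fun m => ksum (fun i => F i + G i) m = ksum F m + ksum G m) by apply: CP_eqK; comp.
apply: (cp_ind D) n => [|m IH]; first by rewrite !(@ksum0 _ Z) // addr0.
by rewrite (ksumS m H) (ksumS m HF) (ksumS m HG) IH; ring.
Qed.
Lemma ksumM k F n : CQ Z F -> ksum (fun i => k * F i) n = k * ksum F n.
Proof.
move=> HF; have H : CQ Z (fun i => k * F i) by comp.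
have D : CP Z (fun m => ksum (fun i => k * F i) m = k * ksum F m) by apply: CP_eqK; comp.
apply: (cp_ind D) n => [|m IH]; first by rewrite !(@ksum0 _ Z) // mulr0.
by rewrite (ksumS m H) (ksumS m HF) IH; ring.
Qed.
Lemma ksum_single F j n : CQ Z F -> (forall i, i ≺ n -> i <> j -> F i = 0) -> j ≺ n -> ksum F n = F j.
Proof.
move=> HF H Hj.
have D : CP Z (fun m => m ⪯ n -> ksum F m = ite (j ≺ m) (F j) 0).
  by apply: CP_imp; [comp|apply: CP_eqK; comp].
suff R : forall m, m ⪯ n -> ksum F m = ite (j ≺ m) (F j) 0 by rewrite R ?iteT //; right.
apply: (cp_ind D) => [_|m IH L]; first by rewrite (@ksum0 _ Z) // iteF // => ?; nlra.
rewrite (ksumS m HF) IH; last by nlra.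
case: (ltN_cmp j m) => C.
- rewrite !iteT //; last by nlra.
  rewrite (H m) ?addr0 //; first by nlra.
  by move=> E; rewrite E in C; case: (ltNn C).
- by rewrite C iteF ?iteT ?add0r //; [nlra|exact: ltNn].
- rewrite !iteF; try by move=> ?; nlra.
  rewrite (H m) ?addr0 //; first by nlra.
  by move=> E; rewrite E in C; case: (ltNn C).
Qed.
End SumLemmas.

(** * Conditional measure and Kolmogorov's inequality *)

Section Measure.
Variable M : model.
Local Notation N := (carrier M).
Local Notation K := (ratio M).
Local Notation Z0 := (inh M).
Implicit Types (x y z n a b c i j u v s t r : N) (Z : set_of M).

Definition ip2 n : K := (iota (pow2 n))^-1.
Lemma ip_gt0 n : 0 < iota (pow2 n). Proof. by apply: iota_gt0; apply: pow2_gt0. Qed.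
Lemma ip2_gt0 n : 0 < ip2 n. Proof. by rewrite invr_gt0 ip_gt0. Qed.
Lemma ip20 : ip2 0 = 1. Proof. by rewrite /ip2 pow20 iota1 invr1. Qed.
Lemma ip2S n : ip2 n = 2 * ip2 (n + 1).
Proof.
have := ip_gt0 n; rewrite /ip2 pow2S iotaD => H.
by field; rewrite gt_eqF //; lra.
Qed.
Lemma ip2D m n : ip2 (m + n) = ip2 m * ip2 n.
Proof. by rewrite /ip2 pow2D iotaM invfM. Qed.
Lemma ip2_pow n : iota (pow2 n) * ip2 n = 1.
Proof. by rewrite /ip2 mulfV // gt_eqF // ip_gt0. Qed.
Lemma CQ_ip2 Z (f : N -> N) : Comp Z f -> CQ Z (fun x => ip2 (f x)).
Proof. by move=> Hf; rewrite /ip2; comp. Qed.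

(** The conditional measure of the cylinder of [r] given the cylinder of [s]. *)
Definition wt r s : K := ite (pre r s) 1 (ite (pre s r) (iota (pow2 (lh s)) * ip2 (lh r)) 0).
Lemma CQ_wt Z (f g : N -> N) : Comp Z f -> Comp Z g -> CQ Z (fun x => wt (f x) (g x)).
Proof. by move=> Hf Hg; rewrite /wt; comp; apply: CQ_ip2; comp. Qed.
Lemma wt_up r s : pre r s -> wt r s = 1. Proof. exact: iteT. Qed.
Lemma wt_down r s : pre s r -> wt r s = iota (pow2 (lh s)) * ip2 (lh r).
Proof.
move=> H; rewrite /wt; have [H'|H'] := pselect (pre r s); last by rewrite iteF // iteT.
by rewrite iteT // (pre_eq H (pre_lh H')) ip2_pow.
Qed.
Lemma wt_none r s : ~ pre r s -> ~ pre s r -> wt r s = 0.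
Proof. by move=> H H'; rewrite /wt !iteF. Qed.
Lemma wt_ge0 r s : 0 <= wt r s.
Proof.
have [H|H] := pselect (pre r s); first by rewrite wt_up.
have [H'|H'] := pselect (pre s r); last by rewrite wt_none.
by rewrite wt_down // mulr_ge0 // ltW // ?ip_gt0 ?ip2_gt0.
Qed.
Lemma kid_disjoint s k k' r : 0 ≺ s -> kid s k -> kid s k' -> k <> k' -> pre k r -> ~ pre k' r.
Proof.
move=> Hs Hk Hk' C H H'; apply: C.
have E : lh k = lh k' by rewrite (kid_lh Hs Hk) (kid_lh Hs Hk').
by apply: pre_eq; [apply: pre_comparable H H' _|]; rewrite E; right.
Qed.
Lemma kid_weight r s k k' : 0 ≺ s -> kid s k -> kid s k' -> k <> k' -> ~ pre r s -> pre k r ->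
  wt r k + wt r k' = 2 * wt r s.
Proof.
move=> Hs Hk Hk' C H Hkr; have Hsr := pre_trans (kid_pre Hs Hk) Hkr.
rewrite (wt_down Hkr) (wt_down Hsr) wt_none; last first.
- exact: (kid_disjoint Hs Hk Hk' C Hkr).
- move=> /(pre_kid _ Hs Hk')[E|//]; have := kid_disjoint Hs Hk Hk' C Hkr; apply.
  by rewrite E; apply: pre_refl; apply: kid_gt0 Hk'.
- by rewrite (kid_lh Hs Hk) pow2S iotaD; ring.
Qed.
Lemma wt_mart r s : 0 ≺ s -> wt r (s + s) + wt r (s + s + 1) = 2 * wt r s.
Proof.
move=> Hs; have K0 : kid s (s + s) by left.
have K1 : kid s (s + s + 1) by right.
have C : s + s <> s + s + 1 by move=> E; nlra.
have [H|H] := pselect (pre r s).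
  by rewrite !wt_up; [ring| |apply/(pre_kid _ Hs K1); right|apply/(pre_kid _ Hs K0); right].
have [H'|H'] := pselect (pre s r); last first.
  rewrite !wt_none ?mulr0 ?addr0 //.
  - by move=> /(pre_kid _ Hs K1)[E|//]; apply: H'; rewrite E; apply: kid_pre.
  - by move=> Hp; apply: H'; apply: pre_trans (kid_pre Hs K1) Hp.
  - by move=> /(pre_kid _ Hs K0)[E|//]; apply: H'; rewrite E; apply: kid_pre.
  - by move=> Hp; apply: H'; apply: pre_trans (kid_pre Hs K0) Hp.
have Hsr : s <> r by move=> E; apply: H; rewrite -E; apply: pre_refl.
have [k [[->|->] Hk]] := pre_split H' Hsr; first exact: (kid_weight Hs K0 K1 C H Hk).
by rewrite addrC; apply: (kid_weight Hs K1 K0 _ H Hk) => E; apply: C.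
Qed.

Definition nmin j c : Prop := smem j c /\ ~ exists t, t ≺ c /\ (smem t c /\ (t <> j /\ pre t j)).
Lemma CP_nmin Z (f g : N -> N) : Comp Z f -> Comp Z g -> CP Z (fun x => nmin (f x) (g x)).
Proof. by move=> Hf Hg; rewrite /nmin; comp. Qed.
Lemma nminP j c t : nmin j c -> smem t c -> pre t j -> t = j.
Proof.
move=> [_ H] Ht Hp; apply: contrapT => C; apply: H; exists t; split=> //; exact: smem_lt.
Qed.
Definition mterm c s j : K := ite (nmin j c) (wt j s) 0.
Lemma CQ_mterm Z (f g h : N -> N) : Comp Z f -> Comp Z g -> Comp Z h ->
  CQ Z (fun x => mterm (f x) (g x) (h x)).
Proof.
move=> *; rewrite /mterm; apply: CQ_ite; [apply: CP_nmin|apply: CQ_wt|comp] => //.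
Qed.
Lemma CQ_mterm1 Z c s : CQ Z (mterm c s).
Proof. by apply: (CQ_mterm (f := fun _ => c) (g := fun _ => s)); comp. Qed.
(** The conditional measure of the cylinders of [c] given that of [s]; for [s = 1], the empty
    string, it is the measure itself. Members of [c] are below [c], so the sum meets them all. *)
Definition mu c s : K := ksum (mterm c s) c.
Lemma CQ_mu Z (f g : N -> N) : Comp Z f -> Comp Z g -> CQ Z (fun x => mu (f x) (g x)).
Proof. by move=> *; rewrite /mu; apply: CQ_ksum => //; apply: CQ_mterm; comp. Qed.

Lemma mterm_min c s j : nmin j c -> mterm c s j = wt j s. Proof. exact: iteT. Qed.
Lemma mterm_not c s j : ~ nmin j c -> mterm c s j = 0. Proof. exact: iteF. Qed.
Lemma mterm_ge0 c s j : 0 <= mterm c s j.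
Proof.
by have [H|H] := pselect (nmin j c); [rewrite mterm_min // wt_ge0|rewrite mterm_not].
Qed.
Lemma mu_ge0 c s : 0 <= mu c s.
Proof. by apply: (ksum_ge0 (Z := Z0)) => [|i _]; [apply: CQ_mterm1|apply: mterm_ge0]. Qed.
Lemma mu_mart c s : 0 ≺ s -> mu c (s + s) + mu c (s + s + 1) = 2 * mu c s.
Proof.
move=> Hs; rewrite /mu -(ksumD (Z := Z0)) ?CQ_mterm1 //; try exact: CQ_mterm1.
rewrite -(ksumM (Z := Z0)); last exact: CQ_mterm1.
have H0 := CQ_mterm1 Z0 c (s + s); have H1 := CQ_mterm1 Z0 c (s + s + 1); have H2 := CQ_mterm1 Z0 c s.
apply: (ksum_eq (Z := Z0)) => [||i _]; try by comp.
have [H|H] := pselect (nmin i c); last by rewrite !mterm_not // mulr0 addr0.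
by rewrite !mterm_min //; apply: wt_mart.
Qed.
Lemma mu_zero c s : (forall r, smem r c -> ~ pre r s /\ ~ pre s r) -> mu c s = 0.
Proof.
move=> H; apply: (ksum_zero (Z := Z0)) => [|i _]; first exact: CQ_mterm1.
have [Hi|Hi] := pselect (nmin i c); last by rewrite mterm_not.
by rewrite mterm_min //; have [? ?] := H i (proj1 Hi); apply: wt_none.
Qed.
Lemma min_prefix c s r : smem r c -> pre r s -> exists j, nmin j c /\ pre j s.
Proof.
move=> Hr Hp.
have D : CP Z0 (fun n => exists j, j ≺ c /\ (smem j c /\ (pre j s /\ lh j = n))) by comp.
have [|n [[j [Lj [Hj [Hjs Ej]]]] Hn]] := cp_least D.
  by exists (lh r), r; split=> //; exact: smem_lt.
exists j; split=> //; split=> // -[t [Lt [Ht [C Htj]]]].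
apply: (Hn (lh t)); last by exists t; split=> //; split=> //; split=> //; apply: pre_trans Hjs.
have := pre_lh Htj; rewrite Ej => -[//|E]; case: C; apply: pre_eq Htj _.
by rewrite E Ej; right.
Qed.
(** Prefixes of [s] are comparable, so exactly one minimal string is a prefix of [s]; the other
    minimal strings are incomparable with [s] and weigh 0. *)
Lemma mu_one c s r : smem r c -> pre r s -> mu c s = 1.
Proof.
move=> Hr Hp; have [j [Hj Hjs]] := min_prefix Hr Hp.
rewrite /mu (ksum_single (Z := Z0) (j := j)); last exact: smem_lt (proj1 Hj).
- by rewrite mterm_min // wt_up.
- exact: CQ_mterm1.
- move=> i Li C; have [Hi|Hi] := pselect (nmin i c); last by rewrite mterm_not.
  rewrite mterm_min // wt_none // => H; apply: C.
  + case: (leN_total (lh i) (lh j)) => L.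
    * by apply: (nminP Hj) (proj1 Hi) _; apply: pre_comparable H Hjs L.
    * by apply/esym; apply: (nminP Hi) (proj1 Hj) _; apply: pre_comparable Hjs H L.
  + by apply/esym; apply: (nminP Hi) (proj1 Hj) _; apply: pre_trans Hjs H.
Qed.

Definition supermart (B : N -> K) : Prop :=
  (forall s, 0 ≺ s -> B (s + s) + B (s + s + 1) <= 2 * B s) /\ forall s, 0 ≺ s -> 0 <= B s.
Lemma mu_supermart c : supermart (mu c).
Proof. by split=> s Hs; [rewrite mu_mart|apply: mu_ge0]. Qed.

(* Kolmogorov's inequality, by downward induction on the length of [s] starting
   from a length exceeding those of all strings in [c]. *)
Lemma kolmogorov Z c (B : N -> K) (l : K) : CQ Z B -> supermart B -> 0 <= l ->
  (forall r, smem r c -> 0 ≺ r) -> (forall r, smem r c -> l <= B r) ->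
  forall s, 0 ≺ s -> (forall r, smem r c -> r <> s -> ~ pre r s) -> l * mu c s <= B s.
Proof.
move=> HB [HS H0] Hl Hc Hlc.
have top s : 0 ≺ s -> c ⪯ lh s -> (forall r, smem r c -> r <> s -> ~ pre r s) -> l * mu c s <= B s.
  move=> Hs Ls Hr; rewrite mu_zero ?mulr0 ?H0 // => r Hrc.
  have L1 := lh_lt_self (Hc r Hrc); have L2 := smem_lt Hrc.
  have L3 : lh r ≺ lh s by move: (lh r) (lh s) L1 L2 Ls => *; nlra.
  split=> Hp; last by have := pre_lh Hp => ?; apply: (ltNn (x := lh r)); nlra.
  by apply: (Hr r Hrc) Hp => E; rewrite E in L3; apply: (ltNn L3).
(* [d] is the distance of the length of [s] from [c]. The bounds on [s] and [r] make the induction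
   statement decidable in [Z]. *)
have D : CP Z (fun d => forall s, s ≺ pow2 (c + 1) -> 0 ≺ s -> lh s + d = c ->
    (forall r, r ≺ c -> smem r c -> r <> s -> ~ pre r s) -> l * mu c s <= B s).
  by comp; apply: CQ_mu; comp.
have main d : forall s, 0 ≺ s -> lh s + d = c ->
    (forall r, smem r c -> r <> s -> ~ pre r s) -> l * mu c s <= B s.
  suff R d' : forall s, s ≺ pow2 (c + 1) -> 0 ≺ s -> lh s + d' = c ->
      (forall r, r ≺ c -> smem r c -> r <> s -> ~ pre r s) -> l * mu c s <= B s.
    move=> s Hs E Hr; apply: (R d) => //; last by move=> r _; apply: Hr.
    have := lh_lt s; have : pow2 (lh s + 1) ⪯ pow2 (c + 1) by apply: pow2_mono; nlra.
    by move: (pow2 _) (pow2 _) => p q *; nlra.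
  apply: (cp_ind D) d' => [s _ Hs E Hr|d' IH s _ Hs E Hr].
    apply: top => //; first by right; rewrite -E addr0.
    by move=> r Hrc; apply: Hr => //; exact: smem_lt.
  have [Hsc|Hsc] := pselect (smem s c).
    by rewrite (mu_one Hsc (pre_refl Hs)) mulr1; apply: Hlc.
  have kids k : kid s k -> l * mu c k <= B k.
    move=> Hk; apply: IH; [|exact: kid_gt0 Hk|rewrite (kid_lh Hs Hk) -E; ring|].
    - have := lh_lt k; rewrite (kid_lh Hs Hk).
      have : pow2 (lh s + 1 + 1) ⪯ pow2 (c + 1) by apply: pow2_mono; nlra.
      by move: (pow2 _) (pow2 _) => p q *; nlra.
    - move=> r Lr Hrc C /(pre_kid _ Hs Hk)[//|Hrs].
      by apply: (Hr r Lr Hrc) Hrs => Er; apply: Hsc; rewrite -Er.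
  have K0 : l * mu c (s + s) <= B (s + s) by apply: kids; left.
  have K1 : l * mu c (s + s + 1) <= B (s + s + 1) by apply: kids; right.
  have E2 : l * mu c (s + s) + l * mu c (s + s + 1) = 2 * (l * mu c s).
    by rewrite -mulrDr (mu_mart c Hs); ring.
  by move: (HS s Hs) K0 K1 E2; clear; lra.
move=> s Hs Hr; case: (leN_total c (lh s)) => [L|/leN_subE[d E]]; first exact: top.
exact: (main d).
Qed.

(** Kolmogorov's inequality at level 1 for the martingale [mu c'], which is 1 at every string of
    [c]. It applies unless a string of [c] is a prefix of [s], and then both measures are 1. *)
Lemma mu_mono c c' s : (forall r, smem r c -> 0 ≺ r) -> 
  (forall r, smem r c -> exists r', smem r' c' /\ pre r' r) -> 0 ≺ s -> mu c s <= mu c' s.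
Proof.
move=> Hc H Hs.
have [[r [Hr Hp]]|C] := pselect (exists r, smem r c /\ pre r s).
  have [r' [Hr' Hp']] := H r Hr.
  by rewrite (mu_one Hr Hp) (mu_one Hr' (pre_trans Hp' Hp)).
rewrite -[mu c s]mul1r; apply: (kolmogorov (Z := Z0)) => //.
- by apply: CQ_mu; comp.
- exact: mu_supermart.
- by move=> r Hr; have [r' [Hr' Hp']] := H r Hr; rewrite (mu_one Hr' Hp').
- by move=> r Hr _ Hp; apply: C; exists r.
Qed.

(** Capital at most doubles in one step, because the capital at the sibling is nonnegative. *)
Lemma supermart_growth Z (B : N -> K) s : CQ Z B -> supermart B -> 0 ≺ s ->
  B s <= iota (pow2 (lh s)) * B 1.
Proof.
move=> HB [HS H0] Hs.
have D : CP Z (fun n => forall s, s ≺ pow2 (n + 1) -> 0 ≺ s -> lh s = n -> B s <= iota (pow2 n) * B 1).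
  by comp.
apply: ((cp_ind D _ _ (lh s)) s (lh_lt s)) => // {s Hs} [s _ Hs E|n IH s _ Hs E].
  have -> : s = 1.
    have := lh_lt s; rewrite E pow2S pow20 => L; case: (ltN_ge1 Hs) => // L'; nlra.
  by rewrite pow20 iota1 mul1r.
have Hk : kid (hlf s) s by exact: hlfP.
have Hh : 0 ≺ hlf s.
  case: (leN0 (hlf s)) => // E0; exfalso; move: Hk; rewrite -E0 /kid addr0 add0r => -[Es|Es].
  - by rewrite Es in Hs; exact: (ltNn Hs).
  - by rewrite Es lh_one in E; nlra.
have En : lh (hlf s) = n by move: E; rewrite (kid_lh Hh Hk) => /addNI.
have := IH (hlf s); rewrite En => /(_ _ Hh erefl) {}IH.
have {}IH : B (hlf s) <= iota (pow2 n) * B 1 by apply: IH; rewrite -En; apply: lh_lt.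
have G : B s <= 2 * B (hlf s).
  move: (hlf s) Hk Hh => h Hk Hh.
  have HB0 : 0 <= B (h + h) by apply: H0; apply: (kid_gt0 Hh); left.
  have HB1 : 0 <= B (h + h + 1) by apply: H0; apply: (kid_gt0 Hh); right.
  move: (HS _ Hh) HB0 HB1; case: Hk => ->; clear; lra.
by rewrite pow2S iotaD mulrDl; move: G IH; clear; lra.
Qed.
End Measure.

Ltac comp_measure := lazymatch goal with
  | |- Comp _ (fun x => pow2 _) => apply: Comp_pow2
  | |- Comp _ (fun x => hlf _) => apply: Comp_hlf
  | |- Comp _ (fun x => lh _) => apply: Comp_lh
  | |- Comp _ (fun x => anc _ _) => apply: Comp_anc
  | |- CP _ (fun x => pre _ _) => apply: CP_pre
  | |- CP _ (fun x => nmin _ _) => apply: CP_nmin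
  | |- CP _ (fun x => isq _) => apply: CP_isq
  | |- CQ _ (fun x => ip2 _) => apply: CQ_ip2
  | |- CQ _ (fun x => mu _ _) => apply: CQ_mu
  | |- CQ _ (fun x => mterm _ _ _) => apply: CQ_mterm
  | |- CQ _ (fun x => ksum _ _) => apply: CQ_ksum
  end.
Ltac comp_string ::= comp_measure.

(** * The formal measure of a coded finite set *)

Section FiniteMeasure.
Variable M : model.
Local Notation N := (carrier M).
Local Notation K := (ratio M).
Local Notation Z0 := (inh M).
Implicit Types (c i j u v s r : N) (t : frac M).

Definition strings c : Prop := forall r, smem r c -> 0 ≺ r.

Lemma sminimalE c j : strings c -> sminimal j c <-> nmin j c.
Proof.
move=> Hc; split=> -[H1 H2]; split=> // -[t].
- move=> [_ [Ht Hp]]; apply: H2; exists t; split=> //.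
  by apply/sproper_prefixE => //; apply: Hc.
- move=> [Ht /(sproper_prefixE _ (Hc _ Ht)) Hp]; apply: H2; exists t; split=> //.
  exact: smem_lt.
Qed.
Lemma pre1 s : 0 ≺ s -> pre 1 s.
Proof.
move=> Hs; apply/preE; split; first exact: ltN01.
have [r E] := leN_subE (lh_le Hs); exists (lh s); apply/anc_mod; exists r.
split; last by rewrite mul1r E.
by have := lh_lt s; rewrite pow2S; move: (pow2 (lh s)) E => p *; nlra.
Qed.
Lemma wt1 r : 0 ≺ r -> wt r 1 = ip2 (lh r).
Proof. by move=> Hr; rewrite wt_down ?lh_one ?pow20 ?iota1 ?mul1r //; exact: pre1. Qed.

Definition psum c j : K := ksum (mterm c 1) j.
Lemma psum0 c : psum c 0 = 0. Proof. exact: (ksum0 (CQ_mterm1 Z0 c 1)). Qed.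
Lemma psumS c j : psum c (j + 1) = psum c j + mterm c 1 j.
Proof. exact: (ksumS j (CQ_mterm1 Z0 c 1)). Qed.

Lemma fin_measure_step c j (t1 t2 : frac M) : strings c -> fvalid t1 -> fvalid t2 ->
  (sminimal j c /\ exists l p, slen j l /\ sexp2 l p /\ sreq t2 (sradd t1 (srinv p))) \/
    (~ sminimal j c /\ sreq t2 t1) <->
  qv t2 = qv t1 + mterm c 1 j.
Proof.
move=> Hc V1 V2; rewrite (sminimalE j Hc).
have R (a b : frac M) : fvalid a -> fvalid b -> sreq a b <-> qv a = qv b.
  move=> Va Vb; rewrite /sreq !srleE //; split=> [[H1 H2]|->] //.
  by apply/le_anti/andP.
have [H|H] := pselect (nmin j c); last first.
  by rewrite mterm_not // addr0 R //; split=> [[[]|[]]|] //; right.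
have Hj := Hc _ (proj1 H).
rewrite mterm_min // wt1 //.
have Vp : fvalid (srinv (pow2 (lh j))) by exact: pow2_gt0.
have E : qv (sradd t1 (srinv (pow2 (lh j)))) = qv t1 + ip2 (lh j) by rewrite qv_sradd // qv_srinv.
split=> [[[_ [l [p [/(slenE l Hj) -> [/sexp2E -> Hr]]]]]|[]//]|Hq].
- by rewrite -E; apply/R => //; apply: sradd_valid.
- left; split=> //; exists (lh j), (pow2 (lh j)).
  split; first exact/slenE.
  by split; [apply/sexp2E|apply/R; rewrite ?E //; apply: sradd_valid].
Qed.

(** A formal computation may write any code of each partial sum, so only the values of the codes are
    determined, and the induction follows these. *)
Lemma fin_measure_mu c t : strings c -> fvalid t -> sfin_measure c t -> qv t = mu c 1.
Proof.
move=> Hc V [d [Hm HJ]].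
have D : CP Z0 (fun j => forall u, u ≺ d -> smem (spr j u) d -> isq u /\ qval u = psum c j).
  by rewrite /psum; comp.
have R j : forall u, u ≺ d -> smem (spr j u) d -> isq u /\ qval u = psum c j.
  apply: (cp_ind D) j => [u _ /HJ|j IH u _ /HJ].
  - move=> [[_ [t' [V' [-> [H1 H2]]]]]|[j [v [E _]]]]; last by nlra.
    split; first by exists t'.
    move: H1 H2; rewrite psum0 qval_scode !srleE //; try exact: srnat_valid.
    by rewrite qv_srnat iota0 => H1 H2; apply/le_anti/andP.
  - move=> [[E _]|[i [v [E [Hv [t1 [V1 [t2 [V2 [E1 [E2 Hs]]]]]]]]]]]; first by nlra.
    have Eij := addNI E; subst i.
    have [|_ Hq] := IH v _ Hv; first by apply: leN_ltN_trans (smem_lt Hv); apply: spr_ler.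
    rewrite E2 qval_scode psumS -Hq E1 qval_scode; split; first by exists t2.
    exact/fin_measure_step.
have [|_ H] := R c (scode t) _ Hm; first by apply: leN_ltN_trans (smem_lt Hm); apply: spr_ler.
by rewrite -(qval_scode t) H.
Qed.

Lemma mu_fin_measure c : strings c -> exists t, [/\ fvalid t, qv t = mu c 1, scode t = qc (mu c 1) & sfin_measure c t].
Proof.
move=> Hc; have [t [V Et]] := qc_isq (mu c 1).
exists t; split=> //; first by rewrite -(qval_scode t) -Et qcK.
pose h j := qc (psum c j).
have Hh : Comp Z0 h by rewrite /h /psum; comp.
rewrite /sfin_measure -Et -[mu c 1]/(psum c c) -/(h c).
(* The recursion is run on canonical codes alone, by letting each step also demand [v = h i]. *)
have [_ /(_ erefl)] := prim_rec_eq (base := fun u => u = h 0)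
  (step := fun i v u => v = h i /\ u = h (i + 1)) Hh (fun _ => iff_refl _)
  (fun i u => conj (@proj2 _ _) (fun H => conj erefl H)) c (h c).
move=> [d [Hd HJ]]; exists d; split=> // i u /HJ [[-> ->]|[j [v [-> [Hv [Ev ->]]]]]]; [left|right].
- split=> //; have [t' [V' E']] := qc_isq (psum c 0); exists t'; split=> //; split=> //.
  have Q : qv t' = 0 by rewrite -(qval_scode t') -E' qcK psum0.
  by split; apply/srleE => //; rewrite ?Q ?qv_srnat ?iota0 //; exact: srnat_valid.
- exists j, v; split=> //; split=> //; rewrite Ev.
  have [t1 [V1 E1]] := qc_isq (psum c j); have [t2 [V2 E2]] := qc_isq (psum c (j + 1)).
  exists t1; split=> //; exists t2; split=> //; split=> //; split=> //.
  apply/fin_measure_step => //.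
  by rewrite -(qval_scode t1) -(qval_scode t2) -E1 -E2 !qcK psumS.
Qed.
End FiniteMeasure.

(** * Tests and supermartingales as computable functions *)

Section Tests.
Variables (M : model) (Z : set_of M).
Local Notation N := (carrier M).
Local Notation K := (ratio M).
Implicit Types (b c i j k l m n u v s r x y z : N) (t : frac M) (X F S R : set_of M).

Lemma open_seq_fun F : sopen_seq F -> CP Z (fun x => inS x F) -> exists B : N -> N -> N,
  [/\ Comp2 Z B, forall n i, strings (B n i) & forall n i b, inS (spr (spr n i) b) F <-> b = B n i].
Proof.
move=> HF HZ.
have H n i : exists b, inS (spr (spr n i) b) F /\ strings b /\ forall z, inS (spr (spr n i) z) F -> z = b.
  by apply: HF; exists n, i.
have D : CP2 Z (fun z b => inS (spr (spr (p1 z) (p2 z)) b) F) by comp.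
have [|m [Hm Hmin]] := Comp_least D.
  by move=> z; have [b [Hb _]] := H (p1 z) (p2 z); exists b.
have E n i : inS (spr (spr n i) (m (spr n i))) F by have [] := Hmin (spr n i); rewrite p1E p2E.
exists (fun n i => m (spr n i)); split; first by comp.
- by move=> n i; have [b [_ [Hb U]]] := H n i; rewrite (U _ (E n i)).
- move=> n i b; split=> [Hb|->]; last exact: E.
  by have [b' [_ [_ U]]] := H n i; rewrite (U _ Hb) (U _ (E n i)).
Qed.

Lemma uni_fun : exists w : N -> N -> N, Comp2 Z w /\
  forall c c' x, smem x (w c c') <-> smem x c \/ smem x c'.
Proof.
pose P z d := (forall x, x ≺ d -> smem x d -> smem x (p1 z) \/ smem x (p2 z)) /\
  (forall x, x ≺ p1 z -> smem x (p1 z) -> smem x d) /\ (forall x, x ≺ p2 z -> smem x (p2 z) -> smem x d).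
have D : CP2 Z P by rewrite /P; comp.
have PE z d : P z d <-> forall x, smem x d <-> smem x (p1 z) \/ smem x (p2 z).
  split=> [[H1 [H2 H3]] x|H].
    by split=> [Hx|[Hx|Hx]]; [apply: H1|apply: H2|apply: H3] => //; exact: smem_lt.
  by split=> [x _ /H //|]; split=> x _ Hx; apply/H; [left|right].
have [|m [Hm Hmin]] := Comp_least D.
  by move=> z; have [d Hd] := code_union (p1 z) (p2 z); exists d; apply/PE.
exists (fun c c' => m (spr c c')); split; first by comp.
by move=> c c' x; have [/PE H _] := Hmin (spr c c'); rewrite H p1E p2E.
Qed.

Lemma stages (B : N -> N -> N) : Comp2 Z B -> exists U : N -> N -> N, Comp2 Z U /\
  forall n m x, smem x (U n m) <-> exists i, i ⪯ m /\ smem x (B n i).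
Proof.
move=> HB; have [w [Hw Ew]] := uni_fun.
have [||U [HU U0 US]] := @Comp_rec _ Z (fun n => B n 0)
  (fun z => w (p2 (p2 z)) (B (p1 z) (p1 (p2 z) + 1))); try by comp.
exists U; split=> // n m x.
have D : CP Z (fun m => smem x (U n m) <-> exists i, i ≺ m + 1 /\ smem x (B n i)) by comp.
have E k : smem x (U n k) <-> exists i, i ≺ k + 1 /\ smem x (B n i).
  apply: (cp_ind D) k => [|k IH].
    rewrite U0; split=> [H|[i [L H]]]; first by exists 0; split=> //; nlra.
    by have <- : i = 0 by nlra.
  rewrite US !p1E !p2E p1E Ew IH; split=> [[[i [L H]]|H]|[i [L H]]].
  - by exists i; split=> //; nlra.
  - by exists (k + 1); split=> //; nlra.
  - have [Ei|C] := pselect (i = k + 1); first by right; rewrite -Ei.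
    left; exists i; split=> //; case: (ltN_cmp i (k + 1)) => // L'; exfalso; nlra.
by rewrite E; split=> -[i [L H]]; exists i; split=> //; nlra.
Qed.

Lemma mu_ext c c' s : strings c -> (forall x, smem x c <-> smem x c') -> 0 ≺ s -> mu c s = mu c' s.
Proof.
move=> Hc E Hs; have Hc' : strings c' by move=> r /E /Hc.
by apply/le_anti/andP; split; apply: mu_mono => // r Hr; exists r; split; try exact/E;
  apply: pre_refl; [apply: Hc|apply: Hc'].
Qed.

Lemma stage_measureP F (B U : N -> N -> N) :
  (forall n i, strings (B n i)) -> (forall n i b, inS (spr (spr n i) b) F <-> b = B n i) ->
  (forall n m x, smem x (U n m) <-> exists i, i ⪯ m /\ smem x (B n i)) ->
  [/\ forall n m, strings (U n m),
    forall n m t, fvalid t -> sstage_measure F n m t -> qv t = mu (U n m) 1 &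
    forall n m, exists t, [/\ fvalid t, qv t = mu (U n m) 1, scode t = qc (mu (U n m) 1) & sstage_measure F n m t]].
Proof.
move=> HB EF EU.
have HU n m : strings (U n m) by move=> r /EU [i [_ /HB]].
have E n m c : (forall s, smem s c <-> exists i b, i ⪯ m /\ inS (spr (spr n i) b) F /\ smem s b) <->
    (forall s, smem s c <-> smem s (U n m)).
  have R s : (exists i b, i ⪯ m /\ inS (spr (spr n i) b) F /\ smem s b) <-> smem s (U n m).
    rewrite EU; split=> [[i [b [L [/EF -> H]]]]|[i [L H]]]; first by exists i.
    by exists i, (B n i); split=> //; split=> //; apply/EF.
  by split=> H s; rewrite H R.
split=> // n m.
- move=> t V [c [/E Ec Hc]]; have Sc : strings c by move=> r /Ec /HU.
  rewrite (fin_measure_mu Sc V Hc); apply: mu_ext => //; exact: ltN01.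
- have [t [V Q Et Ht]] := mu_fin_measure (HU n m); exists t; split=> //.
  by exists (U n m); split=> //; apply/E.
Qed.

Lemma mart_set (B : N -> K) : CQ Z B -> supermart B -> exists S, [/\ ssupermartingale S, sleT S Z &
  forall X, (forall k, exists n, iota k < B (rs X n)) -> ssucceeds S X].
Proof.
move=> HB [HS H0].
have D : CP Z (fun y => p2 y = qc (B (p1 y)) /\ y = spr (p1 y) (p2 y)) by comp.
have [S ES] := CP_set D.
have E s y : inS (spr s y) S <-> y = qc (B s) by rewrite ES p1E p2E; split=> [[]|].
have Q s t : inS (spr s (scode t)) S -> qv t = B s by move=> /E H; rewrite -(qval_scode t) H qcK.
exists S; split.
- split=> [s Hs|s Hs t1 V1 t2 V2 t3 V3 /Q Q1 /Q Q2 /Q Q3].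
    exists (qc (B s)); split; first exact/E.
    split; last by move=> z /E.
    have [t [V Et]] := qc_isq (B s); exists t; split=> //; split=> //.
    apply/srleE => //; first exact: srnat_valid.
    by rewrite qv_srnat iota0 -(qval_scode t) -Et qcK H0.
  apply/srleE; try exact: sradd_valid.
  by rewrite !qv_sradd // Q1 Q2 Q3; move: (HS s Hs); clear; lra.
- by apply/CP_leT; apply: (CP_ext (P := fun y => p2 y = qc (B (p1 y)) /\ y = spr (p1 y) (p2 y))) => // x; rewrite ES.
- move=> X H k; have [n Hn] := H k; exists n, (rs X n); split; first exact/srestrE.
  have [t [V Et]] := qc_isq (B (rs X n)); exists t; split=> //; split; first by apply/E.
  apply/srltE => //; first exact: srnat_valid.
  by rewrite qv_srnat -(qval_scode t) -Et qcK.
Qed.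

Lemma mart_fun S : ssupermartingale S -> CP Z (fun x => inS x S) -> exists B : N -> K, [/\ CQ Z B, supermart B,
  forall s t, 0 ≺ s -> fvalid t -> inS (spr s (scode t)) S -> qv t = B s,
  forall s, 0 ≺ s -> exists t, [/\ fvalid t, qv t = B s & inS (spr s (scode t)) S] &
  forall X, ssucceeds S X -> forall k, exists n, iota k < B (rs X n)].
Proof.
move=> [HF HS] HZ.
(* At numbers that are not strings the condition is vacuous, which keeps the search total. *)
have D : CP2 Z (fun s y => 0 ≺ s -> inS (spr s y) S) by comp.
have [|m [Hm Hmin]] := Comp_least D.
  move=> s; have [Hs|Hs] := pselect (0 ≺ s); last by exists 0.
  by have [y [Hy _]] := HF s Hs; exists y.
have Em s : 0 ≺ s -> inS (spr s (m s)) S by move=> Hs; have [H _] := Hmin s; apply: H.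
have U s y : 0 ≺ s -> inS (spr s y) S -> y = m s.
  by move=> Hs Hy; have [y' [_ [_ Hu]]] := HF s Hs; rewrite (Hu _ Hy) (Hu _ (Em s Hs)).
have T s : 0 ≺ s -> exists t, [/\ fvalid t, m s = scode t & 0 <= qv t].
  move=> Hs; have [y [Hy [[t [V [Et Hl]]] _]]] := HF s Hs; exists t; split=> //.
    by rewrite -Et -(U s y).
  by move/srleE: Hl; rewrite qv_srnat iota0; apply => //; exact: srnat_valid.
exists (fun s => qval (m s)); split.
- by comp.
- split=> s Hs; last by have [t [V -> H]] := T s Hs; rewrite qval_scode.
  have Hs0 : 0 ≺ s + s by apply: (kid_gt0 Hs); left.
  have Hs1 : 0 ≺ s + s + 1 by apply: (kid_gt0 Hs); right.
  have [t1 [V1 E1 _]] := T _ Hs0; have [t2 [V2 E2 _]] := T _ Hs1; have [t3 [V3 E3 _]] := T _ Hs.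
  have := HS s Hs t1 V1 t2 V2 t3 V3; rewrite -E1 -E2 -E3 => /(_ (Em _ Hs0) (Em _ Hs1) (Em _ Hs)).
  move/srleE; rewrite !qv_sradd // E1 E2 E3 !qval_scode => /(_ (sradd_valid V1 V2) (sradd_valid V3 V3)).
  by clear; lra.
- by move=> s t Hs V /(U _ _ Hs) <-; rewrite qval_scode.
- move=> s Hs; have [t [V E _]] := T s Hs; exists t; rewrite E qval_scode; split=> //.
  by rewrite -E; apply: Em.
- move=> X HX k; have [n [s [/srestrE -> [t [V [Hin Hlt]]]]]] := HX k; exists n.
  rewrite -(U _ _ (rs_gt0 X n) Hin) qval_scode.
  by move/srltE: Hlt; rewrite qv_srnat; apply => //; exact: srnat_valid.
Qed.
End Tests.

(** * Computable randomness implies Schnorr randomness *)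

Section SchnorrFromComputable.
Variables (M : model) (Z : set_of M).
Local Notation N := (carrier M).
Local Notation K := (ratio M).
Implicit Types (b c i j k l m n u v s r x y z : N) (t : frac M) (X F S R : set_of M).

Lemma ksum_ge_term (G : N -> K) j n : CQ Z G -> (forall i, 0 <= G i) -> j ≺ n -> G j <= ksum G n.
Proof.
move=> HG H Hj; have D : CQ Z (fun i => ite (i = j) (G i) 0) by comp.
rewrite -[X in X <= _](iteT (P := j = j) _ 0) // -(ksum_single (n := n) D) //.
- apply: (ksum_le D HG) => i _; have [E|E] := pselect (i = j); first by rewrite iteT.
  by rewrite iteF.
- by move=> i _ E; rewrite iteF.
Qed.
Lemma ksum_pow2 n : ksum (fun i => iota (pow2 i)) n <= iota (pow2 n) :> K.
Proof.
have D : CQ Z (fun i => iota (pow2 i)) by comp.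
have D' : CP Z (fun n => ksum (fun i => iota (pow2 i)) n <= iota (pow2 n) :> K) by comp.
apply: (cp_ind D') n => [|n IH]; first by rewrite (ksum0 D) ltW // ip_gt0.
by rewrite (ksumS n D) pow2S iotaD; move: IH; clear; lra.
Qed.
Lemma ip2_mono m n : m ⪯ n -> ip2 n <= ip2 m :> K.
Proof.
move=> /pow2_mono /leNK H; rewrite /ip2 lef_pV2 ?posrE ?ip_gt0 //.
Qed.

Lemma real_seq_fun R : sreal_seq R -> CP Z (fun x => inS x R) -> exists q : N -> N -> K,
  CQ2 Z q /\ forall n k, exists t, [/\ fvalid t, sreal_term R n k t & qv t = q n k].
Proof.
move=> [HR _] HZ.
have D : CP2 Z (fun z b => inS (spr (spr (p1 z) (p2 z)) b) R) by comp.
have H n k : exists y, inS (spr (spr n k) y) R /\ isq y.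
  by have [|y [H1 [H2 _]]] := HR (spr n k); [exists n, k|exists y].
have U n k y y' : inS (spr (spr n k) y) R -> inS (spr (spr n k) y') R -> y = y'.
  have [|y0 [_ [_ H2]]] := HR (spr n k); first by exists n, k.
  by move=> /H2 -> /H2 ->.
have [|m [Hm Hmin]] := Comp_least D.
  by move=> z; have [y [Hy _]] := H (p1 z) (p2 z); exists y.
exists (fun n k => qval (m (spr n k))); split; first by comp.
move=> n k; have [y [Hy [t [V E]]]] := H n k; exists t; split=> //.
  by rewrite /sreal_term -E.
have [Hm' _] := Hmin (spr n k); rewrite p1E p2E in Hm'.
by rewrite -(U _ _ _ _ Hy Hm') E qval_scode.
Qed.

(** The difference of the conditional measures of nested sets is again a nonnegative martingale, so
    it at most doubles per bit. *)
Lemma mu_diff c c' s : strings c -> strings c' -> (forall x, smem x c -> smem x c') -> 0 ≺ s ->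
  mu c' s - mu c s <= iota (pow2 (lh s)) * (mu c' 1 - mu c 1).
Proof.
move=> Hc Hc' Hsub Hs.
apply: (@supermart_growth M Z (fun s => mu c' s - mu c s)) => //; first by comp.
split=> r Hr.
- by move: (mu_mart c Hr) (mu_mart c' Hr); move: (mu _ _) (mu _ _) (mu _ _) (mu _ _) (mu _ _) (mu _ _); clear; intros; lra.
- rewrite subr_ge0; apply: mu_mono => // x Hx; exists x; split; first exact: Hsub.
  by apply: pre_refl; apply: Hc.
Qed.

(** Passing from length l to l + 1 costs two amounts of at most 2^-l each. The new term is at most
    2^l 2^l 2^-3l; moving from the stages for l to those for l + 1 adds at most 2^l 2^-4l to each
    measure, with weights summing to at most 2^l. The correction 4 2^-|s| falls by 2 2^-l, which
    pays for both. *)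
Lemma betting X F R : sopen_seq F -> sleT F Z -> (forall n p, sexp2 n p -> smeasure_le F n (srinv p)) ->
  sreal_seq R -> sleT R Z -> (forall n, sconverges (sstage_measure F n) (sreal_term R n)) ->
  (forall n, sin_open X F n) -> exists S, [/\ ssupermartingale S, sleT S Z & ssucceeds S X].
Proof.
move=> HF FZ Fle HR RZ Fconv XF.
have [B [HB SB EB]] := open_seq_fun HF (proj2 (CP_leT _ _) FZ).
have [U [HU EU]] := stages HB.
have [SU smE smX] := stage_measureP SB EB EU.
have [q [Hq Eq]] := real_seq_fun HR (proj2 (CP_leT _ _) RZ).
pose mass n m := mu (U n m) 1.
have mass_le n m : mass n m <= ip2 n.
  have [t [V [Hs Hl]]] := Fle _ _ (proj2 (sexp2E n _) erefl) m.
  rewrite /mass -(smE n m t V Hs) /ip2 -qv_srinv; apply/srleE => //; exact: pow2_gt0.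
have U_mono n m m' x : m ⪯ m' -> smem x (U n m) -> smem x (U n m').
  by move=> L /EU [i [Li Hi]]; apply/EU; exists i; split=> //; apply: leN_trans L.
have mass_mono n m m' : m ⪯ m' -> mass n m <= mass n m'.
  move=> L; apply: mu_mono; [exact: SU| |exact: ltN01] => r Hr; exists r; split; first exact: U_mono Hr.
  by apply: pre_refl; apply: SU Hr.
have close n k : exists m0, forall m, m0 ⪯ m -> forall j,
    mass n m - q n j <= ip2 k + ip2 j /\ q n j - mass n m <= ip2 k + ip2 j.
  have [m0 Hm0] := Fconv n k _ (proj2 (sexp2E k _) erefl).
  exists m0 => m L j; have [t [V Qt _ Ht]] := smX n m; have [v [W Hv Qv]] := Eq n j.
  have := Hm0 m L t V Ht j _ (proj2 (sexp2E j _) erefl) v W Hv.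
  have Vi x : fvalid (srinv (pow2 x)) by exact: pow2_gt0.
  have Vo : fvalid (sropp v) by exact: W.
  have Vs : fvalid (srsub t v) by exact: sradd_valid.
  have Vso : fvalid (sropp (srsub t v)) by exact: Vs.
  have Vi2 := sradd_valid (Vi k) (Vi j).
  rewrite /srabs_le !srleE // qv_sropp /srsub !qv_sradd // qv_sropp !qv_srinv Qt Qv -!/(ip2 _) -/(mass n m).
  by rewrite opprB.
(* The exponent 4l + 2 gives two errors of 2^-(4l+1), one from the search and one from the limit;
   together they make the 2^-4l of [st_close]. *)
pose j4 l := l + l + l + l + 1 + 1.
(* Besides being close to the given measure, the stage is required to be at least [l], so that
   growing l exhausts the whole open set. *)
have D : CP2 Z (fun z y => p2 z ⪯ y /\ q (p1 z) (j4 (p2 z)) - mass (p1 z) y <= 2 * ip2 (j4 (p2 z))).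
  by rewrite /mass /j4; comp.
have [|st' [Hst Hmin]] := Comp_least D.
  move=> z; have [m0 Hm0] := close (p1 z) (j4 (p2 z)); exists (m0 + p2 z).
  split; first by rewrite addrC; apply: leN_addr.
  by have [_] := Hm0 _ (leN_addr m0 (p2 z)) (j4 (p2 z)); move: (ip2 _); clear; intros; lra.
pose st n l := st' (spr n l).
have st_ge n l : l ⪯ st n l by have [[+ _] _] := Hmin (spr n l); rewrite p2E.
have st_close n l m : mass n m - mass n (st n l) <= ip2 (l + l + l + l).
  have [[_ +] _] := Hmin (spr n l); rewrite p1E p2E -/(st n l) => H1.
  have [m0 Hm0] := close n (j4 l).
  have L : m0 ⪯ m0 + m by apply: leN_addr.
  have [H2 _] := Hm0 _ L (j4 l).
  have H3 : mass n m <= mass n (m0 + m) by apply: mass_mono; rewrite addrC; apply: leN_addr.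
  rewrite !(ip2S (l + l + l + l)) (ip2S (l + l + l + l + 1)) -/(j4 l).
  by move: H1 H2 H3; clear; lra.
pose n3 n := n + n + n.
pose G l s n := iota (pow2 n) * mu (U (n3 n) (st (n3 n) l)) s.
pose V s := ksum (G (lh s) s) (lh s) + 4 * ip2 (lh s).
have HG l s : CQ Z (G l s) by rewrite /G /n3 /st; comp.
have G_ge0 l s n : 0 <= G l s n by rewrite mulr_ge0 ?mu_ge0 // ltW // ip_gt0.
have HV : CQ Z V by rewrite /V /G /n3 /st; comp.
have growth s n l : 0 ≺ s -> mu (U n (st n (l + 1))) s - mu (U n (st n l)) s <=
    iota (pow2 (lh s)) * ip2 (l + l + l + l).
  (* The stage found by search need not increase with [l]; where it drops, the measure drops with
     it. *)
  move=> Hs; case: (leN_total (st n l) (st n (l + 1))) => L.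
  - apply: le_trans (mu_diff (SU _ _) (SU _ _) _ Hs) _; first by move=> x; apply: U_mono.
    by rewrite ler_pM2l ?ip_gt0 //; apply: st_close.
  - have : mu (U n (st n (l + 1))) s <= mu (U n (st n l)) s.
      apply: mu_mono => // [|r Hr]; first exact: SU.
      by exists r; split; [apply: U_mono Hr|apply: pre_refl; apply: SU Hr].
    have : 0 <= iota (pow2 (lh s)) * ip2 (l + l + l + l) :> K by rewrite mulr_ge0 // ltW // ?ip_gt0 ?ip2_gt0.
    by move: (_ * _); clear; intros; lra.
have SV : supermart V.
  split=> s Hs; last first.
    rewrite addr_ge0 //; first by apply: (ksum_ge0 (Z := Z)) => // i _; apply: G_ge0.
    by rewrite mulr_ge0 // ltW // ip2_gt0.
  set l := lh s.
  have L0 : lh (s + s) = l + 1 by apply: lh0.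
  have L1 : lh (s + s + 1) = l + 1 by apply: lh1.
  rewrite /V L0 L1 -/l.
  have E : ksum (G (l + 1) (s + s)) (l + 1) + ksum (G (l + 1) (s + s + 1)) (l + 1) =
      2 * ksum (G (l + 1) s) (l + 1).
    rewrite -(ksumD (l + 1) (HG _ _) (HG _ _)) -(ksumM 2 (l + 1) (HG _ _)).
    have C1 := HG (l + 1) (s + s); have C2 := HG (l + 1) (s + s + 1); have C3 := HG (l + 1) s.
    apply: (ksum_eq (Z := Z)) => [||i _]; try by comp.
    by rewrite /G -mulrDr mu_mart //; ring.
  have Ei : ip2 l = 2 * ip2 (l + 1) :> K by exact: ip2S.
  have d_ge0 : 0 <= iota (pow2 l) * ip2 (l + l + l + l) :> K by rewrite mulr_ge0 // ltW // ?ip_gt0 ?ip2_gt0.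
  have P1 : ksum (G (l + 1) s) l <= ksum (G l s) l + iota (pow2 l) * ip2 (l + l + l + l) * iota (pow2 l).
    have C1 := HG (l + 1) s; have C2 := HG l s.
    have C3 : CQ Z (fun n => iota (pow2 n)) by comp.
    have C4 : CQ Z (fun n => iota (pow2 l) * ip2 (l + l + l + l) * iota (pow2 n)) by comp.
    have C5 : CQ Z (fun n => G l s n + iota (pow2 l) * ip2 (l + l + l + l) * iota (pow2 n)).
      exact: CQ_add C2 C4.
    apply: (@le_trans _ _ (ksum (fun n => G l s n + iota (pow2 l) * ip2 (l + l + l + l) * iota (pow2 n)) l)).
      apply: (ksum_le C1 C5) => n _; rewrite /G.
      have := growth s (n3 n) l Hs; rewrite -/l => Hgr.
      rewrite mulrC [X in _ <= X + _]mulrC -mulrDl ler_pM2r ?ip_gt0 //.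
      by move: Hgr; move: (mu _ _) (mu _ _) (_ * _); clear; intros; lra.
    rewrite (ksumD l C2 C4) (ksumM _ l C3) lerD2l.
    by apply: ler_wpM2l (ksum_pow2 l).
  have P2 : G (l + 1) s l <= ip2 l.
    have : mu (U (n3 l) (st (n3 l) (l + 1))) s <= iota (pow2 l) * mass (n3 l) (st (n3 l) (l + 1)).
      by apply: (supermart_growth (Z := Z)) => //; [comp|apply: mu_supermart].
    have := mass_le (n3 l) (st (n3 l) (l + 1)).
    rewrite /n3 !ip2D /G.
    have := ip2_pow l; have := ip_gt0 l; have := ip2_gt0 l.
    move: (iota (pow2 l)) (ip2 l) (mass _ _) (mu _ _) => p i a b Hi Hp Hpi Ha Hb.
    apply: (@le_trans _ _ (p * (p * (i * i * i)))).
      by rewrite ler_pM2l //; apply: le_trans Hb _; rewrite ler_pM2l.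
    have -> : p * (p * (i * i * i)) = (p * i) * (p * i) * i by clear; ring.
    by rewrite Hpi !mul1r.
  have P3 : iota (pow2 l) * ip2 (l + l + l + l) * iota (pow2 l) <= ip2 l :> K.
    rewrite !ip2D.
    have : ip2 l <= 1 :> K by rewrite -ip20; apply: ip2_mono; apply: leN0.
    have := ip2_pow l; have := ip_gt0 l; have := ip2_gt0 l.
    move: (iota (pow2 l)) (ip2 l) => p i Hi Hp Hpi Hi1.
    have -> : p * (i * i * i * i) * p = (p * i) * (p * i) * (i * i) by clear; ring.
    by rewrite Hpi !mul1r -[X in _ <= X]mulr1 ler_pM2l.
  have E2 := ksumS l (HG (l + 1) s).
  move: E E2 P1 P2 P3 Ei; clear; lra.
have [S [H1 H2 H3]] := mart_set HV SV.
exists S; split=> //; apply: H3 => k.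
have [i [b [/EB -> [t [r [/srestrE -> Hr]]]]]] := XF (n3 k).
(* At this length the term [k] has entered, the stage includes the i-th finite set, and the
   enumerated string is a prefix of [X]; that term alone is then 2^k, above k. *)
pose l := k + 1 + i + t; exists l; rewrite /V lh_rs.
have Lk : k ≺ l by rewrite /l; nlra.
have Li : i ⪯ st (n3 k) l by apply: leN_trans (st_ge _ _); rewrite /l; nlra.
have Lt : t ⪯ l by rewrite /l; nlra.
have T := ksum_ge_term (HG l (rs X l)) (G_ge0 l (rs X l)) Lk.
have HrU : smem (rs X t) (U (n3 k) (st (n3 k) l)) by apply/EU; exists i.
rewrite /G (mu_one HrU (pre_rs X Lt)) mulr1 in T.
have Hk : iota k < iota (pow2 k) by apply/iota_lt; apply: lt_pow2.
have I0 := ip2_gt0 l.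
move: T Hk I0; rewrite /G; clear; lra.
Qed.

Lemma computably_random_schnorr X : scomputably_random X Z -> sschnorr_random X Z.
Proof.
move=> H F [HF [FZ [Fle [R [HR [RZ Fconv]]]]]] XF.
have [S [S1 S2 S3]] := betting HF FZ Fle HR RZ Fconv XF.
exact: H S S1 S2 S3.
Qed.
End SchnorrFromComputable.

(** * A computably random set from a Schnorr random one *)

Section Domination.
Variable M : model.
Local Notation N := (carrier M).
Local Notation K := (ratio M).
Implicit Types (b c d e i j k l m n u v s r x y z : N) (t : frac M) (X Y Z W F S R : set_of M).

Lemma code_fun Z (Q : N -> N -> Prop) (h : N -> N) : CP2 Z Q -> Comp Z h -> exists d : N -> N, Comp Z d /\
  forall k x, smem x (d k) <-> x ≺ h k /\ Q k x.
Proof.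
move=> HQ Hh.
pose P z c := (forall x, x ≺ c -> smem x c -> x ≺ h z /\ Q z x) /\ (forall x, x ≺ h z -> Q z x -> smem x c).
have D : CP2 Z P by rewrite /P; comp.
have PE z c : P z c <-> forall x, smem x c <-> x ≺ h z /\ Q z x.
  split=> [[H1 H2] x|H]; first by split=> [Hx|[]]; [apply: H1 => //; exact: smem_lt|exact: H2].
  by split=> [x _ /H //|x Hx Hq]; apply/H.
have [|d [Hd Hmin]] := Comp_least D.
  move=> z; have [|A HA] := @CP_set _ Z (fun x => Q z x); first by comp.
  have [c Hc] := code_set A (h z); exists c; apply/PE => x; rewrite Hc.
  by split=> -[H1 H2]; split=> //; apply/HA.
by exists d; split=> // k; have [/PE H _] := Hmin k.
Qed.

(** Kolmogorov's inequality at level 1 for the sum of the martingales of [d] and [d'], which is at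
    least 1 at every string of [c]. *)
Lemma mu_union Z c d d' : strings c -> (forall x, smem x c -> smem x d \/ smem x d') ->
  strings d -> strings d' -> mu c 1 <= mu d 1 + mu d' 1.
Proof.
move=> Hc Hs Hd Hd'.
have D : CQ Z (fun s => mu d s + mu d' s) by comp.
rewrite -[X in X <= _]mul1r; apply: (kolmogorov D); rewrite ?ler01 //; last 2 first.
- exact: ltN01.
- by move=> r Hr C Hp; apply: C; apply: pre_eq Hp _; rewrite lh_one; apply: leN0.
- split=> s Hs0; last by rewrite addr_ge0 ?mu_ge0.
  by move: (mu_mart d Hs0) (mu_mart d' Hs0); move: (mu _ _) (mu _ _) (mu _ _) (mu _ _) (mu _ _) (mu _ _); clear; intros; lra.
- move=> r Hr; have Hp := pre_refl (Hc r Hr); case: (Hs r Hr) => H; rewrite (mu_one H Hp).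
  + by rewrite lerDl mu_ge0.
  + by rewrite lerDr mu_ge0.
Qed.

Section Test.
Variables (Z X : set_of M).
Hypothesis XR : sschnorr_random X Z.

(* The test is [n |-> the union of the d k for k > n]: its k-th stage misses a set
   of measure at most [2^-k], so its measures are computable. *)
Lemma schnorr_tails (d : N -> N) : Comp Z d -> (forall k, strings (d k)) -> (forall k, mu (d k) 1 <= ip2 k) ->
  exists n0, forall n, n0 ⪯ n -> ~ sin_cyl X (d n).
Proof.
move=> Hd Sd Md; apply: contrapT => C.
have {}C n0 : exists n, n0 ⪯ n /\ sin_cyl X (d n).
  apply: contrapT => H; apply: C; exists n0 => n L Hn; apply: H; exists n; split=> //.
(* The offset 1 keeps the sum of the bounds 2^-(n+1+i) over all i within 2^-n. *)
pose B n i := d (n + 1 + i).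
have HB : CP Z (fun y => p2 y = B (p1 (p1 y)) (p2 (p1 y)) /\ y = spr (spr (p1 (p1 y)) (p2 (p1 y))) (p2 y)).
  by rewrite /B; comp.
have [F EF0] := CP_set HB.
have EF n i b : inS (spr (spr n i) b) F <-> b = B n i.
  by rewrite EF0 !(p1E, p2E); split=> [[]|].
have HB2 : Comp2 Z B by rewrite /B; comp.
have SB n i : strings (B n i) by apply: Sd.
have [U [HU EU]] := stages HB2.
have [SU smE smX] := stage_measureP SB EF EU.
pose mass n m := mu (U n m) 1.
have Hmass : CQ2 Z mass by rewrite /mass; comp.
have mass_mono n m m' : m ⪯ m' -> mass n m <= mass n m'.
  move=> L; apply: mu_mono; [exact: SU| |exact: ltN01] => r Hr; exists r.
  split; last by apply: pre_refl; apply: SU Hr.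
  by case/EU: Hr => i [Li Hi]; apply/EU; exists i; split=> //; apply: leN_trans L.
have mass0 n : mass n 0 + ip2 (n + 1) <= ip2 n.
  have : mass n 0 <= mu (B n 0) 1.
    apply: mu_mono; [exact: SU| |exact: ltN01] => r Hr; exists r.
    split; last by apply: pre_refl; apply: SU Hr.
    by case/EU: Hr => i [[L|->]] //; exfalso; nlra.
  have := Md (n + 1 + 0); rewrite -/(B n 0) addr0 (ip2S n).
  by move: (mass _ _) (mu _ _) (ip2 _); clear; intros; lra.
(* Measure so far plus remaining allowance does not increase with the stage: the geometric tail
   estimate in telescoped form. *)
have massS n m : mass n (m + 1) + ip2 (n + 1 + (m + 1)) <= mass n m + ip2 (n + 1 + m).
  have : mass n (m + 1) <= mass n m + mu (B n (m + 1)) 1.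
    apply: (@mu_union Z) => // r /EU [i [L Hi]].
    have [E|E] := pselect (i = m + 1); first by right; rewrite -E.
    left; apply/EU; exists i; split=> //.
    by case: L => [L|/E //]; clear -L; nlra.
  have := Md (n + 1 + (m + 1)); rewrite -/(B n (m + 1)) (ip2S (n + 1 + m)) (addrA _ m 1).
  by move: (mass _ _) (mass _ _) (mu _ _) (ip2 _); clear; intros; lra.
have massD n m k : mass n (m + k) + ip2 (n + 1 + (m + k)) <= mass n m + ip2 (n + 1 + m).
  have D : CP Z (fun k => mass n (m + k) + ip2 (n + 1 + (m + k)) <= mass n m + ip2 (n + 1 + m)) by comp.
  apply: (cp_ind D) k => [|k IH]; first by rewrite addr0.
  by rewrite (addrA m k 1); apply: le_trans (massS n (m + k)) IH.
have mass_le n m : mass n m <= ip2 n.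
  have := massD n 0 m; rewrite add0r addr0 => H.
  apply: le_trans (le_trans H (mass0 n)); rewrite lerDl ltW //; exact: ip2_gt0.
have mass_lim n m m' : m ⪯ m' -> 0 <= mass n m' - mass n m <= ip2 m.
  move=> L; rewrite subr_ge0 mass_mono //=; case/leN_subE: (L) => k <-.
  have H1 := massD n m k; have H2 := ip2_gt0 (n + 1 + (m + k)).
  have : ip2 (n + 1 + m) <= ip2 m :> K by apply: ip2_mono; rewrite addrC; apply: leN_addr.
  by move: H1 H2; move: (mass _ _) (mass _ _) (ip2 _) (ip2 _) (ip2 _); clear; intros; lra.
(* The stage measures themselves serve as the approximations of the real, their error after stage k
   being at most 2^-k by [mass_lim]. *)
have HR : CP Z (fun y => p2 y = qc (mass (p1 (p1 y)) (p2 (p1 y))) /\ y = spr (spr (p1 (p1 y)) (p2 (p1 y))) (p2 y)).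
  by comp.
have [R ER0] := CP_set HR.
have ER n i b : inS (spr (spr n i) b) R <-> b = qc (mass n i).
  by rewrite ER0 !(p1E, p2E); split=> [[]|].
have RE n k t : sreal_term R n k t -> qv t = mass n k.
  by move=> /ER H; rewrite -(qval_scode t) H qcK.
have Vi x : fvalid (srinv (pow2 x)) by exact: pow2_gt0.
have absE t (u v : frac M) : fvalid t -> fvalid u -> fvalid v ->
    srabs_le (srsub t u) v <-> qv t - qv u <= qv v /\ qv u - qv t <= qv v.
  move=> Vt Vu Vv; have Vo : fvalid (sropp u) by exact: Vu.
  have Vs : fvalid (srsub t u) by exact: sradd_valid.
  have Vso : fvalid (sropp (srsub t u)) by exact: Vs.
  by rewrite /srabs_le !srleE // qv_sropp /srsub !qv_sradd // qv_sropp opprB.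
apply: (XR (F := F)); last first.
  move=> n; have [n' [/leN_subE[i Ei] Hin]] := C (n + 1).
  exists i, (d n'); split=> //; apply/EF; by rewrite /B Ei.
split; first by move=> x [n [i ->]]; exists (B n i); split; [apply/EF|split; [apply: SB|move=> z /EF]].
split; first by apply/CP_leT; apply: CP_ext HB => y; rewrite EF0.
split.
  move=> n p /sexp2E -> m; have [t [V Q _ Ht]] := smX n m; exists t; split=> //; split=> //.
  by apply/srleE => //; rewrite Q qv_srinv; apply: mass_le.
exists R; split; last split.
- split=> [x [n [k ->]]|n k l p L /sexp2E -> t Vt u Vu /RE Qt /RE Qu].
    exists (qc (mass n k)); split; first exact/ER.
    by split; [apply: qc_isq|move=> z /ER].
  apply/absE => //; rewrite Qt Qu qv_srinv -/(ip2 k).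
  have /andP[H1 H2] := mass_lim n k l L; have H3 := ip2_gt0 k.
  by move: H1 H2 H3; move: (mass _ _) (mass _ _) (ip2 _); clear; intros; split; lra.
- by apply/CP_leT; apply: CP_ext HR => y; rewrite ER0.
- move=> n k p /sexp2E ->; exists k => m L t Vt Ht j q /sexp2E -> u Vu /RE Qu.
  have Qt := smE n m t Vt Ht; apply/absE => //; first exact: sradd_valid.
  rewrite Qt Qu qv_sradd // !qv_srinv -!/(ip2 _) -/(mass n m).
  have Hk := ip2_gt0 k; have Hj := ip2_gt0 j; have Hm := ip2_mono L.
  case: (leN_total m j) => L'; have /andP[H1 H2] := mass_lim n _ _ L'.
  + move: H1 H2 Hk Hj Hm; move: (mass _ _) (mass _ _) (ip2 _) (ip2 _) (ip2 _); clear; intros; split; lra.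
  + move: H1 H2 Hk Hj Hm; move: (mass _ _) (mass _ _) (ip2 _) (ip2 _) (ip2 _); clear; intros; split; lra.
Qed.

(** [C] is at least the initial capital, so Kolmogorov's inequality at level C 2^k bounds the
    measure of the k-th set of strings by 2^-k, as [schnorr_tails] requires. *)
Lemma schnorr_domination (B : N -> K) (g : N -> N) C : CQ Z B -> supermart B -> Comp Z g -> 0 ≺ C -> B 1 <= iota C ->
  exists n0, forall n, n0 ⪯ n -> forall m, m ≺ g n -> B (rs X m) <= iota (C * pow2 n).
Proof.
move=> HB SB Hg HC BC.
have D : CP2 Z (fun k x => 0 ≺ x /\ iota (C * pow2 k) < B x) by comp.
have Dg : Comp Z (fun k => pow2 (g k)) by comp.
have [d [Hd Ed]] := code_fun D Dg.
have Sd k : strings (d k) by move=> r /Ed [_ []].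
have [|n0 Hn0] := schnorr_tails Hd Sd.
  move=> k; have HCk : 0 < iota (C * pow2 k) by apply: iota_gt0; apply: pos_mul => //; exact: pow2_gt0.
  have : iota (C * pow2 k) * mu (d k) 1 <= B 1.
    apply: (kolmogorov HB SB (ltW HCk)) => //; last 2 first.
    - exact: ltN01.
    - by move=> r Hr E Hp; apply: E; apply: pre_eq Hp _; rewrite lh_one; apply: leN0.
    - exact: Sd.
    - by move=> r /Ed [_ [_ H]]; apply: ltW.
  move=> H; have {}H := le_trans H BC; have Cgt0 := iota_gt0 HC.
  rewrite iotaM -mulrA ger_pMr // in H.
  by rewrite -(ler_pM2l (ip_gt0 k)) ip2_pow.
exists n0 => n L m Lm; rewrite real_leNgt ?num_real //; apply/negP => H.
apply: (Hn0 n L); exists m, (rs X m); split; first exact/srestrE.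
apply/Ed; split; last by split=> //; apply: rs_gt0.
have := lh_lt (rs X m); rewrite lh_rs => H1.
have /pow2_mono : m + 1 ⪯ g n by apply/ltN_S.
by move: H1; move: (pow2 _) (pow2 _) (rs _ _); clear; intros; nlra.
Qed.
End Test.
End Domination.

(** * Change of oracle and nonincreasing paths *)

Section Relativization.
Variable M : model.
Local Notation N := (carrier M).
Local Notation K := (ratio M).
Implicit Types (b c d e i j k l m n u v s r x y z p : N) (X Y Z W : set_of M).

Lemma CP_bgood W Z (f : N -> N) : CP W (fun x => inS x Z) -> Comp W f -> CP W (fun x => bgood Z (f x)).
Proof. by move=> HZ Hf; rewrite /bgood /bjustified; comp. Qed.

(** No index is translated: [W] searches for a computation relative to [Z] together with its value,
    and the correctness of a proposed computation is decidable in [W]. *)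
Lemma Comp_trans W Z (f : N -> N) : CP W (fun x => inS x Z) -> Comp Z f -> Comp W f.
Proof.
move=> HZ [e He].
have D : CP2 W (fun x u => bgood Z (p1 u) /\ smem (strip e x (p2 u)) (p1 u)).
  by comp; apply: CP_bgood; comp.
have [|m [Hm Hmin]] := Comp_least D.
  by move=> x; have [d [H1 /bgoodE H2]] := He x; exists (spr d (f x)); rewrite p1E p2E.
apply: (Comp_ext (f := fun x => p2 (m x))); last by comp.
move=> x; have [[H1 H2] _] := Hmin x.
by apply: (cmp_unique (e := e) (x := x)) (He x); exists (p1 (m x)); split=> //; apply/bgoodE.
Qed.
Lemma CQ_trans W Z (F : N -> K) : CP W (fun x => inS x Z) -> CQ Z F -> CQ W F.
Proof. exact: Comp_trans. Qed.

Lemma join Z X : exists W, CP W (fun x => inS x Z) /\ CP W (fun x => inS x X).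
Proof.
pose P n (r : nat -> N) h := exists x, x ≺ n + 1 /\ ((n = spr 0 x /\ inS (M := M) x (h 0%N)) \/ (n = spr 1 x /\ inS x (h 1%N))).
have D : D0 (fun (r : nat -> N) h => P (r 0%N) (fun q => r (S q)) h) by rewrite /P; d0.
have [W HW] := D0_comprehension D (env [::]) (senv [:: Z; X]).
have L i x : x ≺ spr i x + 1 by have := spr_ler i x; move: (spr _ _) => *; nlra.
exists W; split; [apply: (CP_ext (P := fun x => inS (spr 0 x) W))|apply: (CP_ext (P := fun x => inS (spr 1 x) W))]; 
  try by apply: CP_oracle; comp.
- move=> x; rewrite HW; split=> [[y [_ [[/spr_inj[_ ->]]|[/spr_inj[E _]]]]]|H] //.
    by have := @ltN01 M; rewrite -E => /ltNn.
  by exists x; split=> //; left.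
- move=> x; rewrite HW; split=> [[y [_ [[/spr_inj[E _]]|[/spr_inj[_ ->]]]]]|H] //.
    by have := @ltN01 M; rewrite E => /ltNn.
  by exists x; split=> //; right.
Qed.

(** At every string one of the two children has no more capital than the string itself. The
    comparison is decidable in [W], so the path that prefers the 0-child when it qualifies is
    computable. *)
Lemma follow W (L : N -> K) : CQ W L -> supermart L ->
  exists Y, CP W (fun x => inS x Y) /\ forall n, L (rs Y n) <= L 1.
Proof.
move=> HL [SL _].
pose g i v := ite (L (v + v) <= L v) (v + v) (v + v + 1).
have Hg : Comp2 W g by rewrite /g; comp.
pose h n := prec 1 g n.
have Hh : Comp W h by rewrite /h; comp.
have HY : CP W (fun n => ~ L (h n + h n) <= L (h n)) by comp.
have [Y EY] := CP_set HY.
have DY : CP W (fun x => inS x Y) by apply: CP_ext HY => x; rewrite EY.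
exists Y; split=> //.
have D1 : CP W (fun n => rs Y n = h n) by comp; apply: Comp_rs; comp.
have E n : rs Y n = h n.
  apply: (cp_ind D1) n => [|n IH]; first by rewrite rs0 /h (prec0 1 Hg).
  rewrite rsS IH /h (precS 1 n Hg) -/(h n) /g.
  have [H|H] := pselect (L (h n + h n) <= L (h n)).
  - by rewrite [RHS]iteT // iteF // EY.
  - by rewrite [RHS]iteF // iteT // EY.
have D2 : CP W (fun n => L (rs Y n) <= L 1) by comp; apply: Comp_rs; comp.
move=> n; apply: (cp_ind D2) n => [|n IH]; first by rewrite rs0.
apply: le_trans IH; have Hs := SL _ (rs_gt0 Y n); rewrite rsS.
have [H|H] := pselect (inS n Y).
- rewrite iteT //; move/EY: H; rewrite -E => /negP; rewrite -real_ltNge ?num_real // => H.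
  by move: H Hs; clear; lra.
- by rewrite iteF // E; apply: contrapT => H'; apply: H; apply/EY.
Qed.

(** The field is Archimedean over the numbers of the model: denominators are at least 1, so the
    positive part of the numerator is a bound. *)
Lemma iota_unbounded (x : K) : exists k, x <= iota k.
Proof.
have [t [V <-]] := qv_surj x; exists (fnum t); rewrite /qv ler_pdivrMr ?fvalid_gt0 //.
have : 1 <= iota (fden t) by rewrite -iota1; apply/leNK; apply: ltN_ge1.
have := iota_ge0 (fnum t); have := iota_ge0 (fneg t).
by move: (iota _) (iota _) (iota _) => a b c *; nra.
Qed.
Lemma anc_pos s j : 0 ≺ s -> j ⪯ lh s -> 0 ≺ anc s j.
Proof.
move=> Hs /pow2_mono L; have [r [Lr E]] := proj1 (anc_mod s j _) erefl.
case: (leN0 (anc s j)) => // E0; exfalso; move: E; rewrite -E0 mul0r add0r => E.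
by have := lh_le Hs; rewrite E in L Lr *; move: (pow2 _) (pow2 _) Lr L => a b *; nlra.
Qed.
Lemma anc_kid s k j : kid s k -> anc k (j + 1) = anc s j.
Proof. by move=> Hk; rewrite (addrC j) ancD -{1}[1]add0r ancS anc0 (kid_hlf Hk). Qed.
End Relativization.

Ltac comp_string ::= first [comp_measure | lazymatch goal with
  | |- CP _ (fun x => bgood _ _) => apply: CP_bgood
  end].

(** * The weighted sum of all computable supermartingales *)

Section Universal.
Variables (M : model) (Z : set_of M).
Local Notation N := (carrier M).
Local Notation K := (ratio M).
Implicit Types (b c d e i j k l m n u v s r x y z p : N) (X Y W : set_of M).

(* [u] is a pair of a computation and of the value it exhibits: the index [e] decides
   a set of pairs, and the computation puts [(s, p2 u)] into it. *)
Definition value_wit e s u : Prop :=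
  (bgood Z (p1 u) /\ smem (strip e (spr s (p2 u)) 1) (p1 u)) /\ (isq (p2 u) /\ (0 : K) <= qval (p2 u)).
Lemma value_wit_computes e s u : value_wit e s u -> scomputes Z e (spr s (p2 u)) 1.
Proof. by move=> [[/bgoodE H1 H2] _]; exists (p1 u). Qed.
(** An arbitrary index may accept several values at the same string, or none; the least witness
    settles which one counts. *)
Definition least_value_wit e s u : Prop := value_wit e s u /\ forall v, v ≺ u -> ~ value_wit e s v.
Definition val e s : K := 
  if pselect (exists u, least_value_wit e s u) is left E then qval (p2 (projT1 (cid E))) else 0.
Lemma valE e s u : least_value_wit e s u -> val e s = qval (p2 u).
Proof.
move=> [Hu Lu]; rewrite /val; case: pselect => [E|[]]; last by exists u.
case: cid => v /= [Hv Lv]; case: (ltN_cmp u v) => [/Lv|->|/Lu] //.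
Qed.
Lemma val_ge0 e s : 0 <= val e s.
Proof. by rewrite /val; case: pselect => // E; case: cid => v /= [[_ [_]]]. Qed.
Definition converges_below e n b : Prop := forall s, s ≺ pow2 (n + 1) -> 0 ≺ s -> exists u, u ≺ b /\ value_wit e s u.

Section Strategy.
Variables (W : set_of M) (f : N -> N).
Hypothesis HZ : CP W (fun x => inS x Z).
Hypothesis Hf : Comp W f.

Lemma CP_value_wit (a b c : N -> N) : Comp W a -> Comp W b -> Comp W c -> CP W (fun x => value_wit (a x) (b x) (c x)).
Proof. by move=> *; rewrite /value_wit; comp. Qed.
Lemma CP_converges_below (a b c : N -> N) : Comp W a -> Comp W b -> Comp W c -> CP W (fun x => converges_below (a x) (b x) (c x)).
Proof. by move=> *; rewrite /converges_below; comp; apply: CP_value_wit; comp. Qed.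

(** [val] itself need not be computable, as its search may run forever. [v] cuts the search off at
    [b] and agrees with [val] wherever a witness exists below [b]. *)
Lemma bounded_val : exists v : N -> N -> N -> K,
  CQ W (fun z => v (p1 z) (p1 (p2 z)) (p2 (p2 z))) /\
  forall e n b s, converges_below e n b -> 0 ≺ s -> s ≺ pow2 (n + 1) -> v e s b = val e s.
Proof.
have D : CP2 W (fun z u => value_wit (p1 z) (p1 (p2 z)) u \/ u = p2 (p2 z)).
  by comp; apply: CP_value_wit; comp.
have [|m [Hm Hmin]] := Comp_least D; first by move=> z; exists (p2 (p2 z)); right.
exists (fun e s b => qval (p2 (m (spr e (spr s b))))); split; first by comp.
move=> e n b s Hc Hs Ls; have [u [Lu Hu]] := Hc s Ls Hs.
have [] := Hmin (spr e (spr s b)); rewrite !(p1E, p2E); move: (m _) => v Hv Lv.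
rewrite (valE (u := v)) //; split; last by move=> w Lw Hw; apply: (Lv w Lw); left.
case: Hv => // E; exfalso; apply: (Lv u); first by rewrite E.
by left.
Qed.

(** Convergence covers the strings of length at most [n], fairness those of length below [n], whose
    children still have values found below [f n]. *)
Definition legal e n : Prop := converges_below e n (f n) /\
  forall s, s ≺ pow2 n -> 0 ≺ s -> val e (s + s) + val e (s + s + 1) <= 2 * val e s.
(** A pair is at least each of its components, so entering at length [p] is late enough for the
    starting length coded in [p]. *)
Definition alive p n : Prop := forall m, m ≺ n + 1 -> p ⪯ m -> legal (p1 p) m.
(* The capital of the player [p = (e, n0)], who enters at length [p] with less than 1
   and then bets like [e] until [alive] fails. *)
Definition share p s : K := ite ((0 ≺ s /\ p ⪯ lh s) /\ alive p (lh s))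
  (val (p1 p) s / (val (p1 p) (anc s (nsub (lh s) p)) + 1)) 0.
(** The summand [ip2 (lh s)] is the reserve for the players beyond the length of [s], whose weights
    2^-p add up to it. *)
Definition universal s : K := ksum (fun p => ip2 p * share p s) (lh s + 1) + ip2 (lh s).

Lemma CP_legal : CP2 W legal.
Proof.
have [v [Hv Ev]] := bounded_val.
have H3 (a b c : N -> N) : Comp W a -> Comp W b -> Comp W c -> CQ W (fun x => v (a x) (b x) (c x)).
  move=> Ha Hb Hc; apply: CQ_ext (CQ_app Hv (Comp_spr Ha (Comp_spr Hb Hc))) => x.
  by rewrite !(p1E, p2E).
apply: (CP_ext (P := fun z => converges_below (p1 z) (p2 z) (f (p2 z)) /\ forall s, s ≺ pow2 (p2 z) -> 0 ≺ s ->
    v (p1 z) (s + s) (f (p2 z)) + v (p1 z) (s + s + 1) (f (p2 z)) <= 2 * v (p1 z) s (f (p2 z)))); last first.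
  by (comp; [apply: CP_converges_below; comp|apply: H3; comp ..]).
move=> z; rewrite /legal.
suff E s : converges_below (p1 z) (p2 z) (f (p2 z)) -> s ≺ pow2 (p2 z) -> 0 ≺ s ->
    [/\ v (p1 z) (s + s) (f (p2 z)) = val (p1 z) (s + s), v (p1 z) (s + s + 1) (f (p2 z)) = val (p1 z) (s + s + 1)
      & v (p1 z) s (f (p2 z)) = val (p1 z) s].
  split=> -[H1 H2]; split=> // s Ls Hs; have := H2 s Ls Hs; have [-> -> ->] := E s H1 Ls Hs; done.
move=> Hc Ls Hs; have P := pow2S (p2 z).
by split; apply: Ev Hc _ _; rewrite ?P; move: (pow2 _) Ls => a Ls; clear -Hf HZ Ls Hs; nlra.
Qed.

Lemma alive_converges p n : alive p n -> p ⪯ n -> converges_below (p1 p) n (f n).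
Proof. by move=> H L; have [] := H n _ L; first by nlra. Qed.

Lemma anc_lt s j : 0 ≺ s -> j ⪯ lh s -> anc s j ≺ pow2 (lh s + 1).
Proof.
move=> Hs L; have H := anc_pos Hs L; have H1 := lh_lt (anc s j).
suff /pow2_mono : lh (anc s j) + 1 ⪯ lh s + 1.
  by move: (pow2 _) (pow2 _) H1; clear -Hf HZ; intros; nlra.
by have := anc_lh H; move: (lh _) (lh _) => a b *; nlra.
Qed.

Lemma nsub_le a b : nsub a b ⪯ a.
Proof. by case: (nsubP a b) => [E|[_ ->]]; [rewrite -{2}E; exact: leN_addr|exact: leN0]. Qed.

Lemma CQ_share : CQ2 W share.
Proof.
have [v [Hv Ev]] := bounded_val.
have H3 (a b c : N -> N) : Comp W a -> Comp W b -> Comp W c -> CQ W (fun x => v (a x) (b x) (c x)).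
  move=> Ha Hb Hc; apply: CQ_ext (CQ_app Hv (Comp_spr Ha (Comp_spr Hb Hc))) => x.
  by rewrite !(p1E, p2E).
have Hok := CP_legal.
have Hal : CP2 W alive by rewrite /alive; comp.
apply: (CQ_ext (F := fun z => ite ((0 ≺ p2 z /\ p1 z ⪯ lh (p2 z)) /\ alive (p1 z) (lh (p2 z)))
  (v (p1 (p1 z)) (p2 z) (f (lh (p2 z))) /
    (v (p1 (p1 z)) (anc (p2 z) (nsub (lh (p2 z)) (p1 z))) (f (lh (p2 z))) + 1)) 0)); last first.
  by comp; apply: H3; comp.
move=> z; rewrite /share; move: (p1 z) (p2 z) => p s.
have [H|H] := pselect ((0 ≺ s /\ p ⪯ lh s) /\ alive p (lh s)); last by rewrite !iteF.
rewrite !iteT //; case: H => -[Hs L] /alive_converges /(_ L) Hc.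
rewrite (Ev _ _ _ _ Hc) //; last exact: lh_lt.
by rewrite (Ev _ _ _ _ Hc) //; [apply: anc_pos|apply: anc_lt] => //; apply: nsub_le.
Qed.
Lemma CQ_universal : CQ W universal.
Proof. by have H := CQ_share; rewrite /universal; comp. Qed.

Lemma share_ge0 p s : 0 <= share p s.
Proof.
rewrite /share; have [H|H] := pselect ((0 ≺ s /\ p ⪯ lh s) /\ alive p (lh s)); last by rewrite iteF.
by rewrite iteT // divr_ge0 ?addr_ge0 ?val_ge0.
Qed.
Lemma share_self p s : p = lh s -> share p s <= 1.
Proof.
move=> E; rewrite /share; have [H|H] := pselect ((0 ≺ s /\ p ⪯ lh s) /\ alive p (lh s)); last by rewrite iteF.
rewrite iteT // E (_ : nsub _ _ = 0); last by apply/nsub0; right.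
rewrite anc0; have := val_ge0 (p1 (lh s)) s; move: (val _ _) => a Ha.
by rewrite ler_pdivrMr; move: Ha; clear -Hf HZ; intros; lra.
Qed.
(** If the player does not survive to the next length, both children carry 0. Otherwise [s] and its
    children are normalised at the same ancestor, and legality at the next length gives the fairness
    of [val] at [s]. *)
Lemma share_mart p s : 0 ≺ s -> p ⪯ lh s -> share p (s + s) + share p (s + s + 1) <= 2 * share p s.
Proof.
move=> Hs L; have [H|H] := pselect (alive p (lh s + 1)); last first.
  have S0 : share p (s + s) = 0 by rewrite /share lh0 // iteF // => -[].
  have S1 : share p (s + s + 1) = 0 by rewrite /share lh1 // iteF // => -[].
  by rewrite S0 S1 addr0 mulr_ge0 ?share_ge0.
rewrite /share lh0 // lh1 //.
have Hl : alive p (lh s).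
  by move=> m Lm Lp; apply: (H m) => //; move: (lh s) Lm; clear -Hf HZ; intros; nlra.
have Ln : nsub (lh s + 1) p = nsub (lh s) p + 1.
  apply: nsubE; left; case: (nsubP (lh s) p) => [E|[E _]]; first by rewrite -{2}E; ring.
  by exfalso; nlra.
have P0 : 0 ≺ s + s by apply: (kid_gt0 Hs); left.
have P1 : 0 ≺ s + s + 1 by apply: (kid_gt0 Hs); right.
have L1 : p ⪯ lh s + 1 by nlra.
rewrite !iteT // Ln !(@anc_kid _ s); [|by right|by left].
have [_ /(_ s)] : legal (p1 p) (lh s + 1) by apply: (H (lh s + 1)) => //; nlra.
move=> /(_ (lh_lt s) Hs) Hm.
have := val_ge0 (p1 p) (anc s (nsub (lh s) p)); move: Hm (val _ (anc _ _)) => Hm d Hd.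
rewrite mulrA -mulrDl ler_pM2r // invr_gt0; move: Hd; clear -Hf HZ; intros; lra.
Qed.

Lemma universal_mart : supermart universal.
Proof.
split=> s Hs; last first.
  rewrite addr_ge0 ?(ltW (ip2_gt0 _)) //; apply: (ksum_ge0 (Z := W)); first by have H := CQ_share; comp.
  by move=> i _; rewrite mulr_ge0 ?share_ge0 // ltW // ip2_gt0.
rewrite /universal lh0 // lh1 //; set l := lh s.
have HC t : CQ W (fun p => ip2 p * share p t) by have H := CQ_share; comp.
rewrite (ksumS (l + 1) (HC (s + s))) (ksumS (l + 1) (HC (s + s + 1))).
have P : ksum (fun p => ip2 p * share p (s + s)) (l + 1) + ksum (fun p => ip2 p * share p (s + s + 1)) (l + 1)
    <= 2 * ksum (fun p => ip2 p * share p s) (l + 1).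
  rewrite -(ksumD (l + 1) (HC _) (HC _)) -(ksumM 2 (l + 1) (HC _)).
  have H0 := HC (s + s); have H1 := HC (s + s + 1); have H2 := HC s.
  apply: (ksum_le (Z := W)); [by comp|by comp|move=> p Lp].
  rewrite -mulrDr mulrCA ler_pM2l ?ip2_gt0 //; apply: share_mart => //.
  by move: Lp; rewrite -/l; clear -Hf HZ; intros; nlra.
have E := ip2S l; have I := ip2_gt0 (l + 1).
(* At each child the old reserve 2^-l splits into the new reserve and the capital, at most 2^-(l+1),
   of the player entering there. *)
have S0 : ip2 (l + 1) * share (l + 1) (s + s) <= ip2 (l + 1).
  by rewrite ger_pMr // share_self // lh0.
have S1 : ip2 (l + 1) * share (l + 1) (s + s + 1) <= ip2 (l + 1).
  by rewrite ger_pMr // share_self // lh1.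
move: P S0 S1 E; move: (ip2 (l + 1) * share (l + 1) (s + s)) (ip2 (l + 1) * share (l + 1) (s + s + 1)) (ip2 (l + 1)) (ip2 l) => x y i j.
move: (ksum _ _) (ksum _ _) (ksum _ _).
by clear -Hf HZ; intros; lra.
Qed.

Lemma universal_one : universal 1 <= 2.
Proof.
have HC : CQ W (fun p => ip2 p * share p 1) by have H := CQ_share; comp.
rewrite /universal lh_one (ksumS 0 HC) (ksum0 HC) ip20 mul1r add0r.
have : share 0 1 <= 1 by apply: share_self; rewrite lh_one.
by clear -Hf HZ; lra.
Qed.

Lemma share_universal p s : p ⪯ lh s -> ip2 p * share p s <= universal s.
Proof.
move=> L; have HC : CQ W (fun p => ip2 p * share p s) by have H := CQ_share; comp.
have := ksum_ge_term HC (j := p) (n := lh s + 1).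
have H0 i : 0 <= ip2 i * share i s by rewrite mulr_ge0 ?share_ge0 // ltW // ip2_gt0.
have Lp : p ≺ lh s + 1 by nlra.
move=> /(_ H0 Lp) H; apply: le_trans H _; rewrite /universal lerDl ltW //; exact: ip2_gt0.
Qed.
End Strategy.
End Universal.

(** * Passage to a computably random set *)

Section ComputableFromSchnorr.
Variable M : model.
Local Notation N := (carrier M).
Local Notation K := (ratio M).
Implicit Types (b d e i j k l m n u v s x y z p : N) (X Y Z W S : set_of M).

Section Index.
Variables (Z S : set_of M) (e : N) (B : N -> K).
Hypothesis eS : forall n, (inS n S -> scomputes Z e n 1) /\ (~ inS n S -> scomputes Z e n 0).
Hypothesis SB : supermart B.
Hypothesis B_unique : forall s (t : frac M), 0 ≺ s -> fvalid t -> inS (spr s (scode t)) S -> qv t = B s.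
Hypothesis B_ex : forall s, 0 ≺ s -> exists t, [/\ fvalid t, qv t = B s & inS (spr s (scode t)) S].

Lemma value_wit_unique s u : 0 ≺ s -> value_wit Z e s u -> qval (p2 u) = B s.
Proof.
move=> Hs Hu; have H1 := value_wit_computes Hu; have [_ [[t [V E]] _]] := Hu.
rewrite E qval_scode; apply: B_unique => //; rewrite -E; apply: contrapT => C.
have [_ /(_ C) H0] := eS (spr s (p2 u)).
by have := @ltN01 M; rewrite (cmp_unique H1 H0) => /ltNn.
Qed.
Lemma value_wit_ex s : 0 ≺ s -> exists u, value_wit Z e s u.
Proof.
move=> Hs; have [t [V Q Ht]] := B_ex Hs; have [/(_ Ht) [d [H1 /bgoodE H2]] _] := eS (spr s (scode t)).
exists (spr d (scode t)); rewrite /value_wit !(p1E, p2E); split=> //; split; first by exists t.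
by rewrite qval_scode Q; apply: (proj2 SB).
Qed.
(** An index that decides a genuine supermartingale accepts only one rational at each string, so
    every witness, in particular the least, shows the right value. *)
Lemma val_index s : 0 ≺ s -> val Z e s = B s.
Proof.
move=> Hs; have D : CP Z (fun u => value_wit Z e s u) by apply: (CP_value_wit (oracle_self Z)); comp.
have [u [Hu Lu]] := cp_least D (value_wit_ex Hs).
by rewrite (valE (u := u)) // (value_wit_unique Hs Hu).
Qed.
(** A common bound for the witnesses at all strings of length at most [n]: Sigma_1 bounding, by
    induction on the number of strings treated. *)
Lemma converges_below_ex n : exists b, converges_below Z e n b.
Proof.
have D : CP2 Z (fun b k => forall s, s ≺ k -> 0 ≺ s -> exists u, u ≺ b /\ value_wit Z e s u).
  by comp; apply: (CP_value_wit (oracle_self Z)); comp.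
apply: (cp_sigma_ind D) (pow2 (n + 1)) => [|k [b Hb]]; first by exists 0 => s L Hs; exfalso; nlra.
have [u Hu] : exists u, 0 ≺ k -> value_wit Z e k u.
  have [H|H] := pselect (0 ≺ k); last by exists 0.
  by have [u Hu] := value_wit_ex H; exists u.
exists (b + u + 1) => s L Hs; have [E|E] := pselect (s = k).
  by exists u; subst s; split; [nlra|exact: Hu].
have Ls : s ≺ k by case: (ltN_cmp s k) => // L'; exfalso; nlra.
by have [v [Lv Hv]] := Hb s Ls Hs; exists v; split=> //; nlra.
Qed.
End Index.

Lemma computably_random_of_schnorr Z X S : sschnorr_random X Z -> ssupermartingale S -> sleT S Z -> ssucceeds S X ->
  exists Y, scomputably_random Y Z.
Proof.
move=> XR S1 S2 SX.
have [B [HB SB _ _ BX]] := mart_fun S1 (proj2 (CP_leT _ _) S2).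
have [C0 HC0] := iota_unbounded (B 1).
pose C := C0 + 1; have HC : 0 ≺ C by apply/ltN_S; rewrite add0r /C addrC; exact: leN_addr.
have BC : B 1 <= iota C by apply: le_trans HC0 _; apply/leNK; exact: leN_addr.
have [W [WZ WX]] := join Z X.
have HBW := CQ_trans WZ HB.
have D : CP2 W (fun k n => iota (C * pow2 k) < B (rs X n)) by comp; apply: Comp_rs; comp.
have [|f [Hf Hmin]] := Comp_least D; first by move=> k; have [n Hn] := BX _ SX (C * pow2 k); exists n.
(* Capital along [X] exceeds C 2^n at length [f n], but for almost all n it does not do so at any
   length below [g n]. *)
have dom g : Comp Z g -> exists n0, forall n, n0 ⪯ n -> g n ⪯ f n.
  move=> Hg; have [n0 H] := schnorr_domination XR HB SB Hg HC BC.
  exists n0 => n L; apply/leN_ltN => L'; have := H n L _ L'.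
  by have [H1 _] := Hmin n; rewrite real_leNgt ?num_real // H1.
have [Y [WY HY]] := follow (CQ_universal WZ Hf) (universal_mart WZ Hf).
exists Y => T T1 T2 TY.
have [A [HA SA UA EA AY]] := mart_fun T1 (proj2 (CP_leT _ _) T2).
have [e He] := T2.
have Ev s := val_index He SA UA EA (s := s).
(* The least convergence bound [g] of the index is computable in [Z] alone, which is what allows [f]
   to dominate it. *)
have Dc : CP2 Z (converges_below Z e) by apply: (CP_converges_below (oracle_self Z)); comp.
have [|g [Hg Hgm]] := Comp_least Dc; first exact: (converges_below_ex He SA EA).
have [n0 Hn0] := dom g Hg.
have Hconv n : n0 ⪯ n -> converges_below Z e n (f n).
  move=> L s Ls Hs; have [Hc _] := Hgm n; have [u [Lu Hu]] := Hc s Ls Hs.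
  by exists u; split=> //; move: (Hn0 n L) Lu; move: (g n) (f n); clear; intros; nlra.
(* This player enters at a length of at least [n0], where [f] already dominates [g], and so it never
   dies. *)
pose p := spr e n0.
have Halive n : alive Z f p n.
  move=> m _ L; rewrite p1E; split; first by apply: Hconv; apply: leN_trans (spr_ler e n0) L.
  move=> s Ls Hs; rewrite !Ev //; first exact: (proj1 SA).
  - by apply: (kid_gt0 Hs); right.
  - by apply: (kid_gt0 Hs); left.
pose c := A (rs Y p) + 1.
have c0 : 0 < c by rewrite ltr_wpDl ?ltr01 //; apply: (proj2 SA); exact: rs_gt0.
(* [k1] bounds the capital from length p on, where 2^-p times the share is at most the universal
   capital and hence at most 2; [k2] bounds it at shorter lengths, where capital has doubled at most
   p times. *)
have [k1 Hk1] := iota_unbounded (2 * iota (pow2 p) * c).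
have [k2 Hk2] := iota_unbounded (iota (pow2 p) * A 1).
have [n Hn] := AY Y TY (k1 + k2).
suff : A (rs Y n) <= iota (k1 + k2) by rewrite real_leNgt ?num_real // Hn.
rewrite iotaD; have K1 := iota_ge0 k1; have K2 := iota_ge0 k2.
case: (leN_total p n) => L.
- suff H : A (rs Y n) <= 2 * iota (pow2 p) * c by move: H K2 Hk1; clear; lra.
  have Lp : p ⪯ lh (rs Y n) by rewrite lh_rs.
  have := share_universal WZ Hf (s := rs Y n) Lp.
  move=> H; have {}H := le_trans H (le_trans (HY n) (universal_one WZ Hf)).
  rewrite /share lh_rs iteT in H; last by split=> //; split=> //; exact: rs_gt0.
  have Ha : anc (rs Y n) (nsub n p) = rs Y p.
    have Hj : nsub n p ⪯ lh (rs Y n) by rewrite lh_rs; apply: nsub_le.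
    have Hp := anc_pos (rs_gt0 Y n) Hj.
    have Hpre : pre (anc (rs Y n) (nsub n p)) (rs Y n) by apply/preE; split=> //; exists (nsub n p).
    rewrite (rs_pre Hpre); congr (rs Y _).
    have := anc_lh Hp; rewrite lh_rs; case: (nsubP n p) => [|[L' _]]; last by exfalso; nlra.
    by move: (nsub n p) => b E Eb; apply: (addNI (z := b)); rewrite Eb -E addrC.
  rewrite Ha !p1E !Ev -/c in H; try exact: rs_gt0.
  have P := ip_gt0 p; have I := ip2_pow p.
  rewrite -(ler_pM2l P) !mulrA I mul1r ler_pdivrMr // in H.
  by apply: le_trans H _; rewrite (mulrC 2).
- have L2 := supermart_growth HA SA (rs_gt0 Y n); rewrite lh_rs in L2.
  have : iota (pow2 n) <= iota (pow2 p) :> K by apply/leNK; exact: pow2_mono L.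
  have A1 : 0 <= A 1 by apply: (proj2 SA); exact: ltN01.
  move=> /(ler_wpM2r A1); move: L2 K1 Hk2; clear; lra.
Qed.

(** The argument is classical and not uniform: either [X] itself is computably random, or the
    supermartingale that succeeds on it provides the fast-growing function from which [Y] is
    built. *)
Lemma CR_of_SR Z : (exists X, sschnorr_random X Z) -> exists Y, scomputably_random Y Z.
Proof.
move=> [X XR]; apply: contrapT => C; apply: (C); exists X => S S1 S2 S3.
exact: C (computably_random_of_schnorr XR S1 S2 S3).
Qed.
End ComputableFromSchnorr.

Local Close Scope ring_scope.

(** * From truth in all models to provability *)

Lemma fbelow_iterN m k p a : fbelow (a + m) k p -> fbelow m k (Nat.iter a FAllN p).
Proof.
elim: a m => [|a IH] m //= H; apply: IH; by rewrite addnS.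
Qed.
Lemma fbelow_iterS m k p b : fbelow m (b + k) p -> fbelow m k (Nat.iter b FAllS p).
Proof.
elim: b k => [|b IH] k //= H; apply: IH; by rewrite addnS.
Qed.
Lemma RCA0_closed q : RCA0 q -> closed q.
Proof.
have C p c : is_closure p c -> closed c.
  by move=> [m [k [H ->]]]; apply: fbelow_iterN; apply: fbelow_iterS; rewrite !addn0.
case=> [p|p c _ /C|p p' c _ _ /C] //.
move=> H; rewrite /closed; repeat (case: H => [<-|H]; first by rewrite /=; lia); by [].
Qed.

Lemma provable_semantic (p : fm) : (forall (M : model) rho eta, @sat M rho eta p) -> provable RCA0 p.
Proof.
move=> H; apply: completeness => [q|M HM rho eta]; first exact: RCA0_closed.
exact: (H (Model (eta 0) HM)).
Qed.

Theorem theorem5p4 :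
  provable RCA0 (FImp SR CR) /\ provable RCA0 (FIff SR CR).
Proof.
have H (M : model) rho eta : @sat M rho eta SR -> @sat M rho eta CR.
  by move=> /sat_SR S; apply/sat_CR => Z; apply: CR_of_SR.
split; apply: provable_semantic => M rho eta; first exact: H.
rewrite sat_iff; split; first exact: H.
move=> /sat_CR S; apply/sat_SR => Z; have [X HX] := S Z.
by exists X; apply: computably_random_schnorr.
Qed.
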